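(* $$p_a^+(\vec{\mathbb{Z}}^n)=\frac{\sqrt{2}}{n}\cdot(1+o(1))\quad\text{as } n\to\infty.$$
   Context: The directed lattice $\vec{\mathbb{Z}}^n$ has vertex set $\mathbb{Z}^n$ and edge set consisting of all directed edges $(x,y)$ such that $\{x,y\}$ is a nearest-neighbour edge of $\mathbb{Z}^n$ and $x_i\le y_i$ for every $1\le i\le n$. For a directed graph $G=(V,\vec{E})$, an oriented bond percolation model is a probability measure $\mathrm{P}$ on $\{0,1\}^{\vec{E}}$ with the product $\sigma$-algebra ($\omega(e)=1$: $e$ open). Graph distances in $G$ are taken in the corresponding undirected graph; the distance between two edges is the minimal distance between an endpoint of one and an endpoint of the other, and the distance between edge sets is the infimum over pairs. $\mathrm{P}$ is 1-independent if the edge statuses in $F_1$ are independent of those in $F_2$ whenever $F_1,F_2$ are disjoint sets of edges at distance at least $1$ (i.e. sharing no vertex). $\mathrm{P}$ is positively associated if $\mathrm{P}[A_1\cap A_2]\ge\mathrm{P}[A_1]\mathrm{P}[A_2]$ for all events $A_1,A_2$ increasing in $\omega$ (coordinatewise order). $\mathrm{P}$ percolates if with positive probability there is a vertex from which infinitely many vertices are reachable by open directed paths. $\mathcal{P}_a(G,p)$ is the set of positively associated, 1-independent bond percolation models $\mathrm{P}$ on $G$ with $\mathrm{P}[\omega(e)=1]\ge p$ for all edges $e$, and $$p_a^+(G):=\sup\{p:\ \exists\,\mathrm{P}\in\mathcal{P}_a(G,p)\text{ that does not percolate}\}.$$ *)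

(* Defs.v *)
From HB Require Import structures.
From mathcomp Require Import all_boot all_order all_algebra.
From mathcomp Require Import all_classical all_reals all_analysis.

Set Implicit Arguments.
Unset Strict Implicit.
Unset Printing Implicit Defensive.

Import Order.TTheory GRing.Theory Num.Theory.
Import numFieldNormedType.Exports.

Local Open Scope classical_set_scope.
Local Open Scope ring_scope.

(* Vertex sets are countable, so that the percolation event below is
   measurable and its probability is meaningful. *)
Record digraph := Digraph { vertex : countType; arc : rel vertex }.

Definition edge (G : digraph) := {e : vertex G * vertex G | arc e.1 e.2}.

Section Distances.
Context (R : realType) (G : digraph).
Implicit Types (x y : vertex G) (e f : edge G) (F : set (edge G)).

Definition adj : rel (vertex G) := [rel x y | arc x y || arc y x].

(* Equal to +oo when x and y lie in different components. *)
Definition vertex_dist x y : \bar R :=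
  ereal_inf [set (size s)%:R%:E | s in [set s | path adj x s /\ last x s = y]].

Definition endpoints e : set (vertex G) := [set (val e).1; (val e).2].

Definition edge_dist e f : \bar R :=
  ereal_inf [set vertex_dist x y | x in endpoints e & y in endpoints f].

Definition edges_dist F1 F2 : \bar R :=
  ereal_inf [set edge_dist e f | e in F1 & f in F2].

End Distances.

Section Percolation.
Context (G : digraph).

(* Generators of the sigma-algebra of the statuses of the edges in F. *)
Definition status_events (F : set (edge G)) : set (set (edge G -> bool)) :=
  \bigcup_(e in F) preimage_set_system setT (fun w => w e) measurable.

(* {0,1}^E with the product sigma-algebra. *)
Definition config := g_sigma_algebraType (status_events setT).

Definition increasing_event (A : set config) :=
  forall w w' : config, (forall e, w e ==> w' e) -> A w -> A w'.

Definition open_step (w : config) : rel (vertex G) :=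
  fun x y => oapp w false (insub (x, y)).

Definition reachable (w : config) (x : vertex G) : set (vertex G) :=
  [set y | exists2 s, path (open_step w) x s & last x s = y].

Context (R : realType).
Implicit Types (P : probability config R) (p : R).

Definition percolates P :=
  (0 < P [set w : config | exists x, infinite_set (reachable w x)])%E.

Definition independent_at k P :=
  forall F1 F2 : set (edge G),
    F1 `&` F2 = set0 -> (k%:R%:E <= edges_dist R F1 F2)%E ->
  forall A1 A2 : set config,
    <<s status_events F1 >> A1 -> <<s status_events F2 >> A2 ->
    P (A1 `&` A2) = (P A1 * P A2)%E.

Definition positively_associated P :=
  forall A1 A2 : set config, measurable A1 -> measurable A2 ->
    increasing_event A1 -> increasing_event A2 ->
    (P A1 * P A2 <= P (A1 `&` A2))%E.

Definition Pa p : set (probability config R) :=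
  [set P | [/\ positively_associated P, independent_at 1 P &
               forall e : edge G, (p%:E <= P [set w : config | w e])%E]].

End Percolation.

Definition pa_plus (R : realType) (G : digraph) : R :=
  sup [set p : R | 0 <= p <= 1 /\
                   exists2 P : probability (config G) R, Pa p P & ~ percolates P].

Definition lattice_arc n : rel 'rV[int]_n :=
  fun x y => (\sum_i `|x 0 i - y 0 i| == 1) && [forall i, x 0 i <= y 0 i].

Definition dlattice n := @Digraph 'rV[int]_n (@lattice_arc n).

(* Main.v *)
(** Upper bound: let p = (1 + d) sqrt 2 / n. Reserve a small proportion of the
    coordinates as special ones, and consider paths made of blocks, a block being m
    distinct main steps taken in any order followed by one special step. Steps that
    share no vertex are independent, and positive association controls the others, so
    two orders of the same m steps are strongly correlated only if they share a vertex
    at every step. At most 2^(m/2) orders do so pairwise (each pair of consecutive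
    steps may be swapped or not), whence the main part of a block is open with
    probability at least about m! p^m / 2^(m/2), and the expected number of open main
    parts is about (n p / sqrt 2)^m = (1 + d)^m. A weighted second moment over block
    paths then shows percolation: paths interact only while their special coordinates
    agree, and the difference of the special coordinates of two paths is a random walk
    in large dimension, which hardly ever returns to 0.

    Lower bound: let every vertex of even level carry two independent bits that are 1
    with probability p, and open its outgoing edges if the first is 1, its incoming
    edges if the second is 1. From an even vertex, the expected number of vertices
    reached by open paths of length 2 is p^2 n (n + 1) / 2, so there is no percolation
    when p < sqrt (2 / (n (n + 1))). *)

From HB Require Import structures.
Require Import Defs.
From mathcomp Require Import all_boot all_order all_algebra.
From mathcomp Require Import all_classical all_reals all_analysis.
From mathcomp Require Import measurable_realfun.
From mathcomp Require Import ring lra zify.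

Set Implicit Arguments.
Unset Strict Implicit.
Unset Printing Implicit Defensive.

Import Order.TTheory GRing.Theory Num.Theory.
Import numFieldNormedType.Exports.

Local Open Scope classical_set_scope.
Local Open Scope ring_scope.

(** Independence requires edge sets without a common vertex, and probabilities of open steps and
    routes are known only from below, so the probability that two touching paths are both open
    neither factors nor has an explicit bound. It is therefore compared with the product of the two
    true probabilities: where the paths touch, part of the second event is given up, and positive
    association controls the loss. Such comparisons multiply along concatenated paths, and both
    moment arguments weight each path by the inverse of its true probability.

    The estimates inside a block are crude: they lose factors like 5^m (m!)^2. This is harmless
    because m is fixed before n. Different routes from one vertex end at different vertices, and
    special coordinates that have separated return with probability too small for these constants to
    matter. Only the coincidence of two complete routes has to be priced sharply, at the inverse of
    the route probability; there the factor 2^(m/2), hence sqrt 2, enters. *)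

(** * Real-valued probabilities and local events *)

Definition pr d (T : measurableType d) (R : realType) (P : probability T R)
  (A : set T) : R := fine (P A).

Section RealProbability.
Context d (T : measurableType d) (R : realType) (P : probability T R).
Implicit Types (A B D : set T) (c : R).
Local Notation pr := (pr P).

Lemma prE A : measurable A -> (pr A)%:E = P A.
Proof. by move=> mA; rewrite fineK// fin_num_measure. Qed.

Lemma pr_ge0 A : 0 <= pr A.
Proof. exact: fine_ge0. Qed.

Lemma le_pr A B : measurable A -> measurable B -> A `<=` B -> pr A <= pr B.
Proof. by move=> mA mB AB; rewrite -lee_fin !prE// le_measure// inE. Qed.

Lemma prT : pr setT = 1.
Proof. by rewrite /pr probability_setT. Qed.

Lemma pr0 : pr set0 = 0.
Proof. by rewrite /pr measure0. Qed.

Lemma pr_le1 A : measurable A -> pr A <= 1.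
Proof. by move=> mA; rewrite -prT; apply: le_pr. Qed.

Lemma prID A B : measurable A -> measurable B ->
  pr A = pr (A `&` B) + pr (A `\` B).
Proof.
move=> mA mB; apply: EFin_inj; rewrite EFinD !prE//.
- by rewrite addeC; apply: measureDI.
- exact: measurableD.
- exact: measurableI.
Qed.

(** Takes the place of expectations of simple functions: each moment argument below is an inequality
    between finite combinations of indicators, carried over to probabilities by this lemma. *)
Lemma pr_lin (s : seq (R * set T)) :
  (forall u, u \in s -> measurable u.2) ->
  (forall w, 0 <= \sum_(u <- s) u.1 * (w \in u.2)%:R) ->
  0 <= \sum_(u <- s) u.1 * pr u.2.
Proof.
(* [D] is a cell on which the events already treated are constant; their coefficients are absorbed
   in [c]. *)
have gen c D : measurable D -> (forall u, u \in s -> measurable u.2) ->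
    (forall w, D w -> 0 <= c + \sum_(u <- s) u.1 * (w \in u.2)%:R) ->
    0 <= c * pr D + \sum_(u <- s) u.1 * pr (u.2 `&` D).
  elim: s c D => [|[a A] s IH] c D mD ms pos.
    rewrite big_nil addr0.
    have [->|/set0P[w Dw]] := eqVneq D set0; first by rewrite pr0 mulr0.
    by have := pos w Dw; rewrite big_nil addr0 => c0; rewrite mulr_ge0// pr_ge0.
  have mA : measurable A by apply: (ms (a, A)); rewrite mem_head.
  have ms' u : u \in s -> measurable u.2.
    by move=> us; apply: ms; rewrite in_cons us orbT.
  rewrite big_cons/=.
  have h1 := IH (c + a) (D `&` A) (measurableI _ _ mD mA) ms'.
  have h2 := IH c (D `\` A) (measurableD mD mA) ms'.
  have {}h1 : 0 <= (c + a) * pr (D `&` A) +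
      \sum_(u <- s) u.1 * pr (u.2 `&` (D `&` A)).
    apply: h1 => w [Dw Aw]; have := pos w Dw; rewrite big_cons/= mem_set//.
    by rewrite mulr1 addrA.
  have {}h2 : 0 <= c * pr (D `\` A) +
      \sum_(u <- s) u.1 * pr (u.2 `&` (D `\` A)).
    apply: h2 => w [Dw Aw]; have := pos w Dw; rewrite big_cons/= memNset//.
    by rewrite mulr0 add0r.
  rewrite (prID mD mA) (setIC A).
  have -> : \sum_(u <- s) u.1 * pr (u.2 `&` D) =
      \sum_(u <- s) u.1 * pr (u.2 `&` (D `&` A)) +
      \sum_(u <- s) u.1 * pr (u.2 `&` (D `\` A)).
    rewrite -big_split/= !big_seq; apply: eq_bigr => u us.
    rewrite (@prID (u.2 `&` D) A)//; last by apply: measurableI => //; exact: ms'.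
    by rewrite mulrDr setIA setIDA.
  rewrite [leRHS](_ : _ = ((c + a) * pr (D `&` A) +
      \sum_(u <- s) u.1 * pr (u.2 `&` (D `&` A))) +
      (c * pr (D `\` A) + \sum_(u <- s) u.1 * pr (u.2 `&` (D `\` A)))).
    exact: addr_ge0.
  ring.
move=> ms pos; have := gen 0 setT measurableT ms.
rewrite mul0r add0r; under eq_bigr do rewrite setIT; apply => w _.
by rewrite add0r.
Qed.

End RealProbability.

Section LocalEvents.
Context (G : digraph).
Implicit Types (V : set (vertex G)) (A B : set (config G)) (e : edge G).

Definition edges_in V : set (edge G) := [set e | endpoints e `<=` V].

(** Only edges with both ends in [V] count, so that disjoint vertex sets give edge sets without a
    common vertex, as 1-independence requires. Monotonicity is carried along for positive
    association. *)
Definition local_event V A :=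
  <<s status_events (edges_in V) >> A /\ increasing_event A.

Lemma status_eventsS (F1 F2 : set (edge G)) : F1 `<=` F2 ->
  <<s status_events F1 >> `<=` <<s status_events F2 >>.
Proof.
move=> F12; apply: sub_sigma_algebra2 => A [e Fe eA].
by exists e => //; apply: F12.
Qed.

Lemma status_measurable (F : set (edge G)) A :
  <<s status_events F >> A -> measurable A.
Proof. by apply: status_eventsS. Qed.

Lemma local_measurable V A : local_event V A -> measurable A.
Proof. by case=> sA _; apply: status_measurable sA. Qed.

Lemma local_eventS V1 V2 A : V1 `<=` V2 -> local_event V1 A -> local_event V2 A.
Proof.
move=> V12 [sA iA]; split=> //; apply: status_eventsS sA => e eV v /eV.
exact: V12.
Qed.

Lemma increasingT : increasing_event [set: config G].
Proof. by []. Qed.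

Lemma increasingI A B : increasing_event A -> increasing_event B ->
  increasing_event (A `&` B).
Proof. by move=> iA iB w w' ww' [/(iA _ _ ww') Aw /(iB _ _ ww') Bw]. Qed.

Lemma increasingU A B : increasing_event A -> increasing_event B ->
  increasing_event (A `|` B).
Proof.
by move=> iA iB w w' ww' [/(iA _ _ ww') Aw|/(iB _ _ ww') Bw]; [left|right].
Qed.

Lemma local_eventT V : local_event V setT.
Proof.
split; last exact: increasingT.
exact: (@measurableT _ (g_sigma_algebraType (status_events (edges_in V)))).
Qed.

Lemma local_event0 V : local_event V set0.
Proof.
split=> //.
exact: (@measurable0 _ (g_sigma_algebraType (status_events (edges_in V)))).
Qed.

Lemma local_eventI V A B : local_event V A -> local_event V B ->
  local_event V (A `&` B).
Proof.
move=> [sA iA] [sB iB]; split; last exact: increasingI.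
exact: (@measurableI _ (g_sigma_algebraType (status_events (edges_in V)))).
Qed.

Lemma local_eventU V A B : local_event V A -> local_event V B ->
  local_event V (A `|` B).
Proof.
move=> [sA iA] [sB iB]; split; last exact: increasingU.
exact: (@measurableU _ (g_sigma_algebraType (status_events (edges_in V)))).
Qed.

Definition is_open e : set (config G) := [set w | w e].

Lemma status_open (F : set (edge G)) e : F e -> <<s status_events F >> (is_open e).
Proof.
move=> Fe; apply: sub_sigma_algebra; exists e => //.
by exists [set true] => //; rewrite setTI.
Qed.

Lemma local_open e : local_event (endpoints e) (is_open e).
Proof.
split; first by apply: status_open.
by move=> w w' ww'; rewrite /is_open/=; exact/implyP/ww'.
Qed.

Lemma measurable_is_open e : measurable (is_open e).
Proof. exact: local_measurable (local_open e). Qed.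

Context (R : realType) (P : probability (config G) R).

Lemma pr_local_independent V1 V2 A1 A2 : independent_at 1 P ->
  V1 `&` V2 = set0 -> local_event V1 A1 -> local_event V2 A2 ->
  pr P (A1 `&` A2) = pr P A1 * pr P A2.
Proof.
move=> indP V12 [s1 _] [s2 _].
have V12' v : V1 v -> V2 v -> False.
  by move=> V1v V2v; have : (V1 `&` V2) v by []; rewrite V12.
apply: EFin_inj; rewrite EFinM !prE.
- apply: (indP (edges_in V1) (edges_in V2)) => //.
  + apply/seteqP; split=> // e [e1 e2].
    have h : endpoints e (val e).1 by left.
    by apply: (V12' (val e).1); [exact: e1|exact: e2].
  + apply: le_ereal_inf_tmp => _ [e e1 [f f2 <-]].
    apply: le_ereal_inf_tmp => _ [x ex [y fy <-]].
    apply: le_ereal_inf_tmp => _ [s [_ sy] <-].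
    (* A path of length 0 would be a vertex common to [V1] and [V2]. *)
    rewrite lee_fin ler_nat; case: s sy => //= xy; exfalso.
    by apply: (V12' x); [exact: e1|rewrite xy; exact: f2].
- exact: status_measurable s2.
- exact: status_measurable s1.
- by apply: measurableI; [exact: status_measurable s1|exact: status_measurable s2].
Qed.

Lemma pr_associated A1 A2 : positively_associated P ->
  measurable A1 -> measurable A2 -> increasing_event A1 -> increasing_event A2 ->
  pr P A1 * pr P A2 <= pr P (A1 `&` A2).
Proof.
move=> paP m1 m2 i1 i2; rewrite -lee_fin EFinM !prE//; first exact: paP.
exact: measurableI.
Qed.

Lemma pr_open p e : Pa p P -> p <= pr P (is_open e).
Proof.
move=> [_ _ /(_ e)]; rewrite -[P _]prE ?lee_fin//.
exact: measurable_is_open.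
Qed.

End LocalEvents.

(** * Decoupling pairs of paths *)

Section Lattice.
Context (n : nat).
Local Notation V := 'rV[int]_n.
Local Notation cfg := (config (dlattice n)).
Implicit Types (x y z : V) (i j : 'I_n).

Definition unitv i : V := delta_mx 0 i.

Definition level x : int := \sum_j x 0 j.

Lemma levelD x y : level (x + y) = level x + level y.
Proof. by rewrite /level -big_split/=; apply: eq_bigr => j _; rewrite mxE. Qed.

Lemma level_unitv i : level (unitv i) = 1.
Proof.
rewrite /level (bigD1 i)//= big1 => [|j ji]; rewrite mxE eqxx ?eqxx ?addr0//.
by rewrite (negbTE ji).
Qed.

Lemma level_step x i : level (x + unitv i) = level x + 1.
Proof. by rewrite levelD level_unitv. Qed.

Lemma arc_step x i : lattice_arc x (x + unitv i).
Proof.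
apply/andP; split; last first.
  by apply/forallP => j; rewrite !mxE lerDl; case: (_ && _).
apply/eqP; rewrite -[RHS](level_unitv i) /level; apply: eq_bigr => j _.
by rewrite !mxE opprD addrA subrr add0r normrN; case: (_ && _).
Qed.

Definition stepe x i : edge (dlattice n) :=
  exist (fun e : V * V => is_true (lattice_arc e.1 e.2)) (x, x + unitv i) (arc_step x i).

Definition open_at x i : set cfg := is_open (stepe x i).

Lemma measurable_open_at x i : measurable (open_at x i).
Proof. exact: measurable_is_open. Qed.

Lemma increasing_open_at x i : increasing_event (open_at x i).
Proof. by case: (local_open (stepe x i)). Qed.

(** Sets attached to consecutive pieces of two paths can then meet only at the junction level, and
    only if the two junction vertices coincide. *)
Definition slab x z (U : set V) := forall v, U v ->
  [/\ level x <= level v <= level z, level v = level x -> v = x &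
      level v = level z -> v = z].

Lemma slab_cat x y z (U1 U2 : set V) : level x < level y -> level y < level z ->
  slab x y U1 -> slab y z U2 -> slab x z (U1 `|` U2).
Proof.
move=> xy yz s1 s2 v [/s1[/andP[a b] c d]|/s2[/andP[a b] c d]]; split=> //.
- by rewrite a (le_trans b (ltW yz)).
- by move=> vz; move: yz; rewrite ltNge -vz b.
- by rewrite b andbT (le_trans (ltW xy) a).
- by move=> vx; move: xy; rewrite ltNge -vx a.
Qed.

Context (R : realType) (P : probability cfg R).
Hypotheses (paP : positively_associated P) (indP : independent_at 1 P).
Local Notation pr := (pr P).
Implicit Types (A B K : set cfg) (f : R).

(* [decoupled x x' z z' A A' D f] witnesses pr D <= f * pr A * pr A' for
   events A, A' about paths from x to z and from x' to z', where D is the part of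
   A `&` A' under consideration: on each piece of a cover of D, an event B
   implying A is kept, and A' is weakened to an event K living off the vertices
   of B, at the price of the inverse probability of the part Rm of A' given up. *)
Inductive decoupled x x' z z' A A' : set cfg -> R -> Prop :=
| Decoupled_atom (U U' : set V) B K Rm D f of measurable D
    & slab x z U & slab x' z' U' & U `&` U' = set0
    & (x = x' -> ~ U' x') & (z = z' -> ~ U' z')
    & local_event (U : set (vertex (dlattice n))) B
    & local_event (U' : set (vertex (dlattice n))) K
    & measurable Rm & increasing_event Rm
    & D `<=` B `&` K & B `<=` A & K `&` Rm `<=` A'
    & 0 <= f & 1 <= f * pr Rm : decoupled x x' z z' A A' D f
| Decoupled_empty f of 0 <= f : decoupled x x' z z' A A' set0 f
| Decoupled_cover D1 f1 D2 f2 D f of measurable D & D `<=` D1 `|` D2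
    & decoupled x x' z z' A A' D1 f1 & decoupled x x' z z' A A' D2 f2
    & f1 + f2 <= f : decoupled x x' z z' A A' D f.

Section DecoupledTheory.
Variables (x x' z z' : V).
Local Notation decoupled := (decoupled x x' z z').

Lemma decoupled_measurable A A' D f : decoupled A A' D f -> measurable D.
Proof. by case. Qed.

Lemma decoupled_ge0 A A' D f : decoupled A A' D f -> 0 <= f.
Proof.
elim=> // D1 f1 D2 f2 {}D {}f _ _ _ f10 _ f20.
by apply: le_trans; rewrite addr_ge0.
Qed.

Lemma decoupledS A A' A1 A1' D f : A `<=` A1 -> A' `<=` A1' ->
  decoupled A A' D f -> decoupled A1 A1' D f.
Proof.
move=> AA1 AA1'; elim=> {D f}.
- move=> U U' B K Rm D f mD sU sU' UU' xx zz lB lK mR iR DBK BA KR f0 f1.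
  apply: (@Decoupled_atom _ _ _ _ _ _ U U' B K Rm D f) => //.
    exact: subset_trans AA1.
  exact: subset_trans AA1'.
- by move=> f f0; apply: Decoupled_empty.
- move=> D1 f1 D2 f2 D f mD DD _ d1 _ d2 ff.
  exact: (Decoupled_cover mD DD d1 d2 ff).
Qed.

Lemma decoupled_cover_seq (I : eqType) (s : seq I) (C : I -> set cfg)
    (g : I -> R) A A' D : measurable D ->
  D `<=` [set w | exists2 k, k \in s & C k w] ->
  (forall k, k \in s -> decoupled A A' (C k) (g k)) ->
  decoupled A A' D (\sum_(k <- s) g k).
Proof.
elim: s D => [|k s IH] D mD sD gd.
  rewrite big_nil; have -> : D = set0 by apply/seteqP; split=> // w /sD[].
  exact: Decoupled_empty.
rewrite big_cons.
have gdi l : l \in s -> decoupled A A' (C l) (g l).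
  by move=> ls; apply: gd; rewrite in_cons ls orbT.
have fs : finite_set [set l | l \in s] by exact: finite_seq.
have mT : measurable (\bigcup_(l in [set l | l \in s]) C l).
  by apply: fin_bigcup_measurable => // j /gdi /decoupled_measurable.
apply: (Decoupled_cover mD _ (gd k (mem_head _ _)) (IH _ mT _ gdi)) => //.
  move=> w /sD[l]; rewrite in_cons => /predU1P[->|ls] Cl; first by left.
  by right; exists l.
Qed.

(** On an atom, independence factors [B] and [K], and positive association gives
    [pr K * pr Rm <= pr A'], so passing from [K] back to [A'] costs at most the factor [f]. *)
Lemma decoupled_pr A A' D f : measurable A -> measurable A' ->
  decoupled A A' D f -> pr D <= f * (pr A * pr A').
Proof.
move=> mA mA'; elim=> {D f}.
- move=> U U' B K Rm D f mD sU sU' UU' xx zz lB lK mR iR DBK BA KR f0 f1.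
  have mB := local_measurable lB; have mK := local_measurable lK.
  have h1 : pr D <= pr B * pr K.
    rewrite -(pr_local_independent indP UU' lB lK).
    by apply: le_pr => //; apply: measurableI.
  have h2 : pr K * pr Rm <= pr A'.
    apply: (le_trans (pr_associated paP mK mR _ iR)); first by case: lK.
    by apply: le_pr => //; apply: measurableI.
  have h3 : pr B <= pr A by apply: le_pr.
  have [A0 B0 K0] : [/\ 0 <= pr A, 0 <= pr B & 0 <= pr K].
    by split; apply: pr_ge0.
  apply: (le_trans h1); rewrite mulrCA.
  apply: ler_pM => //.
  apply: (@le_trans _ _ (f * (pr K * pr Rm))); last by rewrite ler_wpM2l.
  by rewrite mulrCA -[leLHS]mulr1 ler_wpM2l.
- by move=> f f0; rewrite pr0 !mulr_ge0// pr_ge0.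
- move=> D1 f1 D2 f2 D f mD DD d1 IH1 d2 IH2 ff.
  have mD1 := decoupled_measurable d1; have mD2 := decoupled_measurable d2.
  have mD12 : measurable (D2 `\` D1) by apply: measurableD.
  apply: (@le_trans _ _ (pr (D1 `|` D2))).
    by apply: le_pr => //; apply: measurableU.
  rewrite (prID P (measurableU _ _ mD1 mD2) mD1) setUK setDUl setDv set0U.
  apply: (@le_trans _ _ ((f1 + f2) * (pr A * pr A'))).
    by rewrite mulrDl lerD// (le_trans _ IH2)// le_pr// => w [].
  by rewrite ler_wpM2r// mulr_ge0 ?pr_ge0.
Qed.

End DecoupledTheory.

(** The kept vertex sets of the two paths could only meet across the junction, at y = y', and the
    end conditions of the atoms remove that vertex from the second path. The parts given up are
    increasing, so by association the probability of both is at least the product, and the prices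
    multiply. *)
Lemma decoupled_cat x x' y y' z z' A1 A1' A2 A2' D1 D2 f1 f2 :
  level x = level x' -> level y = level y' -> level z = level z' ->
  level x < level y -> level y < level z ->
  decoupled x x' y y' A1 A1' D1 f1 -> decoupled y y' z z' A2 A2' D2 f2 ->
  decoupled x x' z z' (A1 `&` A2) (A1' `&` A2') (D1 `&` D2) (f1 * f2).
Proof.
move=> xx' yy' zz' xy yz d1; elim: d1 D2 f2 => {D1 f1}.
- move=> U U' B K Rm D f mD sU sU' UU' xx zz lB lK mR iR DBK BA KR f0 f1 D2 f2.
  elim=> {D2 f2}.
  + move=> W W' B2 K2 Rm2 D2 f2 mD2 sW sW' WW' xx2 zz2 lB2 lK2 mR2 iR2 DBK2 BA2
      KR2 f02 f12.
    apply: (@Decoupled_atom _ _ _ _ _ _ (U `|` W) (U' `|` W') (B `&` B2)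
      (K `&` K2) (Rm `&` Rm2)).
    * exact: measurableI.
    * exact: slab_cat xy yz sU sW.
    * by apply: slab_cat sU' sW'; rewrite -?xx' -?yy' -?zz'.
    * apply/seteqP; split=> // v [[Uv|Wv] [Uv'|Wv']].
      - by rewrite -UU'.
      - have [/andP[_ a1] _ a2] := sU _ Uv.
        have [/andP[b1 _] b2 _] := sW' _ Wv'.
        have vy : level v = level y by apply/le_anti; rewrite a1 yy' b1.
        case: xx2; first by rewrite -(a2 vy) -b2// vy.
        by rewrite -b2// vy.
      - have [/andP[_ a1] _ a2] := sU' _ Uv'.
        have [/andP[b1 _] b2 _] := sW _ Wv.
        have vy : level v = level y by apply/le_anti; rewrite b1 yy' a1.
        case: zz; first by rewrite -b2// -a2// vy.
        by rewrite -a2// vy.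
      - by rewrite -WW'.
    * move=> e [] ; first exact: xx.
      by move/sW' => [/andP[+ _] _ _]; rewrite -xx' -yy' leNgt xy.
    * move=> e [] ; last exact: zz2.
      by move/sU' => [/andP[_ +] _ _]; rewrite -zz' -yy' leNgt yz.
    * by apply: local_eventI; [apply: local_eventS lB => ? | apply: local_eventS lB2 => ?]; [left|right].
    * by apply: local_eventI; [apply: local_eventS lK => ? | apply: local_eventS lK2 => ?]; [left|right].
    * exact: measurableI.
    * exact: increasingI.
    * by move=> w [/DBK[? ?] /DBK2[? ?]].
    * by move=> w [/BA ? /BA2 ?].
    * by move=> w [[? ?] [? ?]]; split; [apply: KR|apply: KR2].
    * exact: mulr_ge0.
    * apply: (@le_trans _ _ ((f * pr Rm) * (f2 * pr Rm2))).
        by rewrite -[leLHS]mulr1 ler_pM.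
      rewrite mulrACA ler_wpM2l ?mulr_ge0//.
      exact: pr_associated.
  + by move=> g g0; rewrite setI0; apply: Decoupled_empty; rewrite mulr_ge0.
  + move=> E1 g1 E2 g2 E g mE EE _ IH1 _ IH2 gg.
    apply: (Decoupled_cover _ _ IH1 IH2); first exact: measurableI.
      by move=> w [Dw /EE[]]; [left|right].
    by rewrite -mulrDr ler_wpM2l.
- move=> f f0 D2 f2 d2; rewrite set0I; apply: Decoupled_empty.
  by rewrite mulr_ge0// (decoupled_ge0 d2).
- move=> E1 g1 E2 g2 E g mE EE _ IH1 _ IH2 gg D2 f2 d2.
  apply: (Decoupled_cover _ _ (IH1 _ _ d2) (IH2 _ _ d2)).
  + by apply: measurableI => //; apply: decoupled_measurable d2.
  + by move=> w [/EE[] ? ?]; [left|right].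
  + by rewrite -mulrDl ler_wpM2r// (decoupled_ge0 d2).
Qed.

End Lattice.

Section Words.
Context (n : nat).
Local Notation V := 'rV[int]_n.
Local Notation cfg := (config (dlattice n)).
Implicit Types (x y z : V) (i j : 'I_n) (c r : seq 'I_n).

Fixpoint endp x c : V := if c is i :: c' then endp (x + unitv i) c' else x.

Fixpoint word_open x c : set cfg :=
  if c is i :: c' then open_at x i `&` word_open (x + unitv i) c' else setT.

Lemma endpE x c : endp x c = x + \sum_(i <- c) unitv i.
Proof.
elim: c x => [|i c IH] x /=; first by rewrite big_nil addr0.
by rewrite IH big_cons addrA.
Qed.

Lemma endp_cat x c r : endp x (c ++ r) = endp (endp x c) r.
Proof. by elim: c x => //= i c IH x; rewrite IH. Qed.

Lemma perm_endp x c r : perm_eq c r -> endp x c = endp x r.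
Proof. by move=> cr; rewrite !endpE (perm_big _ cr). Qed.

Lemma level_endp x c : level (endp x c) = level x + (size c)%:Z.
Proof.
elim: c x => [|i c IH] x /=; first by rewrite addr0.
by rewrite IH level_step -addrA -natz -[in RHS]natz -nat1r.
Qed.

Lemma measurable_word_open x c : measurable (word_open x c).
Proof.
elim: c x => [|i c IH] x /=; first exact: measurableT.
by apply: measurableI => //; exact: measurable_open_at.
Qed.

Lemma increasing_word_open x c : increasing_event (word_open x c).
Proof.
elim: c x => [|i c IH] x //=; apply: increasingI => //.
exact: increasing_open_at.
Qed.

Definition route_open x c : set cfg :=
  \bigcup_(r in [set r | r \in permutations c]) word_open x r.

Lemma measurable_route_open x c : measurable (route_open x c).
Proof.
apply: fin_bigcup_measurable; first exact: finite_seq.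
by move=> r _; apply: measurable_word_open.
Qed.

Lemma increasing_route_open x c : increasing_event (route_open x c).
Proof.
move=> w w' ww' [r rc rw]; exists r => //.
exact: (@increasing_word_open x r w w' ww').
Qed.

Lemma perm_route_open x c r : perm_eq c r -> route_open x c = route_open x r.
Proof.
move=> cr; rewrite /route_open; congr bigcup; apply/seteqP.
by split=> t /=; rewrite !mem_permutations => h; rewrite (perm_trans h)// perm_sym.
Qed.

Definition route_hull x c : set V :=
  [set v | exists r k, perm_eq r c /\ v = endp x (take k r)].

Lemma route_hull_slab x c : slab x (endp x c) (route_hull x c).
Proof.
move=> v [r [k [rc ->]]]; rewrite !level_endp.
have sk : (size (take k r) <= size r)%N by rewrite size_take_min geq_minr.
have sr : size r = size c by apply: perm_size.
split.
- by apply/andP; split; lia.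
- by move=> h; have /size0nil -> : size (take k r) = 0%N by lia.
- move=> h; have rk : (size r <= k)%N by move: h; rewrite size_take_min; lia.
  by rewrite take_oversize// (perm_endp x rc).
Qed.

Lemma local_word_open x c (U : set V) :
  (forall k, U (endp x (take k c))) ->
  local_event (U : set (vertex (dlattice n))) (word_open x c).
Proof.
elim: c x => [|i c IH] x Uc; first exact: local_eventT.
apply: local_eventI; last by apply: IH => k; apply: (Uc k.+1).
apply: local_eventS (local_open (stepe x i)) => v [->|->]; first exact: (Uc 0%N).
by have := Uc 1%N; rewrite /= take0.
Qed.

Lemma local_route_open x c :
  local_event (route_hull x c : set (vertex (dlattice n))) (route_open x c).
Proof.
rewrite /route_open bigcup_seq.
have : {subset permutations c <= permutations c} by [].
elim: {-2}(permutations c) => [|r s IH] rs.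
  by rewrite big_nil; apply: local_event0.
rewrite big_cons; apply: local_eventU.
  apply: local_word_open => k; exists r, k; split=> //.
  by rewrite -mem_permutations rs// mem_head.
by apply: IH => t ts; rewrite rs// in_cons ts orbT.
Qed.

End Words.

Section WordCost.
Context (n : nat) (R : realType) (p : R).
Local Notation V := 'rV[int]_n.
Implicit Types (x y z : V) (i j : 'I_n) (c r : seq 'I_n).

(** Steps starting at the same level share a vertex only if their starts or their ends coincide. *)
Definition step_cost x x' i i' : R :=
  if (x == x') || (x + unitv i == x' + unitv i') then p^-1 else 1.

Fixpoint word_cost x x' r r' : R :=
  match r, r' with
  | i :: s, i' :: s' =>
      step_cost x x' i i' * word_cost (x + unitv i) (x' + unitv i') s s'
  | _, _ => 1
  end.

Context (P : probability (config (dlattice n)) R).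
Hypotheses (paP : positively_associated P) (indP : independent_at 1 P).
Hypotheses (p0 : 0 < p) (ppr : forall x i, p <= pr P (open_at x i)).

Lemma decoupled_step x x' i i' : level x = level x' ->
  decoupled P x x' (x + unitv i) (x' + unitv i') (open_at x i) (open_at x' i')
    (open_at x i `&` open_at x' i') (step_cost x x' i i').
Proof.
move=> xx'.
have slabU y j : slab y (y + unitv j) [set y; y + unitv j].
  move=> v [->|->]; rewrite level_step; split=> //.
  - by lia.
  - by lia.
  - by lia.
  - by lia.
have mI : measurable (open_at x i `&` open_at x' i').
  by apply: measurableI; apply: measurable_open_at.
rewrite /step_cost; case: ifPn => [_|].
  (* The second step is given up entirely, at the price [p^-1]. *)
  apply: (@Decoupled_atom _ _ _ _ _ _ _ _ _ [set x; x + unitv i] set0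
    (open_at x i) setT (open_at x' i')) => //.
  - by rewrite setI0.
  - by move=> _ [].
  - by move=> _ [].
  - exact: (local_open (stepe x i)).
  - exact: local_eventT.
  - exact: measurable_open_at.
  - exact: increasing_open_at.
  - by move=> w [].
  - by rewrite invr_ge0; apply: ltW.
  - by rewrite mulrC ler_pdivlMr// mul1r.
rewrite negb_or => /andP[/eqP nx /eqP nz].
apply: (@Decoupled_atom _ _ _ _ _ _ _ _ _ [set x; x + unitv i]
    [set x'; x' + unitv i'] (open_at x i) (open_at x' i') setT) => //.
- apply/seteqP; split=> // v [[]-> []// h].
  + by have := level_step x' i'; rewrite -h xx'; lia.
  + by have := level_step x i; rewrite h xx'; lia.
- exact: (local_open (stepe x i)).
- exact: (local_open (stepe x' i')).
- by rewrite prT mulr1.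
Qed.

Lemma decoupled_word x x' r r' : level x = level x' -> size r = size r' ->
  decoupled P x x' (endp x r) (endp x' r') (word_open x r) (word_open x' r')
    (word_open x r `&` word_open x' r') (word_cost x x' r r').
Proof.
elim: r x x' r' => [|i r IH] x x' [|i' r']// xx'.
  move=> _ /=.
  by apply: (@Decoupled_atom _ _ _ _ _ _ _ _ _ set0 set0 setT setT setT) => //;
    rewrite ?prT ?mulr1 ?setI0 ?setIT//;
    by [exact: local_eventT|move=> _ []].
move=> [rr']; have st := decoupled_step i i' xx'.
have ll : level (x + unitv i) = level (x' + unitv i') by rewrite !level_step xx'.
have {}IH := IH _ _ _ ll rr'.
(* Words of one step are treated apart because [decoupled_cat] needs a second piece that rises
   strictly. *)
case: r r' rr' IH => [|j r] [|j' r']// rr' IH.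
  by rewrite /= !setIT mulr1.
rewrite (_ : word_open x (i :: j :: r) `&` word_open x' (i' :: j' :: r') =
  (open_at x i `&` open_at x' i') `&` (word_open (x + unitv i) (j :: r) `&`
   word_open (x' + unitv i') (j' :: r'))); last exact: setIACA.
apply: (decoupled_cat paP _ ll _ _ _ st IH) => //.
- by move: rr' => /= rr'; rewrite !level_endp !level_step xx'; lia.
- by rewrite level_step; lia.
- by rewrite ?level_endp ?level_step/=; lia.
Qed.

Lemma decoupled_routes x x' c c' : level x = level x' -> size c = size c' ->
  decoupled P x x' (endp x c) (endp x' c') (route_open x c) (route_open x' c')
    (route_open x c `&` route_open x' c')
    (\sum_(r <- permutations c) \sum_(r' <- permutations c') word_cost x x' r r').
Proof.
move=> xx' cc'.
rewrite -(big_allpairs_dep (F := fun u => word_cost x x' u.1 u.2) (h := pair)).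
apply: (@decoupled_cover_seq _ _ _ _ _ _ _ _ _
  (fun u : seq 'I_n * seq 'I_n => word_open x u.1 `&` word_open x' u.2)).
- by apply: measurableI; apply: measurable_route_open.
- move=> w [[r /= rc wr] [r' /= rc' wr']]; exists (r, r') => //.
  by apply/allpairsP; exists (r, r').
- move=> _ /allpairsP[[r r'] [/= rc rc' ->]].
  move: rc rc'; rewrite !mem_permutations => rc rc'.
  rewrite -(perm_endp x rc) -(perm_endp x' rc').
  apply: (@decoupledS _ _ _ _ _ _ _ (word_open x r) (word_open x' r')).
  + by move=> w wr; exists r => //=; rewrite mem_permutations.
  + by move=> w wr; exists r' => //=; rewrite mem_permutations.
  + by apply: decoupled_word => //; rewrite (perm_size rc) (perm_size rc').
Qed.

(** Summing over pairs of orders would lose too much here. The second event is instead dropped as a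
    whole, and its price [q^-1] is the one that decides the threshold. *)
Lemma decoupled_same_routes x c c' (q : R) : 0 < q -> perm_eq c c' ->
  q <= pr P (route_open x c) ->
  decoupled P x x (endp x c) (endp x c') (route_open x c) (route_open x c')
    (route_open x c `&` route_open x c') q^-1.
Proof.
move=> q0 cc' qc; rewrite -(perm_route_open x cc') -(perm_endp x cc').
apply: (@Decoupled_atom _ _ _ _ _ _ _ _ _ (route_hull x c) set0
    (route_open x c) setT (route_open x c)) => //.
- by rewrite setIid; apply: measurable_route_open.
- exact: route_hull_slab.
- by rewrite setI0.
- by move=> _ [].
- by move=> _ [].
- exact: local_route_open.
- exact: local_eventT.
- exact: measurable_route_open.
- exact: increasing_route_open.
- by move=> w [].
- by rewrite invr_ge0; apply: ltW.
- by rewrite mulrC ler_pdivlMr// mul1r.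
Qed.

Lemma decoupled_disjoint_routes x x' c c' :
  route_hull x c `&` route_hull x' c' = set0 ->
  decoupled P x x' (endp x c) (endp x' c') (route_open x c) (route_open x' c')
    (route_open x c `&` route_open x' c') 1.
Proof.
move=> d.
have st y a : route_hull y a y by exists a, 0%N; rewrite take0.
have en y a : route_hull y a (endp y a).
  by exists a, (size a); rewrite take_size.
have dd v : route_hull x c v -> ~ route_hull x' c' v.
  by move=> h h'; have : (route_hull x c `&` route_hull x' c') v by []; rewrite d.
apply: (@Decoupled_atom _ _ _ _ _ _ _ _ _ (route_hull x c) (route_hull x' c')
    (route_open x c) (route_open x' c') setT) => //.
- by apply: measurableI; apply: measurable_route_open.
- exact: route_hull_slab.
- exact: route_hull_slab.
- by move=> e; apply: dd; rewrite -e.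
- by move=> e; apply: dd; rewrite -e.
- exact: local_route_open.
- exact: local_route_open.
- by rewrite prT mulr1.
Qed.

End WordCost.

(** * The probability of a route *)

Section Rounding.
Context (R : realDomainType) (T : eqType) (bad : rel T) (om : nat)
  (s0 : seq T).
Hypothesis badxx : forall t, bad t t = false.
Hypothesis clique : forall s : seq T, uniq s -> {subset s <= s0} ->
  {in s &, forall r r', ~~ bad r r'} -> (size s <= om)%N.

Let npairs (a : T -> R) (s : seq T) : R :=
  \sum_(r <- s) \sum_(r' <- s) (bad r r')%:R * (a r * a r').

Let npairs_cons a t s : npairs a (t :: s) =
  a t * (\sum_(r <- s) a r * ((bad t r)%:R + (bad r t)%:R)) + npairs a s.
Proof.
rewrite /npairs big_cons big_cons badxx mul0r add0r.
under [X in _ + X = _]eq_bigr do rewrite big_cons.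
rewrite big_split/= addrA; congr (_ + _).
by rewrite -big_split/= mulr_sumr; apply: eq_bigr => r _; ring.
Qed.

Let perm_npairs a s t : perm_eq s t -> npairs a s = npairs a t.
Proof.
move=> st; rewrite /npairs (perm_big _ st)/=.
by apply: eq_bigr => r _; rewrite (perm_big _ st).
Qed.

(** Removing an element of a bad pair lowers the size by 1 and [npairs] by at least 1; this is
    repeated until no bad pair is left. *)
Let size_npairs (s : seq T) : uniq s -> {subset s <= s0} ->
  (size s)%:R - npairs (fun=> 1) s <= om%:R.
Proof.
have [k] := ubnP (size s); elim: k s => // k IH s sk us ss0.
have [h|] := boolP (all (fun r => all (fun r' => ~~ bad r r') s) s).
  have npairs0 : npairs (fun=> 1) s = 0.
    rewrite /npairs big_seq big1// => r rs; rewrite big_seq big1// => r' rs'.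
    by move/allP: h => /(_ _ rs)/allP/(_ _ rs')/negbTE->; rewrite mul0r.
  rewrite npairs0 subr0 ler_nat; apply: clique => // r r' rs rs'.
  by move/allP: h => /(_ _ rs)/allP/(_ _ rs').
move=> /allPn[r rs /allPn[r' rs' /negPn br]].
have st := perm_to_rem rs.
have r'S : r' \in rem r s.
  have := rs'; rewrite (perm_mem st) in_cons => /predU1P[e|//].
  by move: br; rewrite e badxx.
rewrite (perm_npairs _ st) npairs_cons (perm_size st)/= mul1r.
have dg : 1 <= \sum_(t <- rem r s) 1 * ((bad r t)%:R + (bad t r)%:R) :> R.
  rewrite (perm_big _ (perm_to_rem r'S))/= big_cons br mul1r -addrA lerDl.
  by rewrite addr_ge0 ?ler0n// sumr_ge0// => t _; rewrite mul1r addr_ge0.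
have := IH (rem r s); rewrite rem_uniq// => IHr.
have {}IHr : (size (rem r s))%:R - npairs (fun=> 1) (rem r s) <= om%:R.
  apply: IHr => //; first by move: sk; rewrite (perm_size st).
  by move=> t /mem_rem/ss0.
rewrite -natr1; lra.
Qed.

Variable a : T -> R.
Hypothesis a01 : forall t, 0 <= a t <= 1.

(* The left-hand side is affine in each weight, so it is largest when all weights
   are 0 or 1; then deleting one element of every bad pair leaves a clique. *)
Lemma weighted_clique_bound (s : seq T) : uniq s -> {subset s <= s0} ->
  \sum_(r <- s) a r
    - \sum_(r <- s) \sum_(r' <- s) (bad r r')%:R * (a r * a r') <= om%:R.
Proof.
move=> us ss0; rewrite -/(npairs a s).
(* [S] holds the elements whose weight has been rounded to 1, those rounded to 0 are discarded, and
   [s] keeps its weights. The middle sum contains the bad pairs between [s] and [S]. *)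
suff gen S : uniq (S ++ s) -> {subset S ++ s <= s0} -> (size S)%:R - npairs (fun=> 1) S
    + \sum_(r <- s) a r * (1 - \sum_(q <- S) ((bad r q)%:R + (bad q r)%:R))
    - npairs a s <= om%:R.
  have := gen [::] us ss0; rewrite /npairs !big_nil subr0 add0r.
  by under eq_bigr do rewrite big_nil subr0 mulr1.
elim: s S {us ss0} => [|t s IH] S.
  rewrite cats0 => uS SS; rewrite {2}/npairs !big_nil addr0 subr0.
  exact: size_npairs.
move=> uS SS.
have uS0 : uniq (S ++ s).
  by apply: subseq_uniq uS; rewrite cat_subseq// subseq_cons.
have uS1 : uniq ((t :: S) ++ s).
  by rewrite (perm_uniq (s2 := S ++ t :: s))// perm_sym -cat1s perm_catCA.
have SS0 : {subset S ++ s <= s0}.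
  move=> r; rewrite mem_cat => /orP h; apply: SS.
  by rewrite mem_cat in_cons; case: h => ->; rewrite ?orbT.
have SS1 : {subset (t :: S) ++ s <= s0}.
  by move=> r h; apply: SS; move: h; rewrite !mem_cat !in_cons orbCA orbA.
have := IH _ uS1 SS1; have := IH _ uS0 SS0.
rewrite !npairs_cons big_cons/= -natr1.
under [X in _ -> _ + X - _ <= _ -> _]eq_bigr do rewrite big_cons opprD addrCA mulrDr.
rewrite big_split/= mul1r.
set Y := \sum_(r <- s) a r * (1 - _).
have -> : \sum_(i <- s) a i * - ((bad i t)%:R + (bad t i)%:R) =
    - \sum_(r <- s) a r * ((bad t r)%:R + (bad r t)%:R).
  by rewrite -sumrN; apply: eq_bigr => r _; ring.
set Z := \sum_(r <- s) a r * (_ + _).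
have -> : \sum_(r <- S) 1 * ((bad t r)%:R + (bad r t)%:R) =
    \sum_(q <- S) ((bad t q)%:R + (bad q t)%:R) :> R.
  by apply: eq_bigr => r _; rewrite mul1r.
set W := \sum_(q <- S) _; move: (npairs _ S) (npairs a s) => N1 N2 h0 h1.
have /andP[a0 a1] := a01 t.
have : (1 - a t) * ((size S)%:R - N1 + Y - N2) + a t *
   ((size S)%:R + 1 - (W + N1) + (- Z + Y) - N2) <= (1 - a t) * om%:R + a t * om%:R.
  by rewrite lerD// ler_wpM2l// subr_ge0.
set u := (size S)%:R; set v := om%:R; nra.
Qed.

End Rounding.

Section TouchingWords.
Context (n : nat).
Local Notation V := 'rV[int]_n.
Implicit Types (x y z : V) (i j : 'I_n) (c r : seq 'I_n).

Lemma unitvE i j : unitv i 0 j = (i == j)%:R.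
Proof. by rewrite mxE eqxx eq_sym. Qed.

Lemma unitv_inj : injective (@unitv n).
Proof.
move=> i j /rowP/(_ i); rewrite !unitvE eqxx; by case: (eqVneq j i).
Qed.

Lemma unitv_pair i j h b : unitv i + unitv j = unitv h + unitv b -> h != i ->
  h = j /\ b = i.
Proof.
move=> e hi.
have := congr1 (fun v : V => v 0 h) e; rewrite !mxE !eqxx/= (negbTE hi).
case: (eqVneq h j) => [hj|]/=; last by case: (h == b).
move=> _; split=> //; subst h; apply: unitv_inj.
by apply: (@addrI _ (unitv j)); rewrite -e addrC.
Qed.

Fixpoint all_touched x x' r r' : bool :=
  match r, r' with
  | i :: s, i' :: s' => ((x == x') || (x + unitv i == x' + unitv i')) &&
      all_touched (x + unitv i) (x' + unitv i') s s'
  | _, _ => true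
  end.

Lemma all_touchedxx x r : all_touched x x r r.
Proof. by elim: r x => //= i r IH x; rewrite eqxx IH. Qed.

Lemma touching_pair x i i' j j' r r' : i != i' ->
  all_touched x x [:: i, j & r] [:: i', j' & r'] -> j = i' /\ j' = i.
Proof.
move=> ii' /= /andP[_ /andP[+ _]]; rewrite (inj_eq (addrI _)).
rewrite (inj_eq unitv_inj) (negbTE ii')/= -!addrA (inj_eq (addrI _)).
move=> /eqP e; have [-> ->] := unitv_pair (esym e) ii'; by [].
Qed.

(* By [touching_pair], two such words that separate at a vertex take the same two
   steps in opposite orders and meet again. *)
Lemma touching_clique m x z (s : seq (seq 'I_n)) : uniq s ->
  {in s, forall r, size r = m /\ endp x r = z} ->
  {in s &, forall r r', all_touched x x r r'} -> (size s <= 2 ^ m./2)%N.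
Proof.
have [k] := ubnP m; elim: k m x z s => // k IH m x z s mk us sz tt.
have small : (forall r r', r \in s -> r' \in s -> r = r') -> (size s <= 1)%N.
  case: s us {sz tt} => [//|r [//|r' s]] /=; rewrite in_cons negb_or.
  move=> /andP[/andP[rr' _] _] h.
  by move: rr'; rewrite (h r r') ?eqxx ?inE ?eqxx ?orbT.
(* Words with a common prefix stay pairwise touching once the prefix is removed. *)
have sub_IH (pre : seq 'I_n) : (0 < size pre <= m)%N ->
    (size [seq drop (size pre) r | r <- s & take (size pre) r == pre]
      <= 2 ^ (m - size pre)./2)%N.
  move=> /andP[p0 pm]; apply: (IH _ (endp x pre) z); first by lia.
  - rewrite map_inj_in_uniq ?filter_uniq// => r r'; rewrite !mem_filter.
    move=> /andP[/eqP rp _] /andP[/eqP r'p _] rr'.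
    by rewrite -(cat_take_drop (size pre) r) rp rr' -{1}r'p cat_take_drop.
  - move=> _ /mapP[r + ->]; rewrite mem_filter => /andP[/eqP rp /sz[<- <-]].
    by rewrite size_drop -[X in endp (endp x X)]rp -endp_cat cat_take_drop.
  - move=> _ _ /mapP[r + ->] /mapP[r' + ->]; rewrite !mem_filter.
    move=> /andP[/eqP rp rs] /andP[/eqP r'p r's].
    have := tt _ _ rs r's.
    rewrite -{1}(cat_take_drop (size pre) r) -{1}(cat_take_drop (size pre) r').
    rewrite rp r'p; move: (drop _ r) (drop _ r') => d1 d2; elim: (pre) x {tt sz small} => //= i t IHt y /andP[_].
    exact: IHt.
case: m mk sz sub_IH => [|[|m]] mk sz sub_IH.
- by apply: small => r r' /sz[/size0nil-> _] /sz[/size0nil-> _].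
- apply: small => r r' /sz[s1 e1] /sz[s2 e2].
  by case: r r' s1 e1 s2 e2 => [|i [|? ?]] [|i' [|? ?]]//= _ <- _ /addrI /unitv_inj->.
have [/hasP[r1 r1s /hasP[r2 r2s]]|same] :=
  boolP (has (fun r => has (fun r' => take 1 r != take 1 r') s) s).
  case: r1 r1s (sz _ r1s) => [? []//|i [|j u1] r1s []// _ _].
  case: r2 r2s (sz _ r2s) => [? []//|i' [|j' u2] r2s []// _ _ /= ii'].
  have {}ii' : i != i' by move: ii'; rewrite eqseq_cons andbT.
  have [? ?] := touching_pair ii' (tt _ _ r1s r2s); subst j j'.
  (* Every word differs in its first step from one of the two chosen words, which fixes its first
     two steps. So there are two classes, each a clique of words with two steps fewer. *)
  have ss : {in s, forall r, (take 2 r == [:: i; i']) || (take 2 r == [:: i'; i])}.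
    move=> [|h [|b u]] rs; first by case: (sz _ rs).
      by case: (sz _ rs).
    rewrite /= !take0; have [e|hi] := eqVneq h i.
      subst h; have [|-> _] := touching_pair _ (tt _ _ rs r2s) => //.
      by rewrite eqxx.
    have [|-> <-] := touching_pair _ (tt _ _ rs r1s) => //.
    by rewrite !eqxx orbT.
  have := sub_IH [:: i; i'] erefl; have := sub_IH [:: i'; i] erefl.
  rewrite !size_map !size_filter !subSS subn0 /= expnS mul2n -addnn => l1 l2.
  apply: leq_trans (leq_add l2 l1).
  rewrite -count_predUI -[leqLHS](@count_predT _ s).
  apply: leq_trans (leq_addr _ _); rewrite leq_eqVlt; apply/orP; left.
  apply/eqP; apply: eq_in_count => r rs; apply/esym.
  exact: ss.
case: s us sz tt small sub_IH same => [//|r s] us sz tt small sub_IH same.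
have [sr _] := sz r (mem_head _ _).
case: r sr us sz tt small sub_IH same => [//|i r] sr us sz tt small sub_IH same.
have := sub_IH [:: i] erefl; rewrite size_map size_filter.
have -> : count (fun r0 => take (size [:: i]) r0 == [:: i]) ((i :: r) :: s) =
    size ((i :: r) :: s).
  apply/eqP; rewrite -all_count; apply/allP => t ts /=.
  have := hasPn same _ ts => /hasPn/(_ _ (mem_head _ _)).
  by rewrite negbK => /eqP->; rewrite /= take0.
move=> h; apply: (leq_trans h); rewrite leq_exp2l// subSS subn0.
by rewrite half_leq.
Qed.

End TouchingWords.

Section RouteBound.
Context (n : nat) (R : realType) (p : R).
Local Notation V := 'rV[int]_n.
Implicit Types (x y z : V) (i j : 'I_n) (c r : seq 'I_n).
Context (P : probability (config (dlattice n)) R).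
Hypotheses (paP : positively_associated P) (indP : independent_at 1 P).
Hypotheses (p0 : 0 < p) (p1 : p <= 1) (ppr : forall x i, p <= pr P (open_at x i)).

Lemma pr_word_open x r : p ^+ size r <= pr P (word_open x r).
Proof.
elim: r x => [|i r IH] x /=; first by rewrite prT.
rewrite exprS; apply: (@le_trans _ _ (pr P (open_at x i) *
    pr P (word_open (x + unitv i) r))).
  by rewrite ler_pM// ?exprn_ge0// ltW.
apply: pr_associated => //.
- exact: measurable_open_at.
- exact: measurable_word_open.
- exact: increasing_open_at.
- exact: increasing_word_open.
Qed.

Lemma word_cost_ge0 x x' r r' : 0 <= word_cost p x x' r r'.
Proof.
elim: r x x' r' => [|i r IH] x x' [|i' r']//=; rewrite mulr_ge0// /step_cost.
by case: ifP => // _; rewrite invr_ge0 ltW.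
Qed.

(** A touched step costs [p^-1], which its factor [p] cancels; an untouched step costs nothing, and
    its factor [p] is gained. *)
Lemma word_cost_le x x' r r' :
  word_cost p x x' r r' * p ^+ size r <= (if all_touched x x' r r' then 1 else p).
Proof.
elim: r x x' r' => [|i r IH] x x' [|i' r']/=; rewrite ?expr0 ?mulr1 ?mul1r//.
  by rewrite exprn_ile1// ltW.
rewrite exprS mulrACA /step_cost; case: ifP => _ /=.
  by rewrite mulVf ?gt_eqF// mul1r.
have h : word_cost p (x + unitv i) (x' + unitv i') r r' * p ^+ size r <= 1.
  by apply: le_trans (IH _ _ _) _; case: ifP.
by rewrite mul1r ger_pMr.
Qed.

(** By [weighted_clique_bound], the weight of the open orders minus that of the open bad pairs never
    exceeds [2 ^ m./2], and it vanishes when the route is closed. On average the first weight is m!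
    p^m; a bad pair has an untouched step, so each of the at most (m!)^2 bad pairs weighs at most
    p^(m+1). *)
Lemma pr_route_open x c : uniq c ->
  (size c)`!%:R * p ^+ size c - (size c)`!%:R ^+ 2 * p ^+ (size c).+1
    <= (2 ^ (size c)./2)%:R * pr P (route_open x c).
Proof.
move=> uc; set m := size c; set s := permutations c.
have szs r : r \in s -> size r = m.
  by rewrite mem_permutations => /perm_size.
have us : uniq s by apply: permutations_uniq.
have sizes : size s = m`! by apply: size_permutations.
pose w r := pr P (word_open x r).
have w0 r : 0 < w r by apply: lt_le_trans (pr_word_open x r); rewrite exprn_gt0.
(* The weights make [a r * w r = p ^+ m] for every order, whatever the true probability [w r]; they
   are at most 1 by association. *)
pose a r := p ^+ size r / w r.
have a01 r : 0 <= a r <= 1.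
  apply/andP; split; last by rewrite ler_pdivrMr// mul1r pr_word_open.
  by rewrite divr_ge0// ltW// exprn_gt0.
pose bad r r' := [&& r \in s, r' \in s & ~~ all_touched x x r r'].
have badxx r : bad r r = false.
  by rewrite /bad all_touchedxx !andbF.
have clique (t : seq (seq 'I_n)) : uniq t -> {subset t <= s} ->
    {in t &, forall r r', ~~ bad r r'} -> (size t <= 2 ^ m./2)%N.
  move=> ut ts bt; apply: (@touching_clique n m x (endp x c)) => //.
    by move=> r /ts rs; rewrite szs//; split=> //; apply: perm_endp; rewrite -mem_permutations.
  by move=> r r' rt r't; have := bt _ _ rt r't; rewrite /bad !ts//= negbK.
have lin : 0 <= (2 ^ m./2)%:R * pr P (route_open x c)
    + (\sum_(r <- s) - a r * w r
    + \sum_(r <- s) \sum_(r' <- s) (bad r r')%:R * (a r * a r') *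
         pr P (word_open x r `&` word_open x r')).
  pose L := ((2 ^ m./2)%:R, route_open x c) ::
    [seq (- a r, word_open x r) | r <- s] ++
    [seq ((bad r r')%:R * (a r * a r'), word_open x r `&` word_open x r')
      | r <- s, r' <- s].
  have := @pr_lin _ _ _ P L.
  rewrite {3}/L big_cons big_cat/= big_map big_allpairs_dep/=; apply.
  - move=> u; rewrite in_cons => /predU1P[->|]; first exact: measurable_route_open.
    rewrite mem_cat => /orP[/mapP[r _ ->]|/allpairsP[[r r'] [_ _ ->]]] /=.
      exact: measurable_word_open.
    by apply: measurableI; apply: measurable_word_open.
  - move=> v; rewrite /L big_cons big_cat/= big_map big_allpairs_dep/=.
    pose O := [seq r <- s | v \in word_open x r].
    have -> : \sum_(r <- s) - a r * (v \in word_open x r)%:R = - \sum_(r <- O) a r.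
      rewrite /O big_filter -sumrN [RHS]big_mkcond/=; apply: eq_bigr => r _.
      by case: ifP; rewrite (mulr1, mulr0).
    have -> : \sum_(r <- s) \sum_(r' <- s) (bad r r')%:R * (a r * a r') *
        (v \in word_open x r `&` word_open x r')%:R =
        \sum_(r <- O) \sum_(r' <- O) (bad r r')%:R * (a r * a r').
      rewrite /O big_filter [RHS]big_mkcond/=; apply: eq_bigr => r _.
      under eq_bigr do rewrite in_setI.
      case: ifP => _ /=; last by rewrite big1// => r' _; rewrite mulr0.
      rewrite big_filter [RHS]big_mkcond/=; apply: eq_bigr => r' _.
      by case: ifP; rewrite (mulr1, mulr0).
    have uO : uniq O by rewrite filter_uniq.
    have [s0|[r rO]] : (O = [::] \/ exists r, r \in O).
      by case: (O) => [|r ?]; [left|right; exists r; rewrite mem_head].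
      by rewrite s0 !big_nil oppr0 addr0 addr0 mulr_ge0.
    have -> : v \in route_open x c.
      apply/mem_set; exists r; last by move: rO; rewrite mem_filter => /andP[/set_mem].
      by move: rO; rewrite mem_filter => /andP[].
    have := weighted_clique_bound badxx clique a01 uO (mem_subseq (filter_subseq _ _)).
    by rewrite mulr1; lra.
have pairs_le : \sum_(r <- s) \sum_(r' <- s) (bad r r')%:R * (a r * a r') *
    pr P (word_open x r `&` word_open x r') <= m`!%:R ^+ 2 * p ^+ m.+1.
  have -> : m`!%:R ^+ 2 * p ^+ m.+1 = \sum_(r <- s) \sum_(r' <- s) p ^+ m.+1.
    rewrite !big_const_seq !count_predT !iter_addr_0 sizes -mulrnA -[RHS]mulr_natr natrM.
    by move: (m`!%:R) => f; ring.
  rewrite big_seq [leRHS]big_seq; apply: ler_sum => r rs.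
  rewrite big_seq [leRHS]big_seq; apply: ler_sum => r' r's.
  rewrite /bad rs r's /=.
  have dw := decoupled_pr paP indP (measurable_word_open x r)
    (measurable_word_open x r') (decoupled_word paP p0 ppr erefl
       (etrans (szs _ rs) (esym (szs _ r's)))).
  have := word_cost_le x x r r'; case: (all_touched x x r r') => /= wc.
    by rewrite !mul0r exprn_ge0// ltW.
  rewrite mul1r; apply: (@le_trans _ _ (a r * a r' *
      (word_cost p x x r r' * (w r * w r')))).
    by rewrite ler_wpM2l// mulr_ge0//; case/andP: (a01 r); case/andP: (a01 r').
  rewrite /a (szs r)// (szs r')// (_ : _ * _ = word_cost p x x r r' * p ^+ m * p ^+ m).
    have pm : 0 <= p ^+ m by rewrite exprn_ge0// ltW.
    by rewrite exprS ler_wpM2r// -(szs _ rs).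
  by field; rewrite !gt_eqF.
have singles : \sum_(r <- s) - a r * w r = - (m`!%:R * p ^+ m).
  rewrite big_seq (eq_bigr (fun=> - p ^+ m)) => [|r rs].
    by rewrite -big_seq big_const_seq count_predT iter_addr_0 sizes -[LHS]mulr_natr
      mulNr mulrC.
  by rewrite /a (szs r)//; field; rewrite gt_eqF.
by move: lin; rewrite singles; lra.
Qed.

End RouteBound.

(** * The second moment of open block paths *)

Section SecondMoment.
Context d (T : measurableType d) (R : realType) (P : probability T R).
Local Notation pr := (pr P).

(** With X the sum of the indicators of the [A i] divided by their probabilities, the indicator of
    the union is at least 2 [la] X - [la]^2 X^2. *)
Lemma pr_second_moment (I : eqType) (s : seq I) (A : I -> set T)
    (f : I -> I -> R) (C : R) :
  (forall i, measurable (A i)) -> {in s, forall i, 0 < pr (A i)} ->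
  {in s &, forall i j, pr (A i `&` A j) <= f i j * (pr (A i) * pr (A j))} ->
  0 < C -> (0 < size s)%N ->
  \sum_(i <- s) \sum_(j <- s) f i j <= (size s)%:R ^+ 2 * C ->
  C^-1 <= pr (\bigcup_(i in [set i | i \in s]) A i).
Proof.
move=> mA A0 Af C0 s0 fC; set U := \bigcup_(i in _) A i.
have mU : measurable U by apply: fin_bigcup_measurable => //; exact: finite_seq.
have k0 : 0 < (size s)%:R :> R by rewrite ltr0n.
(* Maximises 2 [la] k - [la]^2 k^2 C for k the size of [s]; the maximum is 1 / C. *)
pose la : R := ((size s)%:R * C)^-1.
have la0 : 0 < la by rewrite invr_gt0 mulr_gt0.
pose b i : R := (pr (A i))^-1.
have b0 i : 0 <= b i by rewrite invr_ge0 pr_ge0.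
have lin : 0 <= pr U + (\sum_(i <- s) - (2 * la * b i) * pr (A i) +
    \sum_(i <- s) \sum_(j <- s) la ^+ 2 * (b i * b j) * pr (A i `&` A j)).
  pose L := (1, U) :: [seq (- (2 * la * b i), A i) | i <- s] ++
    [seq (la ^+ 2 * (b i * b j), A i `&` A j) | i <- s, j <- s].
  have := @pr_lin _ _ _ P L.
  rewrite {3}/L big_cons big_cat/= big_map big_allpairs_dep/= mul1r; apply.
  - move=> u; rewrite in_cons => /predU1P[->//|].
    rewrite mem_cat => /orP[/mapP[i _ ->]|/allpairsP[[i j] [_ _ ->]]] /=.
      exact: mA.
    by apply: measurableI; exact: mA.
  - move=> v; rewrite /L big_cons big_cat/= big_map big_allpairs_dep/= mul1r.
    pose X := \sum_(i <- s) b i * (v \in A i)%:R.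
    have -> : \sum_(i <- s) - (2 * la * b i) * (v \in A i)%:R = - (2 * la * X).
      by rewrite mulr_sumr -sumrN; apply: eq_bigr => i _; ring.
    have -> : \sum_(i <- s) \sum_(j <- s) la ^+ 2 * (b i * b j) *
        (v \in A i `&` A j)%:R = la ^+ 2 * X ^+ 2.
      rewrite [X ^+ 2]expr2 {1}/X mulr_suml mulr_sumr; apply: eq_bigr => i _.
      rewrite /X mulr_sumr mulr_sumr; apply: eq_bigr => j _.
      by rewrite in_setI; case: (v \in A i); case: (v \in A j) => /=; ring.
    have [vU|vU] := boolP (v \in U).
      by have := sqr_ge0 (1 - la * X); rewrite /=; nra.
    have -> : X = 0.
      rewrite /X big_seq big1// => i si; rewrite memNset ?mulr0// => vi.
      by move/negP: vU; apply; apply/mem_set; exists i.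
    by rewrite !(mulr0, expr0n, oppr0, addr0)/=.
have e1 : \sum_(i <- s) - (2 * la * b i) * pr (A i) = - (2 * la * (size s)%:R).
  rewrite big_seq (eq_bigr (fun=> - (2 * la))) => [|i si].
    by rewrite -big_seq big_const_seq count_predT iter_addr_0 -mulr_natr; ring.
  by rewrite /b; field; rewrite gt_eqF// A0.
have e2 : \sum_(i <- s) \sum_(j <- s) la ^+ 2 * (b i * b j) * pr (A i `&` A j) <=
    la ^+ 2 * ((size s)%:R ^+ 2 * C).
  apply: (@le_trans _ _ (\sum_(i <- s) \sum_(j <- s) la ^+ 2 * f i j)).
    rewrite big_seq [leRHS]big_seq; apply: ler_sum => i si.
    rewrite big_seq [leRHS]big_seq; apply: ler_sum => j sj.
    rewrite -mulrA ler_wpM2l ?sqr_ge0//.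
    apply: (le_trans (ler_wpM2l _ (Af _ _ si sj))); first by rewrite mulr_ge0.
    have := A0 _ si; have := A0 _ sj; rewrite /b => h1 h2.
    by rewrite le_eqVlt; apply/orP; left; apply/eqP; field; rewrite !gt_eqF.
  rewrite (eq_bigr (fun i => la ^+ 2 * \sum_(j <- s) f i j)) => [|i _].
    by rewrite -mulr_sumr ler_wpM2l// sqr_ge0.
  by rewrite mulr_sumr.
have e3 : 2 * la * (size s)%:R = 2 * C^-1 by rewrite /la; field; rewrite !gt_eqF.
have e4 : la ^+ 2 * ((size s)%:R ^+ 2 * C) = C^-1.
  by rewrite /la; field; rewrite !gt_eqF.
by move: lin e2; rewrite e1 e3 e4; lra.
Qed.

End SecondMoment.

Section MacroPaths.
Context (n : nat) (R : realType) (p q : R) (n0 m : nat) (B : finType).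
Local Notation V := 'rV[int]_n.
Local Notation cfg := (config (dlattice n)).
Context (main : 'I_n0 -> 'I_n) (spec : B -> 'I_n).
Hypotheses (main_inj : injective main) (spec_inj : injective spec).
Hypothesis main_spec : forall i b, main i != spec b.
Hypothesis m0 : (0 < m)%N.
Implicit Types (x y z : V) (c r : seq 'I_n).

Definition block := (m.-tuple 'I_n0 * B)%type.
Implicit Types (u : block) (g : seq block).

Definition bword u : seq 'I_n := map main u.1.

Definition bnext x u : V := endp x (bword u) + unitv (spec u.2).

Definition block_open x u : set cfg :=
  route_open x (bword u) `&` open_at (endp x (bword u)) (spec u.2).

Fixpoint bend x g : V := if g is u :: g' then bend (bnext x u) g' else x.

Fixpoint path_open x g : set cfg :=
  if g is u :: g' then block_open x u `&` path_open (bnext x u) g' else setT.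

Definition spec_eq x x' := [forall b, x 0 (spec b) == x' 0 (spec b)].

(* Main steps do not change the special coordinates, so routes from vertices with
   different special coordinates do not meet. *)
Definition route_cost x x' c c' : R :=
  if ~~ spec_eq x x' then 1
  else if (x == x') && perm_eq c c' then q^-1
  else \sum_(r <- permutations c) \sum_(r' <- permutations c') word_cost p x x' r r'.

Definition block_cost x x' u u' : R :=
  route_cost x x' (bword u) (bword u') *
  step_cost p (endp x (bword u)) (endp x' (bword u')) (spec u.2) (spec u'.2).

Fixpoint path_cost x x' g g' : R :=
  match g, g' with
  | u :: s, u' :: s' => block_cost x x' u u' * path_cost (bnext x u) (bnext x' u') s s'
  | _, _ => 1
  end.

Lemma endp_spec x r b : (forall i, i \in r -> i != spec b) ->
  endp x r 0 (spec b) = x 0 (spec b).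
Proof.
elim: r x => [//|i r IH] x h /=; rewrite IH => [|j jr]; last first.
  by apply: h; rewrite in_cons jr orbT.
by rewrite mxE unitvE (negbTE (h i (mem_head _ _))) addr0.
Qed.

Lemma bword_spec u b i : i \in bword u -> i != spec b.
Proof. by case/mapP => j _ ->. Qed.

Lemma spec_eqxx x : spec_eq x x.
Proof. exact/forallP. Qed.

Lemma size_bword u : size (bword u) = m.
Proof. by rewrite size_map size_tuple. Qed.

Lemma level_bnext x u : level (bnext x u) = level x + m.+1%:Z.
Proof. by rewrite level_step level_endp size_bword; lia. Qed.

Lemma level_bend x g : level (bend x g) = level x + (size g * m.+1)%:Z.
Proof.
elim: g x => [|u g IH] x /=; first by rewrite addr0.
by rewrite IH level_bnext; lia.
Qed.

Lemma measurable_block_open x u : measurable (block_open x u).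
Proof.
by apply: measurableI; [exact: measurable_route_open|exact: measurable_open_at].
Qed.

Lemma increasing_block_open x u : increasing_event (block_open x u).
Proof.
by apply: increasingI; [exact: increasing_route_open|exact: increasing_open_at].
Qed.

Lemma measurable_path_open x g : measurable (path_open x g).
Proof.
elim: g x => [|u g IH] x /=; first exact: measurableT.
by apply: measurableI => //; exact: measurable_block_open.
Qed.

Lemma increasing_path_open x g : increasing_event (path_open x g).
Proof.
elim: g x => [|u g IH] x //=; apply: increasingI => //.
exact: increasing_block_open.
Qed.

Context (P : probability cfg R).
Hypotheses (paP : positively_associated P) (indP : independent_at 1 P).
Hypotheses (p0 : 0 < p) (ppr : forall x i, p <= pr P (open_at x i)).
Hypotheses (q0 : 0 < q)
  (qpr : forall x u, uniq u.1 -> q <= pr P (route_open x (bword u))).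

Lemma pr_path_open x g : all (fun u => uniq u.1) g -> 0 < pr P (path_open x g).
Proof.
elim: g x => [|u g IH] x /=; first by rewrite prT.
move=> /andP[uu ug].
have h1 : 0 < pr P (route_open x (bword u)) * pr P (open_at (endp x (bword u)) (spec u.2)).
  by rewrite mulr_gt0// ?(lt_le_trans q0 (qpr _ uu))// (lt_le_trans p0).
have h2 : 0 < pr P (block_open x u).
  apply: (lt_le_trans h1); apply: pr_associated => //.
  - exact: measurable_route_open.
  - exact: measurable_open_at.
  - exact: increasing_route_open.
  - exact: increasing_open_at.
apply: (lt_le_trans (mulr_gt0 h2 (IH _ ug))); apply: pr_associated => //.
- exact: measurable_block_open.
- exact: measurable_path_open.
- exact: increasing_block_open.
- exact: increasing_path_open.
Qed.

Lemma decoupled_bword x x' u u' : uniq u.1 -> level x = level x' ->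
  decoupled P x x' (endp x (bword u)) (endp x' (bword u'))
    (route_open x (bword u)) (route_open x' (bword u'))
    (route_open x (bword u) `&` route_open x' (bword u'))
    (route_cost x x' (bword u) (bword u')).
Proof.
move=> uu xx'; rewrite /route_cost; case: ifPn => [nsp|_].
  apply: decoupled_disjoint_routes; apply/seteqP; split=> // v.
  move=> [[r [k [rc ve]]] [r' [k' [rc' ve']]]]; move/negP: nsp; case.
  apply/forallP => b.
  have <- : v 0 (spec b) = x 0 (spec b).
    rewrite ve endp_spec// => i /mem_take; rewrite (perm_mem rc).
    exact: bword_spec.
  rewrite ve' endp_spec// => i /mem_take; rewrite (perm_mem rc').
  exact: bword_spec.
case: ifPn => [/andP[/eqP <- uu']|_].
  by apply: decoupled_same_routes => //; apply: qpr.
by apply: decoupled_routes => //; rewrite !size_bword.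
Qed.

Lemma decoupled_block x x' u u' : uniq u.1 -> level x = level x' ->
  decoupled P x x' (bnext x u) (bnext x' u') (block_open x u) (block_open x' u')
    (block_open x u `&` block_open x' u') (block_cost x x' u u').
Proof.
move=> uu xx'.
have ll : level (endp x (bword u)) = level (endp x' (bword u')).
  by rewrite !level_endp !size_bword xx'.
rewrite (_ : _ `&` _ = (route_open x (bword u) `&` route_open x' (bword u')) `&`
  (open_at (endp x (bword u)) (spec u.2) `&`
   open_at (endp x' (bword u')) (spec u'.2))); last exact: setIACA.
apply: (decoupled_cat paP xx' ll _ _ _ (decoupled_bword u' uu xx')
  (decoupled_step p0 ppr (spec u.2) (spec u'.2) ll)).
- by rewrite !level_step ll.
- by rewrite level_endp size_bword; lia.
- by rewrite level_step; lia.
Qed.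

Lemma decoupled_path x x' g g' : all (fun u => uniq u.1) g ->
  level x = level x' -> size g = size g' ->
  decoupled P x x' (bend x g) (bend x' g') (path_open x g) (path_open x' g')
    (path_open x g `&` path_open x' g') (path_cost x x' g g').
Proof.
elim: g x x' g' => [|u g IH] x x' [|u' g']//=.
  by move=> *; apply: (@decoupled_word _ _ _ _ paP p0 ppr _ _ [::] [::]).
move=> /andP[uu ug] xx' [gg']; have st := decoupled_block u' uu xx'.
have ll : level (bnext x u) = level (bnext x' u') by rewrite !level_bnext xx'.
have {}IH := IH _ _ _ ug ll gg'.
case: g g' ug gg' IH => [|v g] [|v' g']// ug gg' IH.
  by rewrite /= !setIT mulr1.
rewrite (_ : _ `&` _ `&` _ = (block_open x u `&` block_open x' u') `&`
   (path_open (bnext x u) (v :: g) `&` path_open (bnext x' u') (v' :: g')));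
  last exact: setIACA.
apply: (decoupled_cat paP xx' ll _ _ _ st IH).
- by move: gg' => [gg']; rewrite !level_bend !level_bnext/= gg' xx'.
- by rewrite level_bnext; lia.
- by rewrite level_bend/=; lia.
Qed.

Definition blocks : seq block := [seq u : block <- enum {: block} | uniq u.1].

Fixpoint bpaths k : seq (seq block) :=
  if k is k'.+1 then [seq u :: g | u <- blocks, g <- bpaths k'] else [:: [::]].

Lemma bpathsP k g : g \in bpaths k -> size g = k /\ all (fun u => uniq u.1) g.
Proof.
elim: k g => [|k IH] g /=; first by rewrite inE => /eqP->.
case/allpairsP => -[u h] /= [ub /IH[<- uh] ->] /=; split=> //.
by move: ub; rewrite mem_filter => /andP[-> _].
Qed.

Lemma size_bpaths k : size (bpaths k) = (size blocks ^ k)%N.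
Proof. by elim: k => //= k IH; rewrite size_allpairs IH expnS. Qed.

Lemma pr_some_path_open x k (C : R) : 0 < C -> (0 < size blocks)%N ->
  \sum_(g <- bpaths k) \sum_(g' <- bpaths k) path_cost x x g g' <=
    (size blocks)%:R ^+ k.*2 * C ->
  C^-1 <= pr P (\bigcup_(g in [set g | g \in bpaths k]) path_open x g).
Proof.
move=> C0 b0 hC.
apply: (@pr_second_moment _ _ _ P _ _ (path_open x) (path_cost x x)) => //.
- by move=> g; apply: measurable_path_open.
- by move=> g /bpathsP[_ ug]; apply: pr_path_open.
- move=> g g' /bpathsP[sg ug] /bpathsP[sg' _].
  apply: (decoupled_pr paP indP (measurable_path_open _ _)
    (measurable_path_open _ _) (decoupled_path ug erefl _)).
  by rewrite sg.
- by rewrite size_bpaths expn_gt0 b0.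
- by rewrite size_bpaths natrX -exprM muln2.
Qed.

End MacroPaths.

(** * Average cost of the main parts of two blocks *)

Lemma big_tuple_cons (R : nmodType) (T : finType) m (F : m.+1.-tuple T -> R) :
  \sum_(c : m.+1.-tuple T) F c =
  \sum_(i : T) \sum_(c : m.-tuple T) F [tuple of i :: c].
Proof.
rewrite pair_big/=.
rewrite (reindex (fun u : T * m.-tuple T => [tuple of u.1 :: u.2]))//=.
exists (fun t : m.+1.-tuple T => (thead t, [tuple of behead t])) => [[i c] _|t _] /=.
  by congr pair; apply: val_inj.
by rewrite -tuple_eta.
Qed.

Section WordAverage.
Context (n : nat) (R : realType) (p K : R) (n0 : nat).
Local Notation V := 'rV[int]_n.
Context (main : 'I_n0 -> 'I_n).
Hypotheses (main_inj : injective main) (p0 : 0 < p) (pK : p^-1 <= K) (K1 : 1 <= K)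
  (Kn0 : K <= 2 * n0%:R).
Implicit Types (x y z : V).

Definition meet_weight (b : bool) : R := if b then K else 1.

Lemma sum_unitv_perm (c c' : seq 'I_n) :
  \sum_(i <- c) unitv i = \sum_(i <- c') unitv i -> perm_eq c c'.
Proof.
have cnt (s : seq 'I_n) j : (\sum_(i <- s) unitv i) 0 j = (count_mem j s)%:Z.
  rewrite summxE; elim: s => [|i s IH]; first by rewrite big_nil.
  by rewrite big_cons IH unitvE/= PoszD natz.
move=> e; apply/allP => j _ /=; rewrite -eqz_nat -!cnt e; exact: eqxx.
Qed.

(** [meet_weight] is a supersolution up to the factor 5 n0^2. From a common vertex every pair of
    steps costs at most [K], and only the n0 equal pairs stay together, at cost K^2 <= 2 n0 K each.
    From different vertices at most one pair of steps meets, at cost K^2 <= 4 n0^2. *)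
Lemma step_average x x' :
  \sum_(i : 'I_n0) \sum_(i' : 'I_n0) step_cost p x x' (main i) (main i') *
     meet_weight (x + unitv (main i) == x' + unitv (main i'))
  <= 5 * n0%:R ^+ 2 * meet_weight (x == x').
Proof.
have K0 : 0 <= K by apply: le_trans K1.
have n00 : 0 <= n0%:R :> R by [].
have [<-|xx'] := eqVneq x x'.
  rewrite /meet_weight.
  apply: (@le_trans _ _ (\sum_(i : 'I_n0) \sum_(i' : 'I_n0)
      (K + if i' == i then K * K else 0))).
    apply: ler_sum => i _; apply: ler_sum => i' _.
    rewrite /step_cost eqxx/= (inj_eq (addrI _)) (inj_eq (@unitv_inj n)) (inj_eq main_inj).
    rewrite eq_sym; case: eqP => _.
      by apply: (@le_trans _ _ (K * K)); [rewrite ler_wpM2r|rewrite lerDr].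
    by rewrite mulr1 addr0.
  under eq_bigr do rewrite big_split/= -big_mkcond big_pred1_eq sumr_const card_ord.
  rewrite sumr_const card_ord -(mulr_natr (_ + _)) -(mulr_natr K).
  move: (n0%:R : R) n00 Kn0 => b b0 Kb.
  have h1 : K * K * b <= K * (2 * b) * b by rewrite ler_wpM2r// ler_wpM2l.
  have h2 : 0 <= K * b * b by rewrite !mulr_ge0.
  lra.
pose E (u : 'I_n0 * 'I_n0) := x + unitv (main u.1) == x' + unitv (main u.2).
apply: (@le_trans _ _ (\sum_(i : 'I_n0) \sum_(i' : 'I_n0)
    (1 + if E (i, i') then K * K else 0))).
  apply: ler_sum => i _; apply: ler_sum => i' _; rewrite /step_cost (negbTE xx')/= /E/=.
  case: ifP => _ /=; last by rewrite mulr1 addr0.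
  by apply: (@le_trans _ _ (K * K)); [rewrite ler_wpM2r|rewrite lerDr].
under eq_bigr do rewrite big_split/= sumr_const card_ord.
rewrite big_split/= sumr_const card_ord pair_big/= -big_mkcond/= sumr_const.
(* x - x' is a difference of two distinct unit vectors in at most one way. *)
have E1 : (#|[pred u | E u]| <= 1)%N.
  apply/card_le1_eqP => -[i i'] [j j']; rewrite !inE /E/= => /eqP ei /eqP ej.
  have h : unitv (main i) + unitv (main j') = unitv (main j) + unitv (main i').
    by apply: (@addrI _ (x + x')); rewrite addrACA ei -ej [RHS]addrACA addrC.
  have [e|ji] := eqVneq (main j) (main i).
    move: h; rewrite e => /addrI/unitv_inj/main_inj <-.
    by rewrite (main_inj e).
  have [e _] := unitv_pair h ji.
  by move: ej xx'; rewrite e => /addIr->; rewrite eqxx.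
have kk : K * K *+ #|[pred u | E u]| <= K * K.
  by rewrite -mulr_natr ler_piMr ?mulr_ge0// lern1.
rewrite (_ : #|_| = #|[pred u | E u]|); last by apply: eq_card => u; rewrite !inE; case: u.
rewrite mulr1 (_ : n0%:R *+ n0 = n0%:R * n0%:R); last by rewrite mulr_natr.
move: (n0%:R : R) n00 Kn0 => b b0 Kb.
have h1 : K * K <= (2 * b) * (2 * b) by rewrite ler_pM.
by rewrite expr2; lra.
Qed.

Lemma word_average m x x' :
  \sum_(c : m.-tuple 'I_n0) \sum_(c' : m.-tuple 'I_n0)
    word_cost p x x' (map main c) (map main c') *
    meet_weight (endp x (map main c) == endp x' (map main c'))
  <= (5 * n0%:R ^+ 2) ^+ m * meet_weight (x == x').
Proof.
elim: m x x' => [|m IH] x x'.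
  rewrite expr0 (eq_bigl (xpred1 [tuple])) => [|c]; last by rewrite tuple0 eqxx.
  rewrite big_pred1_eq (eq_bigl (xpred1 [tuple])) => [|c]; last by rewrite tuple0 eqxx.
  by rewrite big_pred1_eq.
rewrite big_tuple_cons.
under eq_bigr do under eq_bigr do rewrite big_tuple_cons/=.
apply: (@le_trans _ _ (\sum_(i : 'I_n0) \sum_(i' : 'I_n0)
   step_cost p x x' (main i) (main i') * ((5 * n0%:R ^+ 2) ^+ m *
   meet_weight (x + unitv (main i) == x' + unitv (main i'))))).
  apply: ler_sum => i _; rewrite exchange_big/=; apply: ler_sum => i' _.
  under eq_bigr do under eq_bigr do rewrite -mulrA.
  under eq_bigr do rewrite -mulr_sumr.
  rewrite -mulr_sumr ler_wpM2l//.
  by rewrite /step_cost; case: ifP => // _; rewrite invr_ge0 ltW.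
under eq_bigr do under eq_bigr do rewrite mulrCA.
under eq_bigr do rewrite -mulr_sumr.
rewrite -mulr_sumr (exprSr _ m) -[leRHS]mulrA ler_wpM2l ?exprn_ge0 ?mulr_ge0 ?exprn_ge0//.
exact: step_average.
Qed.

Lemma permutations_map m (c : m.-tuple 'I_n0) (F : seq 'I_n -> R) :
  \sum_(r <- permutations (map main c)) F r =
  \sum_(t : m.-tuple 'I_n0 | perm_eq t c) F (map main t).
Proof.
rewrite -[RHS]big_filter -(big_map (fun t => map main (tval t)) xpredT F).
apply: perm_big; apply: uniq_perm; first exact: permutations_uniq.
  rewrite map_inj_uniq ?filter_uniq ?index_enum_uniq//.
  by move=> t t' /(inj_map main_inj)/val_inj.
move=> r; rewrite mem_permutations; apply/idP/mapP => [rc|[t]].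
  have [t rt] : exists t, r = map main t.
    have : all (fun i => i \in codom main) r.
      apply/allP => i; rewrite (perm_mem rc) => /mapP[j _ ->].
      exact: codom_f.
    elim: r {rc} => [|i r IH] /=; first by exists [::].
    by move=> /andP[/codomP[j ->] /IH[t ->]]; exists (j :: t).
  have tc : perm_eq t c by apply: (perm_map_inj main_inj); rewrite -rt.
  have st : size t == m by rewrite (perm_size tc) size_tuple.
  by exists (Tuple st) => //; rewrite mem_filter/= tc mem_index_enum.
by rewrite mem_filter => /andP[tc _] ->; apply: perm_map.
Qed.

Lemma card_perm_tuple m (t : m.-tuple 'I_n0) : uniq t ->
  (#|[pred c : m.-tuple 'I_n0 | perm_eq c t]| <= m`!)%N.
Proof.
move=> ut; have -> : m`! = size (permutations t).
  by rewrite size_permutations// size_tuple.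
rewrite cardE -(size_map val); apply: uniq_leq_size.
  by rewrite map_inj_uniq ?enum_uniq//; apply: val_inj.
by move=> _ /mapP[c + ->]; rewrite mem_enum inE mem_permutations.
Qed.

(** A given word occurs among the orders of at most m! tuples, all of them its own
    rearrangements. *)
Lemma sum_uniq_permutations m (F : seq 'I_n -> R) : (forall r, 0 <= F r) ->
  \sum_(c : m.-tuple 'I_n0 | uniq c) \sum_(r <- permutations (map main c)) F r
  <= m`!%:R * \sum_(t : m.-tuple 'I_n0) F (map main t).
Proof.
move=> F0; under eq_bigr do rewrite permutations_map.
rewrite (exchange_big_dep xpredT)//= mulr_sumr; apply: ler_sum => t _.
rewrite sumr_const -[leLHS]mulr_natl ler_wpM2r// ler_nat.
have [ut|ut] := boolP (uniq t).
  apply: leq_trans (card_perm_tuple ut); apply: subset_leq_card.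
  by apply/fintype.subsetP => c; rewrite !inE => /andP[_]; rewrite perm_sym.
rewrite (eq_card0 (A := _)) => [//|c]; rewrite !inE.
by apply/negP => /andP[uc /perm_uniq tc]; move: ut; rewrite tc uc.
Qed.

Lemma route_average m x x' :
  \sum_(c : m.-tuple 'I_n0 | uniq c) \sum_(c' : m.-tuple 'I_n0 | uniq c')
    (\sum_(r <- permutations (map main c)) \sum_(r' <- permutations (map main c'))
       word_cost p x x' r r') *
    meet_weight (endp x (map main c) == endp x' (map main c'))
  <= m`!%:R ^+ 2 * (5 * n0%:R ^+ 2) ^+ m * meet_weight (x == x').
Proof.
pose F r r' := word_cost p x x' r r' * meet_weight (endp x r == endp x' r').
have F0 r r' : 0 <= F r r'.
  rewrite mulr_ge0 ?word_cost_ge0// /meet_weight; case: ifP => // _.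
  exact: le_trans K1.
apply: (@le_trans _ _ (\sum_(c : m.-tuple 'I_n0 | uniq c)
   \sum_(r <- permutations (map main c)) \sum_(c' : m.-tuple 'I_n0 | uniq c')
   \sum_(r' <- permutations (map main c')) F r r')).
  apply: ler_sum => c _; rewrite exchange_big/=; apply: ler_sum => c' _.
  rewrite mulr_suml !big_seq; apply: ler_sum => r rc.
  rewrite mulr_suml !big_seq; apply: ler_sum => r' rc'.
  move: rc rc'; rewrite !mem_permutations => /perm_endp e /perm_endp e'.
  by rewrite /F e e'.
apply: (le_trans (sum_uniq_permutations _ _)) => [r|].
  by apply: sumr_ge0 => c' _; apply: sumr_ge0.
rewrite expr2 -!mulrA ler_wpM2l//.
apply: (@le_trans _ _ (m`!%:R * \sum_(t : m.-tuple 'I_n0) \sum_(t' : m.-tuple 'I_n0)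
   F (map main t) (map main t'))).
  rewrite mulr_sumr; apply: ler_sum => t _.
  exact: sum_uniq_permutations.
by rewrite ler_wpM2l// word_average.
Qed.

End WordAverage.

(** * Returns of the special coordinates *)

Section Hits.
Context (R : realType) (B : finType).
Implicit Types (z : {ffun B -> int}) (s : B).

Definition unitf s : {ffun B -> int} := [ffun b => (b == s)%:R].

(* The probability that z plus r independent steps e_s - e_s', with s and s' uniform,
   is 0. *)
Fixpoint hit r z : R :=
  if r is r'.+1 then
    (\sum_(s : B) \sum_(s' : B) hit r' (z + unitf s - unitf s')) / #|B|%:R ^+ 2
  else (z == 0)%:R.

Definition hits k z : R := \sum_(1 <= r < k.+1) hit r z.

Lemma hit_ge0 r z : 0 <= hit r z.
Proof.
elim: r z => [|r IH] z /=; first exact: ler0n.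
by rewrite divr_ge0 ?exprn_ge0// sumr_ge0// => s _; rewrite sumr_ge0.
Qed.

Lemma hits_ge0 k z : 0 <= hits k z.
Proof. by apply: sumr_ge0 => r _; apply: hit_ge0. Qed.

Lemma hitsS k z : #|B|%:R ^+ 2 * hits k.+1 z =
  \sum_(s : B) \sum_(s' : B) ((z + unitf s - unitf s' == 0)%:R +
     hits k (z + unitf s - unitf s')).
Proof.
have [B0|B0] := eqVneq (#|B|%:R : R) 0.
  rewrite B0 expr0n mul0r big1// => s _.
  by move/eqP: B0; rewrite pnatr_eq0 => /eqP/card0_eq/(_ s).
rewrite /hits big_add1/= [LHS]mulr_sumr.
under [LHS]eq_bigr do rewrite /= mulrC divfK ?expf_neq0//.
rewrite exchange_big/=; apply: eq_bigr => s _.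
rewrite exchange_big/=; apply: eq_bigr => s' _.
by rewrite big_nat_recl// big_add1.
Qed.

End Hits.

Section BitHits.
Context (R : realType).

Fixpoint bit_hit r (t : int) : R :=
  if r is r'.+1 then
    \sum_(e : bool) \sum_(e' : bool) 4^-1 * bit_hit r' (t + e%:Z - e'%:Z)
  else (t == 0)%:R.

Definition binz m (j : int) : nat := if j is Posz k then 'C(m, k) else 0%N.

Lemma binzS m j : binz m.+1 j = (binz m j + binz m (j - 1))%N.
Proof.
case: j => [[|k]|k]; first by rewrite /= !bin0.
  by rewrite (_ : k.+1%:Z - 1 = k%:Z)/= ?binS//; lia.
by rewrite (_ : Negz k - 1 = Negz k.+1)//; lia.
Qed.

(** Replacing each e by 1 - e turns a return to 0 into the event that 2r fair bits have sum r +
    t. *)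
Lemma bit_hitE r t : bit_hit r t = (binz r.*2 (r%:Z + t))%:R / 4 ^+ r.
Proof.
elim: r t => [|r IH] t /=.
  rewrite expr0 divr1 add0r; case: t => [[|k]|k]//=.
rewrite !big_bool/= !IH doubleS !binzS.
have -> : r.+1%:Z + t - 1 - 1 = r%:Z + (t + 0%:Z - 1%:Z) by lia.
have -> : r.+1%:Z + t - 1 = r%:Z + t by lia.
have -> : r%:Z + (t + 1%:Z - 1%:Z) = r%:Z + t by lia.
have -> : r%:Z + (t + 0%:Z - 0%:Z) = r%:Z + t by lia.
have -> : r%:Z + (t + 1%:Z - 0%:Z) = r.+1%:Z + t by lia.
rewrite !natrD exprS; field; rewrite expf_neq0//.
Qed.

Lemma bin_le_mid r k : ('C(r.*2, k) <= 'C(r.*2, r))%N.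
Proof.
have low l : (l <= r)%N -> ('C(r.*2, r - l) <= 'C(r.*2, r))%N.
  elim: l => [|l IH] lr; first by rewrite subn0.
  apply: leq_trans (IH (ltnW lr)).
  have := mul_bin_left r.*2 (r - l.+1).
  have -> : (r - l.+1).+1 = (r - l)%N by lia.
  move=> e; rewrite -(@leq_pmul2l (r - l)) ?subn_gt0// e.
  by rewrite leq_mul2r; apply/orP; right; lia.
have [kr|rk] := leqP k r.
  by rewrite -[k](subKn kr); apply: low; rewrite leq_subr.
have [kr2|kr2] := leqP k r.*2; last by rewrite bin_small.
rewrite -bin_sub//.
have -> : (r.*2 - k = r - (k - r))%N by lia.
by apply: low; lia.
Qed.

Lemma central_bin_bound r : ('C(r.*2, r) ^ 2 * r.*2.+1 <= 16 ^ r)%N.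
Proof.
elim: r => // r IH.
have e : (r.+1 * 'C(r.+1.*2, r.+1) = 2 * r.*2.+1 * 'C(r.*2, r))%N.
  have h1 := mul_bin_diag r.*2.+2 r; have h2 := mul_bin_down r.*2.+1 r.
  rewrite /= in h1 h2; rewrite doubleS -h1 -mulnA h2.
  by rewrite mulnA; congr muln; lia.
have r1 : (0 < r.+1 ^ 2)%N by rewrite expn_gt0.
rewrite -(leq_pmul2l r1) mulnA -expnMn e !expnMn (expnS 16).
move: ('C(r.*2, r) ^ 2)%N IH => C IH.
(* Wallis-type step: it remains that (2r + 1)(2r + 3) <= (2r + 2)^2. *)
apply: (@leq_trans (2 ^ 2 * (r.*2.+1 * r.+1.*2.+1) * (C * r.*2.+1))).
  by rewrite leq_eqVlt; apply/orP; left; apply/eqP; ring.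
apply: (@leq_trans (2 ^ 2 * (4 * r.+1 ^ 2) * 16 ^ r)); last first.
  by rewrite leq_eqVlt; apply/orP; left; apply/eqP; ring.
rewrite leq_mul// leq_mul//.
by rewrite -!muln2; nia.
Qed.

Lemma bit_hit_ge0 r t : 0 <= bit_hit r t.
Proof. by rewrite bit_hitE divr_ge0. Qed.

Lemma bit_hit_bound r t : bit_hit r t ^+ 2 <= r.*2.+1%:R^-1.
Proof.
rewrite bit_hitE exprMn exprVn -exprM mulnC exprM ler_pdivrMr ?exprn_gt0//.
rewrite ler_pdivlMl//.
rewrite -!natrX -natrM ler_nat mulnC; apply: leq_trans (central_bin_bound r).
rewrite leq_mul2r leq_sqr; apply/orP; right.
by case: (_ + _) => [k|k] //=; exact: bin_le_mid.
Qed.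

End BitHits.

Section HitBound.
Context (R : realType) (a : nat).
Local Notation B := {ffun 'I_a -> bool}.

(* Special directions are labelled by bit strings. Under the walk of [hit] the sums
   over the labels with a given bit perform independent walks, one for each bit. *)
Definition bit_sum (z : {ffun B -> int}) (j : 'I_a) : int := \sum_(b : B | b j) z b.

Lemma bit_sum_step z s s' j :
  bit_sum (z + unitf s - unitf s') j = bit_sum z j + (s j)%:Z - (s' j)%:Z.
Proof.
have one (t : B) : \sum_(b : B | b j) unitf t b = (t j)%:Z.
  rewrite (eq_bigr (fun b => if b == t then 1 else 0)) => [|b _].
    rewrite -big_mkcondr/=; have [tj|tj] := boolP (t j).
      by rewrite (big_pred1 t)// => b /=; apply/andP/eqP => [[_ /eqP]//|->]; rewrite tj.
    by rewrite big1// => b /andP[bj /eqP bt]; move: tj; rewrite -bt bj.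
  by rewrite ffunE; case: (b == t).
rewrite /bit_sum -!one -big_split -sumrB; apply: eq_bigr => b _.
by rewrite !ffunE.
Qed.

(** The bits of a uniform label are independent and uniform, so the recursion factors over the bits.
    It is an inequality because vanishing bit sums do not force z = 0. *)
Lemma hit_le_prod r z : hit R r z <= \prod_(j < a) bit_hit R r (bit_sum z j).
Proof.
elim: r z => [|r IH] z /=.
  case: eqP => [->|_]; last by apply: prodr_ge0 => j _.
  rewrite big1// => j _; rewrite /bit_sum big1 ?eqxx// => b _.
  by rewrite ffunE.
have -> : #|{ffun 'I_a -> bool}|%:R ^+ 2 = \prod_(j < a) 4 :> R.
  by rewrite card_ffun card_bool card_ord natrX -exprM mulnC exprM prodr_const card_ord -natrX.
rewrite ler_pdivrMr ?prodr_gt0// mulrC -big_split/=.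
apply: (@le_trans _ _ (\sum_(s : B) \sum_(s' : B)
    \prod_(j < a) bit_hit R r (bit_sum z j + (s j)%:Z - (s' j)%:Z))).
  apply: ler_sum => s _; apply: ler_sum => s' _; apply: (le_trans (IH _)).
  by under eq_bigr do rewrite bit_sum_step.
pose F j (e e' : bool) := bit_hit R r (bit_sum z j + e%:Z - e'%:Z).
have E1 (s : B) : \sum_(s' : B) \prod_(j < a) F j (s j) (s' j) =
    \prod_(j < a) \sum_(e' : bool) F j (s j) e'.
  by rewrite (bigA_distr_bigA (fun j => F j (s j))).
rewrite (eq_bigr _ (fun s _ => E1 s)).
rewrite -(bigA_distr_bigA (fun j e => \sum_(e' : bool) F j e e')).
rewrite le_eqVlt; apply/orP; left; apply/eqP; apply: eq_bigr => j _.
rewrite mulr_sumr; apply: eq_bigr => e _.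
rewrite mulr_sumr; apply: eq_bigr => e' _.
by rewrite mulrA divff// mul1r.
Qed.

End HitBound.

Section HitsBound.
Context (R : realType) (a : nat).
Local Notation B := {ffun 'I_(a + 2).*2 -> bool}.

(** Each bit contributes a factor (2r + 1)^(-1/2); the even number of bits makes the exponent an
    integer. *)
Lemma hit_bound r (z : {ffun B -> int}) : hit R r z <= r.*2.+1%:R^-1 ^+ (a + 2).
Proof.
have h0 : 0 <= \prod_(j < (a + 2).*2) bit_hit R r (bit_sum z j).
  by apply: prodr_ge0 => j _; apply: bit_hit_ge0.
apply: (le_trans (hit_le_prod R r z)).
rewrite -(@ler_pXn2r _ 2)// ?nnegrE ?exprn_ge0 ?invr_ge0//.
rewrite -prodrXl -exprM muln2.
apply: (@le_trans _ _ (\prod_(j < (a + 2).*2) r.*2.+1%:R^-1)).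
  by apply: ler_prod => j _; rewrite sqr_ge0 bit_hit_bound.
by rewrite prodr_const card_ord.
Qed.

Lemma hits_bound k (z : {ffun B -> int}) : hits R k z <= 3^-1 ^+ a.
Proof.
(* As r >= 1, a of the factors 1 / (2r + 1) are at most 1/3; the other two are at most 1 / (r (r +
   1)), which telescopes. *)
suff h : hits R k z <= 3^-1 ^+ a * (1 - k.+1%:R^-1).
  by apply: (le_trans h); rewrite ger_pMr ?exprn_gt0// gerBl.
elim: k => [|k IH].
  by rewrite /hits big_nil invr1 subrr mulr0.
rewrite /hits big_nat_recr// -/(hits R k z).
apply: (le_trans (lerD IH (hit_bound _ _))).
rewrite exprD.
have h1 : k.+1.*2.+1%:R^-1 ^+ a <= (3^-1) ^+ a :> R.
  rewrite lerXn2r ?nnegrE// lef_pV2 ?posrE// ler_nat; lia.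
have h2 : k.+1.*2.+1%:R^-1 ^+ 2 <= k.+1%:R^-1 - k.+2%:R^-1 :> R.
  have -> : k.+1%:R^-1 - k.+2%:R^-1 = (k.+1 * k.+2)%:R^-1 :> R.
    have x0 : 0 < k.+1%:R :> R by [].
    rewrite natrM -[k.+2%:R]natr1; move: (k.+1%:R : R) x0 => x x0.
    by field; rewrite !gt_eqF//; lra.
  rewrite exprVn -natrX lef_pV2 ?posrE ?ltr0n// ler_nat.
  by rewrite -!muln2; nia.
have h3 : k.+1.*2.+1%:R^-1 ^+ a * k.+1.*2.+1%:R^-1 ^+ 2 <=
   3^-1 ^+ a * (k.+1%:R^-1 - k.+2%:R^-1) :> R by rewrite ler_pM// exprn_ge0.
by apply: (le_trans (lerD (lexx _) h3)); rewrite -mulrDr ler_wpM2l ?exprn_ge0// addrA subrK.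
Qed.

End HitsBound.

(** * Average cost of two block paths *)

Section Potential.
Context (n : nat) (R : realType) (p q K ka : R) (n0 m : nat) (B : finType).
Local Notation V := 'rV[int]_n.
Context (main : 'I_n0 -> 'I_n) (spec : B -> 'I_n).
Hypotheses (main_inj : injective main) (spec_inj : injective spec).
Hypothesis main_spec : forall i b, main i != spec b.
Implicit Types (x y z : V) (c : m.-tuple 'I_n0) (s : B).

(** [N] counts special directions, [D] main words without repetition, [M] the orders of such a word,
    and [Cm * D ^+ 2] dominates the constant of [route_average]. From a common vertex the recursion
    asks for VE / 4 + N / 2 + 3 Cm K <= VE, which with [N <= K] suggests [VE]. [VS] is the factor of
    [special_sum_le] times [Cm]. *)
Variables (N D M Cm VE VS : R).
Hypotheses (NE : N = #|B|%:R) (DE : D = (n0 ^_ m)%:R) (ME : M = m`!%:R)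
  (CmE : Cm = 4 * 5 ^+ m * M ^+ 2) (VEE : VE = (4 * Cm + 1) * K)
  (VSE : VS = ((4 * Cm + 1) * ka + 2) * Cm).
Hypotheses (p0 : 0 < p) (q0 : 0 < q) (pK : p^-1 <= K) (K1 : 1 <= K)
  (Kn0 : K <= 2 * n0%:R) (KN : K <= ka * N) (ka1 : 1 <= ka) (NK : N <= K)
  (VSN : VS <= N) (Dn0 : n0%:R ^+ m <= 2 * D) (KVE : K * VE * M <= D)
  (lam : 4 * M <= D * q * N * p)
  (small_hits : forall k (z : {ffun B -> int}), VS * hits R k z <= 1).

Definition spec_diff x x' : {ffun B -> int} := [ffun b => x 0 (spec b) - x' 0 (spec b)].

(* A supersolution of the recursion satisfied by the average of [path_cost] over
   pairs of block paths of length k from x and x': VE and VS dominate it at equal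
   vertices and at equal special coordinates; elsewhere the cost exceeds 1 only
   through later returns, whose expected number is at most [hits k]. *)
Definition potential k x x' : R :=
  if spec_diff x x' == 0 then (if x == x' then VE else VS)
  else 1 + VS * hits R k (spec_diff x x').

Let M1 : 1 <= M. Proof. by rewrite ME ler1n fact_gt0. Qed.
Let Cm1 : 1 <= Cm.
Proof.
have h5 : 1 <= 5 ^+ m :> R by rewrite exprn_ege1// ler1n.
have hM : 1 <= M ^+ 2 by rewrite exprn_ege1.
by have := mulr_ege1 h5 hM; rewrite CmE -mulrA; lra.
Qed.
Let C1 : 1 <= (4 * Cm + 1) * ka.
Proof. by rewrite mulr_ege1//; have := Cm1; lra. Qed.
Let VS1 : 1 <= VS.
Proof. by rewrite VSE mulr_ege1//; have := C1; lra. Qed.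
Let VE1 : 1 <= VE. Proof. by rewrite VEE mulr_ege1//; have := Cm1; lra. Qed.
Let N0 : 0 < N. Proof. by rewrite (lt_le_trans _ VSN)// (lt_le_trans _ VS1). Qed.
Let D0 : 0 < D.
Proof.
exact: (lt_le_trans (mulr_gt0 (mulr_gt0 (lt_le_trans ltr01 K1)
  (lt_le_trans ltr01 VE1)) (lt_le_trans ltr01 M1)) KVE).
Qed.

Let pV0 : 0 <= p^-1. Proof. by rewrite invr_ge0 ltW. Qed.

Lemma spec_eqE x x' : spec_eq spec x x' = (spec_diff x x' == 0).
Proof.
apply/forallP/eqP => [h|h b]; first by apply/ffunP => b; rewrite !ffunE (eqP (h b)) subrr.
by have /ffunP/(_ b) := h; rewrite !ffunE => /eqP; rewrite subr_eq0.
Qed.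

Lemma spec_diffxx x : spec_diff x x = 0.
Proof. by apply/eqP; rewrite -spec_eqE spec_eqxx. Qed.

Lemma spec_diff_step x x' s s' :
  spec_diff (x + unitv (spec s)) (x' + unitv (spec s')) =
  spec_diff x x' + unitf s - unitf s'.
Proof.
apply/ffunP => b; rewrite !ffunE !mxE eqxx/= !(inj_eq spec_inj).
by case: (b == s); case: (b == s') => /=; ring.
Qed.

Lemma unitf_inj s s' : unitf s - unitf s' = 0 -> s = s'.
Proof.
by move/ffunP/(_ s); rewrite !ffunE eqxx; case: eqP.
Qed.

Lemma spec_diff_word x x' c c' :
  spec_diff (endp x (map main c)) (endp x' (map main c')) = spec_diff x x'.
Proof.
apply/ffunP => b; rewrite !ffunE !(endp_spec (spec := spec))// => i /mapP[j _ ->] //.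
Qed.

Lemma potential_ge1 k x x' : 1 <= potential k x x'.
Proof.
rewrite /potential; case: ifP => _; first by case: ifP.
by rewrite lerDl mulr_ge0 ?hits_ge0// (le_trans ler01).
Qed.

Lemma potential_off k x x' : spec_diff x x' != 0 -> potential k x x' <= 2.
Proof. by rewrite /potential => /negbTE->; have := small_hits k (spec_diff x x'); lra. Qed.

Definition special_sum k y y' : R := \sum_(s : B) \sum_(s' : B)
  step_cost p y y' (spec s) (spec s') *
  potential k (y + unitv (spec s)) (y' + unitv (spec s')).

Let sum_diag (a : R) : \sum_(s : B) \sum_(s' : B) ((if s' == s then a else 0) + 2) =
  N * a + 2 * N ^+ 2.
Proof.
under eq_bigr do rewrite big_split/= -big_mkcond big_pred1_eq sumr_const.
rewrite sumr_const cardT -cardE -(mulr_natr (_ + _)) -(mulr_natr 2) -NE.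
by ring.
Qed.

Lemma special_sum_eq k y : special_sum k y y <= p^-1 * (N * VE + 2 * N ^+ 2).
Proof.
rewrite -sum_diag mulr_sumr; apply: ler_sum => s _.
rewrite mulr_sumr; apply: ler_sum => s' _.
rewrite /step_cost eqxx/= ler_wpM2l//.
have [<-|ss'] := eqVneq s s'.
  by rewrite /potential spec_diffxx !eqxx/= lerDl.
rewrite add0r potential_off// spec_diff_step spec_diffxx add0r.
by apply: contra ss' => /eqP/unitf_inj->.
Qed.

(** Only [N] pairs of special steps are equal, and [VS <= N] makes their share at most N^2; all
    other pairs separate the special coordinates, where the potential is at most 2. *)
Lemma special_sum_neq k y y' : spec_diff y y' = 0 -> y != y' ->
  special_sum k y y' <= 3 * N ^+ 2.
Proof.
move=> d0 yy'; apply: (@le_trans _ _ (N * VS + 2 * N ^+ 2)); last first.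
  by rewrite expr2; have := ler_wpM2l (ltW N0) VSN; lra.
rewrite -sum_diag; apply: ler_sum => s _; apply: ler_sum => s' _.
have dE := spec_diff_step y y' s s'; rewrite d0 add0r in dE.
rewrite /step_cost (negbTE yy')/=.
have [e|ss'] := eqVneq s s'.
  rewrite -e (inj_eq (addIr _)) (negbTE yy') mul1r.
  by rewrite /potential (inj_eq (addIr _)) (negbTE yy') spec_diff_step d0 add0r subrr eqxx/= lerDl.
have nz : spec_diff (y + unitv (spec s)) (y' + unitv (spec s')) != 0.
  by rewrite dE; apply: contra ss' => /eqP/unitf_inj->.
case: eqP => [e|_]; first by move: nz; rewrite e spec_diffxx eqxx.
by rewrite mul1r add0r potential_off.
Qed.

(** At a common vertex the [N] equal special steps bring [VE], proportional to [K]; [K <= ka * N]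
    turns their share into order N^2, so that the only factor [K] left is the one for [p^-1]. *)
Lemma special_sum_le k y y' : spec_diff y y' = 0 ->
  special_sum k y y' <=
    N ^+ 2 * ((4 * Cm + 1) * ka + 2) * meet_weight K (y == y').
Proof.
move=> d0; have [<-|yy'] := eqVneq y y'; last first.
  apply: (le_trans (special_sum_neq k d0 yy')).
  rewrite mulr1 mulrC ler_wpM2l ?sqr_ge0//.
  by have := C1; lra.
apply: (le_trans (special_sum_eq k y)).
have h : N * VE + 2 * N ^+ 2 <= N ^+ 2 * ((4 * Cm + 1) * ka + 2).
  rewrite mulrDr [2 * _]mulrC lerD2r expr2 -mulrA.
  apply: ler_wpM2l; first exact: ltW.
  rewrite VEE mulrCA; apply: ler_wpM2l; last by rewrite mulrC.
  by have := Cm1; lra.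
rewrite /meet_weight mulrC ler_pM//.
  by have := N0; have := VE1; nra.
Qed.

Lemma sum_uniq_tuples : \sum_(c : m.-tuple 'I_n0 | uniq c) 1 = D.
Proof.
rewrite sumr_const DE; congr (_%:R).
rewrite -[in RHS](card_ord n0) -card_uniq_tuples cardsE.
apply: eq_card => c; rewrite !unfold_in.
by rewrite (_ : all _ c) //; apply/allP.
Qed.

Lemma sum_perm_tuples c : uniq c -> \sum_(c' : m.-tuple 'I_n0 | uniq c') (perm_eq c c')%:R <= M.
Proof.
move=> uc; rewrite (@le_trans _ _ (\sum_(c' : m.-tuple 'I_n0 | perm_eq c' c) 1))//; last first.
  by rewrite sumr_const ME ler_nat; apply: card_perm_tuple.
rewrite [leRHS]big_mkcond [leLHS]big_mkcond/=; apply: ler_sum => c' _.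
by rewrite perm_sym; case: ifP => _; case: (perm_eq _ _).
Qed.

Lemma perm_endp_eq x c c' :
  (endp x (map main c) == endp x (map main c')) = perm_eq c c'.
Proof.
apply/eqP/idP => [|cc']; last by apply: perm_endp; apply: perm_map.
by rewrite !endpE => /addrI/sum_unitv_perm/(perm_map_inj main_inj).
Qed.

Lemma sum_endp_eq x w : \sum_(c : m.-tuple 'I_n0 | uniq c) (endp x (map main c) == w)%:R <= M.
Proof.
have [c0 /andP[u0 /eqP e0]|none] :=
    pickP (fun c => uniq c && (endp x (map main c) == w)); last first.
  rewrite big1 => [|c uc]; first by rewrite (le_trans ler01).
  by have := none c; rewrite uc /= => ->.
apply: le_trans (sum_perm_tuples u0); apply: ler_sum => c _.
by rewrite -e0 perm_endp_eq perm_sym.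
Qed.

Definition block_sum k x x' : R := \sum_(c : m.-tuple 'I_n0 | uniq c) \sum_(c' : m.-tuple 'I_n0 | uniq c')
  route_cost p q spec x x' (map main c) (map main c') *
  special_sum k (endp x (map main c)) (endp x' (map main c')).

Let pairs_const (a : R) : \sum_(c : m.-tuple 'I_n0 | uniq c) \sum_(c' : m.-tuple 'I_n0 | uniq c') a = D ^+ 2 * a.
Proof.
have e b : \sum_(c : m.-tuple 'I_n0 | uniq c) b = D * b.
  by rewrite -sum_uniq_tuples mulr_suml; apply: eq_bigr => c _; rewrite mul1r.
by rewrite (eq_bigr (fun=> D * a)) ?e ?expr2 ?mulrA// => c _; exact: e.
Qed.

(** The routes cost 1, and the special steps move [spec_diff] like the walk of [hits], so [hitsS]
    closes the recursion. Meeting at a vertex costs up to [K * VE], but for each main word of the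
    first path at most [M] words of the second lead there, and [K * VE * M <= D] absorbs this. *)
Lemma block_sum_off k x x' : spec_diff x x' != 0 ->
  block_sum k x x' <= (D * N) ^+ 2 * potential k.+1 x x'.
Proof.
move=> nz; pose zn s s' := spec_diff x x' + unitf s - unitf s'.
pose T s s' := if zn s s' == 0 then VS else 1 + VS * hits R k (zn s s').
have KVE0 : 0 <= K * VE by rewrite mulr_ge0// (le_trans ler01).
have KV : VE <= K * VE by rewrite ler_peMl// (le_trans ler01).
have term c c' s s' : step_cost p (endp x (map main c)) (endp x' (map main c'))
     (spec s) (spec s') * potential k (endp x (map main c) + unitv (spec s))
     (endp x' (map main c') + unitv (spec s')) <=
   T s s' + (zn s s' == 0)%:R * (K * VE) *
    (endp x' (map main c') == endp x (map main c) + unitv (spec s) - unitv (spec s'))%:R.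
  have dE := spec_diff_step (endp x (map main c)) (endp x' (map main c')) s s'.
  rewrite spec_diff_word -/(zn s s') in dE.
  have ne : (endp x (map main c) == endp x' (map main c')) = false.
    apply/eqP => e; move: nz; rewrite -(spec_diff_word x x' c c') e.
    by rewrite spec_diffxx eqxx.
  move: dE ne; move: (endp x _) (endp x' _) => y y' dE ne.
  rewrite /T; move: (zn s s') dE => w dE.
  rewrite /step_cost ne /potential dE [y' == _]eq_sym subr_eq /=.
  have VS0 : 0 <= VS by rewrite (le_trans ler01).
  have VE0 : 0 <= VE by rewrite (le_trans ler01).
  case: (eqVneq w 0) => [_|zn0].
    case: eqP => _; rewrite mul1r ?mulr1 ?mulr0 ?addr0 ?mul1r//.
    by apply: ler_wpDl => //; apply: ler_wpM2r.
  case: eqP => [e|_]; first by move: zn0; rewrite -dE e spec_diffxx eqxx.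
  by rewrite !mul0r addr0 mul1r.
have cnt s s' : \sum_(c : m.-tuple 'I_n0 | uniq c) \sum_(c' : m.-tuple 'I_n0 | uniq c')
    (endp x' (map main c') == endp x (map main c) + unitv (spec s) - unitv (spec s'))%:R
    <= D * M.
  rewrite -sum_uniq_tuples mulr_suml; apply: ler_sum => c _.
  by rewrite mul1r; apply: sum_endp_eq.
have total s s' : \sum_(c : m.-tuple 'I_n0 | uniq c) \sum_(c' : m.-tuple 'I_n0 | uniq c')
    step_cost p (endp x (map main c)) (endp x' (map main c'))
     (spec s) (spec s') * potential k (endp x (map main c) + unitv (spec s))
     (endp x' (map main c') + unitv (spec s')) <=
    D ^+ 2 * (1 + VS * ((zn s s' == 0)%:R + hits R k (zn s s'))).
  apply: (@le_trans _ _ (D ^+ 2 * T s s' + (zn s s' == 0)%:R * (K * VE) * (D * M))).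
    rewrite -pairs_const; apply: (le_trans (ler_sum _ (fun c _ =>
      ler_sum _ (fun c' _ => term c c' s s')))).
    under eq_bigr do rewrite big_split/= -mulr_sumr.
    rewrite big_split/= -mulr_sumr lerD2l ler_wpM2l//.
    by rewrite mulr_ge0.
  have h0 := hits_ge0 R k (zn s s').
  have VS0 : 0 <= VS by rewrite (le_trans ler01).
  rewrite /T; case: eqP => _; last by rewrite !mul0r addr0 add0r.
  rewrite mul1r.
  have h1 : K * VE * (D * M) <= D ^+ 2 * 1.
    by rewrite mulr1 expr2 mulrCA ler_wpM2l// ltW.
  apply: (le_trans (lerD (lexx _) h1)); rewrite -mulrDr ler_wpM2l ?sqr_ge0//.
  have := mulr_ge0 VS0 h0; rewrite mulrDr mulr1; lra.
rewrite /block_sum /route_cost spec_eqE (negbTE nz)/=.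
apply: (@le_trans _ _ (\sum_(s : B) \sum_(s' : B)
   D ^+ 2 * (1 + VS * ((zn s s' == 0)%:R + hits R k (zn s s'))))).
  under eq_bigr do under eq_bigr do rewrite mul1r /special_sum.
  under eq_bigr do rewrite exchange_big/=.
  rewrite exchange_big/=; apply: ler_sum => s _.
  under eq_bigr do rewrite exchange_big/=.
  by rewrite exchange_big/=; apply: ler_sum => s' _.
rewrite /potential (negbTE nz).
under eq_bigr do rewrite -mulr_sumr.
rewrite -mulr_sumr exprMn -[leRHS]mulrA ler_wpM2l ?sqr_ge0//.
under eq_bigr do rewrite big_split/= -mulr_sumr.
rewrite big_split/= -mulr_sumr -hitsS !sumr_const.
rewrite (_ : #|B|%:R *+ #|B| = #|B|%:R ^+ 2); last by rewrite -mulr_natr expr2.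
by rewrite -NE mulrDr mulr1 mulrCA.
Qed.

Let n0_bound : (5 * n0%:R ^+ 2) ^+ m = 5 ^+ m * (n0%:R ^+ m) ^+ 2 :> R.
Proof. by rewrite exprMn -!exprM mulnC. Qed.

Let n0_bound2 : (n0%:R ^+ m) ^+ 2 <= (2 * D) ^+ 2.
Proof. by rewrite lerXn2r ?nnegrE ?exprn_ge0// mulr_ge0// ltW. Qed.

Lemma block_sum_diff k x x' : spec_diff x x' = 0 -> x != x' ->
  block_sum k x x' <= (D * N) ^+ 2 * potential k.+1 x x'.
Proof.
move=> d0 xx'; rewrite /block_sum /route_cost spec_eqE d0 eqxx (negbTE xx')/=.
rewrite /potential d0 eqxx (negbTE xx').
have ck0 : 0 <= (4 * Cm + 1) * ka + 2 by have := C1; lra.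
apply: (@le_trans _ _ (N ^+ 2 * ((4 * Cm + 1) * ka + 2) *
   (M ^+ 2 * (5 * n0%:R ^+ 2) ^+ m * meet_weight K (x == x')))).
  rewrite ME; apply: (le_trans _ (ler_wpM2l _
    (route_average main_inj p0 pK K1 Kn0 m x x'))); last by rewrite mulr_ge0 ?sqr_ge0.
  rewrite mulr_sumr; apply: ler_sum => c _; rewrite mulr_sumr; apply: ler_sum => c' _.
  rewrite mulrCA; apply: ler_wpM2l.
    by do 2!(apply: sumr_ge0 => ? _); apply: word_cost_ge0.
  by apply: special_sum_le; rewrite spec_diff_word.
rewrite /meet_weight (negbTE xx') mulr1 n0_bound VSE.
move: ((4 * Cm + 1) * ka + 2) ck0 => c0 ck0.
apply: (@le_trans _ _ (N ^+ 2 * c0 * (M ^+ 2 * (5 ^+ m * (2 * D) ^+ 2)))).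
  apply: ler_wpM2l; first exact: mulr_ge0 (sqr_ge0 _) ck0.
  apply: ler_wpM2l; first exact: sqr_ge0.
  by rewrite ler_wpM2l ?exprn_ge0// n0_bound2.
by rewrite CmE le_eqVlt; apply/orP; left; apply/eqP; ring.
Qed.

(** There are [D / M] routes and [N] special steps, and [lam] says that D q N p / M, a lower bound
    for the mean number of open blocks up to dependence, is at least 4. So coinciding routes
    reproduce at most a quarter of VE + 2N. Different routes end at different vertices and
    contribute terms free of [VE]. *)
Lemma block_sum_same k x : block_sum k x x <= (D * N) ^+ 2 * potential k.+1 x x.
Proof.
rewrite /block_sum /route_cost spec_eqxx eqxx/= /potential spec_diffxx !eqxx.
pose W c c' := \sum_(r <- permutations (map main c))
  \sum_(r' <- permutations (map main c')) word_cost p x x r r'.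
have W0 c c' : 0 <= W c c'.
  by do 2!(apply: sumr_ge0 => ? _); apply: word_cost_ge0.
have perm_main c c' : perm_eq (map main c) (map main c') = perm_eq c c'.
  apply/idP/idP; [exact: perm_map_inj|exact: perm_map].
pose S := p^-1 * (N * VE + 2 * N ^+ 2).
have S0 : 0 <= S.
  by rewrite mulr_ge0// addr_ge0// mulr_ge0 ?sqr_ge0// ?(ltW N0)// (le_trans ler01).
have qV0 : 0 <= q^-1 by rewrite invr_ge0 ltW.
apply: (@le_trans _ _ (\sum_(c : m.-tuple 'I_n0 | uniq c) \sum_(c' : m.-tuple 'I_n0 | uniq c')
  (q^-1 * S * (perm_eq c c')%:R + 3 * N ^+ 2 * (W c c' *
    meet_weight K (endp x (map main c) == endp x (map main c')))))).
  apply: ler_sum => c _; apply: ler_sum => c' _.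
  have mw0 : 0 <= meet_weight K (endp x (map main c) == endp x (map main c')).
    by rewrite /meet_weight; case: ifP => // _; rewrite (le_trans ler01).
  have N2 : 0 <= 3 * N ^+ 2 by rewrite mulr_ge0 ?sqr_ge0.
  have [cc'|ncc'] := boolP (perm_eq c c').
    rewrite perm_main cc' mulr1 -[leLHS]addr0 lerD//; last first.
      by rewrite mulr_ge0// mulr_ge0.
    rewrite ler_wpM2l// (perm_endp x (perm_map main cc')).
    exact: special_sum_eq.
  rewrite perm_main (negbTE ncc') mulr0 add0r perm_endp_eq (negbTE ncc') mulr1.
  rewrite [leRHS]mulrC; apply: ler_wpM2l; first exact: W0.
  apply: special_sum_neq.
    by rewrite spec_diff_word spec_diffxx.
  by rewrite perm_endp_eq.
under eq_bigr do rewrite big_split/= -!mulr_sumr.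
rewrite big_split/= -!mulr_sumr.
have h1 : \sum_(c : m.-tuple 'I_n0 | uniq c) \sum_(c' : m.-tuple 'I_n0 | uniq c')
    (perm_eq c c')%:R <= D * M.
  rewrite -sum_uniq_tuples mulr_suml; apply: ler_sum => c uc.
  by rewrite mul1r; apply: sum_perm_tuples.
have h2 := route_average main_inj p0 pK K1 Kn0 m x x.
rewrite -ME n0_bound eqxx in h2.
have h3 : M ^+ 2 * (5 ^+ m * (n0%:R ^+ m) ^+ 2) * K <= D ^+ 2 * (Cm * K).
  have -> : D ^+ 2 * (Cm * K) = M ^+ 2 * (5 ^+ m * (2 * D) ^+ 2) * K.
    by rewrite CmE; ring.
  rewrite ler_wpM2r ?(le_trans ler01)// ler_wpM2l ?sqr_ge0//.
  by rewrite ler_wpM2l ?exprn_ge0// n0_bound2.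
apply: (le_trans (lerD (ler_wpM2l (mulr_ge0 qV0 S0) h1)
   (ler_wpM2l (mulr_ge0 _ (sqr_ge0 N)) (le_trans h2 h3)))) => //.
have h4 : q^-1 * S * (D * M) <= (D * N) ^+ 2 * (4^-1 * (VE + 2 * N)).
  have -> : q^-1 * S * (D * M) = (D * N / (q * p)) * M * (VE + 2 * N).
    by rewrite /S; field; rewrite !gt_eqF.
  rewrite mulrA; apply: ler_wpM2r.
    by rewrite addr_ge0 ?mulr_ge0// ?(ltW N0)// (le_trans ler01).
  have qp0 : 0 < q * p by rewrite mulr_gt0.
  have -> : (D * N) ^+ 2 / 4 = (D * N / (q * p)) * (4^-1 * (D * q * N * p)).
    by field; rewrite !gt_eqF.
  apply: ler_wpM2l; first by rewrite divr_ge0 ?mulr_ge0 ?ltW.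
  by have := lam; lra.
apply: (le_trans (lerD h4 (lexx _))).
have -> : 3 * N ^+ 2 * (D ^+ 2 * (Cm * K)) = (D * N) ^+ 2 * (3 * (Cm * K)) by ring.
rewrite -mulrDr ler_wpM2l ?sqr_ge0// VEE.
have CK := mulr_ge0 (le_trans ler01 Cm1) (le_trans ler01 K1).
have -> : (4 * Cm + 1) * K = 4 * (Cm * K) + K by ring.
move: (Cm * K) CK => ck ck0; have := NK; have := K1; lra.
Qed.

Lemma block_sum_le k x x' : block_sum k x x' <= (D * N) ^+ 2 * potential k.+1 x x'.
Proof.
have [d0|nz] := eqVneq (spec_diff x x') 0; last exact: block_sum_off.
have [<-|xx'] := eqVneq x x'; first exact: block_sum_same.
exact: block_sum_diff.
Qed.

Let sum_blocks (F : block n0 m B -> R) :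
  \sum_(u <- blocks n0 m B) F u =
  \sum_(c : m.-tuple 'I_n0 | uniq c) \sum_(s : B) F (c, s).
Proof.
rewrite /blocks big_filter big_enum_cond/= pair_big/=.
by apply: eq_big => [[c s]|[c s]] //=; rewrite ?andbT.
Qed.

Lemma size_blocks : (size (blocks n0 m B))%:R = D * N :> R.
Proof.
transitivity (\sum_(u <- blocks n0 m B) 1 : R).
  by rewrite big_const_seq count_predT iter_addr_0.
rewrite sum_blocks -sum_uniq_tuples mulr_suml; apply: eq_bigr => c _.
by rewrite sumr_const mul1r NE.
Qed.

Lemma path_cost_sum k x x' :
  \sum_(g <- bpaths n0 m B k) \sum_(g' <- bpaths n0 m B k)
    path_cost p q main spec x x' g g'
  <= (D * N) ^+ k.*2 * potential k x x'.
Proof.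
elim: k x x' => [|k IH] x x'.
  by rewrite !big_seq1/= mul1r potential_ge1.
rewrite /= big_allpairs_dep/=.
under eq_bigr do under eq_bigr do rewrite big_allpairs_dep/=.
apply: (@le_trans _ _ (\sum_(u <- blocks n0 m B) \sum_(u' <- blocks n0 m B)
   block_cost p q main spec x x' u u' * ((D * N) ^+ k.*2 *
     potential k (bnext main spec x u) (bnext main spec x' u')))).
  apply: ler_sum => u _; rewrite exchange_big/=; apply: ler_sum => u' _.
  under eq_bigr do rewrite -mulr_sumr.
  rewrite -mulr_sumr; apply: ler_wpM2l => //.
  rewrite mulr_ge0//.
    rewrite /route_cost; case: ifP => // _; case: ifP => _; first by rewrite invr_ge0 ltW.
    by do 2!(apply: sumr_ge0 => ? _); apply: word_cost_ge0.
  by rewrite /step_cost; case: ifP.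
under eq_bigr do under eq_bigr do rewrite mulrCA.
under eq_bigr do rewrite -mulr_sumr.
rewrite -mulr_sumr doubleS -addn2 exprD -mulrA.
apply: ler_wpM2l; first by rewrite exprn_ge0// mulr_ge0 ?ltW.
apply: le_trans (block_sum_le k x x').
rewrite sum_blocks le_eqVlt; apply/orP; left; apply/eqP.
apply: eq_bigr => c _; under eq_bigr do rewrite sum_blocks.
rewrite exchange_big/=; apply: eq_bigr => c' _.
rewrite /special_sum mulr_sumr; apply: eq_bigr => s _.
rewrite mulr_sumr; apply: eq_bigr => s' _.
by rewrite /block_cost/= mulrA.
Qed.

End Potential.

(** * Percolation above the threshold *)

(** Expresses infinity by countable operations, which makes percolation measurable. *)
Lemma infinite_pickle (T : countType) (A : set T) :
  infinite_set A <-> forall K, exists2 y, A y & (K <= pickle y)%N.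
Proof.
split=> [infA K|h /finite_seqP[s sA]].
  apply: contrapT => noy; apply: infA.
  apply: (@sub_finite_set _ _ [set` pmap (@pickle_inv T) (iota 0 K)]); last first.
    exact: finite_seq.
  move=> y Ay /=; rewrite mem_pmap; apply/mapP; exists (pickle y).
    rewrite mem_iota add0n; case: leqP => // Ky.
    by exfalso; apply: noy; exists y.
  by rewrite pickleK_inv.
have [y Ay] := h (\max_(y <- s) pickle y).+1.
by rewrite ltnNge leq_bigmax_seq//; move: Ay; rewrite sA.
Qed.

Section PercolationEvent.
Context (G : digraph).
Implicit Types (x y : vertex G) (w : config G).

Definition percolation_event : set (config G) :=
  [set w | exists x, infinite_set (reachable w x)].

Lemma measurable_open_step x y : measurable [set w : config G | open_step w x y].
Proof.
rewrite /open_step; case: insubP => [e _ exy|_] /=.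
  exact: (measurable_is_open e).
rewrite (_ : [set _ | _] = set0); first exact: measurable0.
by apply/seteqP; split.
Qed.

Lemma measurable_path x (s : seq (vertex G)) :
  measurable [set w : config G | path (open_step w) x s].
Proof.
elim: s x => [|y s IH] x /=.
  rewrite (_ : [set _ | _] = setT); first exact: measurableT.
  by apply/seteqP; split.
rewrite (_ : [set _ | _] = [set w : config G | open_step w x y] `&`
  [set w : config G | path (open_step w) y s]).
  by apply: measurableI => //; exact: measurable_open_step.
by apply/seteqP; split=> [w /= /andP[]|w /= [-> ->]].
Qed.

Lemma measurable_reachable x y : measurable [set w : config G | reachable w x y].
Proof.
rewrite (_ : [set _ | _] = \bigcup_s (if last x s == y then
  [set w : config G | path (open_step w) x s] else set0)).
  apply: countable_bigcupT_measurable => // s.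
  by case: ifP => // _; exact: measurable_path.
apply/seteqP; split=> w /=; first by move=> [s ps ls]; exists s => //; rewrite ls eqxx.
by move=> [s _]; case: eqP => // ls ps; exists s.
Qed.

Lemma percolation_eventE : percolation_event =
  \bigcup_x \bigcap_(K in [set: nat]) \bigcup_y
    (if (K <= pickle y)%N then [set w : config G | reachable w x y] else set0).
Proof.
apply/seteqP; split=> w /=.
  move=> [x /infinite_pickle h]; exists x => // K _.
  by have [y xy Ky] := h K; exists y => //; rewrite Ky.
move=> [x _ h]; exists x; apply/infinite_pickle => K.
by have [y _] := h K I; case: ifP => // Ky xy; exists y.
Qed.

Lemma measurable_percolation : measurable percolation_event.
Proof.
rewrite percolation_eventE.
apply: countable_bigcupT_measurable => // x; apply: bigcapT_measurable => K.
apply: countable_bigcupT_measurable => // y.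
by case: ifP => // _; exact: measurable_reachable.
Qed.

End PercolationEvent.

Section LatticePercolation.
Context (n : nat) (R : realType).
Local Notation V := 'rV[int]_n.
Context (P : probability (config (dlattice n)) R).

Definition reach_level (x : V) k : set (config (dlattice n)) :=
  \bigcup_(y : V) (if k%:Z <= level y then
    [set w : config (dlattice n) | reachable w x y] else set0).

Lemma reach_levelP x k w : reach_level x k w <->
  exists2 y : V, k%:Z <= level y & reachable w x y.
Proof.
split=> [[y _]|[y ky xy]]; first by case: ifP => // ky xy; exists y.
by exists y => //; rewrite ky.
Qed.

Lemma measurable_reach_level x k : measurable (reach_level x k).
Proof.
apply: countable_bigcupT_measurable => // y; case: ifP => // _.
exact: measurable_reachable.
Qed.

Lemma infinite_reach_level x w : (forall k, reach_level x k w) ->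
  infinite_set (reachable w x).
Proof.
move=> h /finite_seqP[s sE].
have [y ky xy] := (reach_levelP x (\max_(y <- s) `|level y|%N).+1 w).1 (h _).
have : y \in s by move: xy; rewrite sE.
move=> ys; have := @leq_bigmax_seq _ s xpredT (fun z : V => `|level z|%N) y ys isT; lia.
Qed.

(** The events decrease in [k], so their intersection still has probability at least [c], and on it
    the levels reached from [x] are unbounded. *)
Lemma percolates_reach_level x (c : R) : 0 < c ->
  (forall k, c <= pr P (reach_level x k)) -> percolates P.
Proof.
move=> c0 ck; rewrite /percolates -/(@percolation_event (dlattice n)).
have mc : measurable (\bigcap_k reach_level x k).
  by apply: bigcapT_measurable => k; exact: measurable_reach_level.
apply: (@lt_le_trans _ _ (P (\bigcap_k reach_level x k))); last first.
  apply: le_measure; rewrite ?inE//; first exact: measurable_percolation.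
  by move=> w h; exists x; apply: infinite_reach_level => k; exact: h.
apply: (@lt_le_trans _ _ c%:E); first by rewrite lte_fin.
have cv := @nonincreasing_cvg_mu _ _ _ P (reach_level x) _
  (measurable_reach_level x) mc _.
have {}cv : P \o reach_level x @ \oo --> P (\bigcap_k reach_level x k).
  apply: cv; last first.
    move=> k l kl; apply/subsetPset => w /reach_levelP[y ky xy].
    by apply/reach_levelP; exists y => //; lia.
  apply: (le_lt_trans (probability_le1 _ _)); last by rewrite ltry.
  exact: measurable_reach_level.
rewrite -(cvg_lim _ cv)//; apply: lime_ge; first by apply/cvg_ex; eexists; exact: cv.
by apply: nearW => k /=; rewrite -prE ?lee_fin//; exact: measurable_reach_level.
Qed.

Lemma word_open_reachable (x : V) (c : seq 'I_n) w : word_open x c w -> reachable w x (endp x c).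
Proof.
elim: c x => [|i c IH] x /=; first by move=> _; exists [::].
move=> [xi /IH[s ps ls]]; exists (x + unitv i :: s) => //=; rewrite ps andbT.
rewrite /open_step; case: insubP => [e _ exy|] /=; last by rewrite arc_step.
by rewrite (_ : e = stepe x i) //; apply: val_inj.
Qed.

End LatticePercolation.

Lemma block_percolates (n : nat) (R : realType) (p q K ka : R) (n0 m : nat)
    (B : finType) (main : 'I_n0 -> 'I_n) (spec : B -> 'I_n) (N D M Cm VE VS : R)
    (P : probability (config (dlattice n)) R) :
  injective main -> injective spec -> (forall i b, main i != spec b) ->
  (0 < m)%N -> N = #|B|%:R -> D = (n0 ^_ m)%:R -> M = m`!%:R ->
  Cm = 4 * 5 ^+ m * M ^+ 2 -> VE = (4 * Cm + 1) * K ->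
  VS = ((4 * Cm + 1) * ka + 2) * Cm ->
  0 < p -> 0 < q -> p^-1 <= K -> 1 <= K -> K <= 2 * n0%:R -> K <= ka * N ->
  1 <= ka -> N <= K -> VS <= N -> n0%:R ^+ m <= 2 * D -> K * VE * M <= D ->
  4 * M <= D * q * N * p -> (forall k (z : {ffun B -> int}), VS * hits R k z <= 1) ->
  (forall (x : 'rV[int]_n) (u : block n0 m B), uniq u.1 ->
     q <= pr P (route_open x (bword main u))) ->
  Pa p P -> percolates P.
Proof.
move=> mi si ms m0 NE DE ME CE VEE VSE p0 q0 pK K1 Kn0 KN ka1 NK VSN Dn KVE lam sh qpr PP.
have [paP indP _] := PP.
have ppr x i : p <= pr P (open_at x i) by apply: pr_open.
have M1 : 1 <= M by rewrite ME ler1n fact_gt0.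
have Cm0 : 0 <= Cm by rewrite CE !mulr_ge0 ?exprn_ge0// (le_trans ler01).
have VE0 : 0 < VE by rewrite VEE mulr_gt0 ?(lt_le_trans ltr01)// lerDr mulr_ge0.
have D0 : 0 < D.
  exact: (lt_le_trans (mulr_gt0 (mulr_gt0 (lt_le_trans ltr01 K1) VE0)
    (lt_le_trans ltr01 M1)) KVE).
have N0 : 0 < N.
  apply: lt_le_trans VSN; rewrite VSE.
  have Cm1 : 1 <= Cm.
    rewrite CE -mulrA mulr_ege1 ?ler1n//.
    by rewrite mulr_ege1 ?exprn_ege1 ?ler1n.
  rewrite mulr_gt0 ?(lt_le_trans ltr01)// -[leLHS]add0r lerD ?ler1n//.
  by rewrite mulr_ge0 ?(le_trans ler01)// lerDr mulr_ge0.
(* [potential k 0 0] is [VE] for every [k], so the second moment bound is uniform in the number of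
   blocks. *)
apply: (@percolates_reach_level n R P 0 VE^-1); first by rewrite invr_gt0.
move=> k.
have sb : (size (blocks n0 m B))%:R = D * N :> R by apply: size_blocks.
have h := @path_cost_sum n R p q K ka n0 m B main spec mi si ms N D M Cm VE VS
  NE DE ME CE VEE VSE p0 q0 pK K1 Kn0 KN ka1 NK VSN Dn KVE lam sh k 0 0.
have := @pr_some_path_open n R p q n0 m B main spec ms m0 P paP indP p0 ppr q0 qpr
  0 k VE VE0.
rewrite -(ltr0n R) sb mulr_gt0// => /(_ isT) h2.
apply: le_trans (h2 _) _.
  apply: (le_trans h); rewrite /potential (_ : spec_diff spec 0 0 = 0) ?eqxx//.
  by apply/eqP; rewrite -spec_eqE spec_eqxx.
have mU : measurable (\bigcup_(g in [set g | g \in bpaths n0 m B k])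
    path_open main spec 0 g).
  apply: fin_bigcup_measurable; first exact: finite_seq.
  by move=> g _; exact: measurable_path_open.
apply: le_pr => //; first exact: measurable_reach_level.
move=> w [g /= /bpathsP[sg _] wg]; apply/reach_levelP.
exists (bend main spec 0 g).
  rewrite level_bend// sg.
  have -> : level (0 : 'rV[int]_n) = 0 by rewrite /level big1// => i _; rewrite mxE.
  by rewrite add0r lez_nat leq_pmulr.
have trans x y z : reachable w x y -> reachable w y z -> reachable w x z.
  move=> [s ps <-] [t pt <-]; exists (s ++ t); last by rewrite last_cat.
  by rewrite cat_path ps.
elim: g {sg} (0 : 'rV[int]_n) wg => [|u g IH] x /=; first by move=> _; exists [::].
move=> [[[r /= rc wr] ws] wg]; apply: (trans _ _ _ _ (IH _ wg)).
apply: (trans _ (endp x r)); first exact: word_open_reachable.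
move: ws; rewrite mem_permutations in rc; rewrite /bnext -(perm_endp x rc) => ws.
by apply: (@word_open_reachable n (endp x r) [:: spec u.2]).
Qed.

(** * Choice of the parameters *)

Lemma ffact_lower_bound n k : (n ^ k * (n - k ^ 2) <= n ^_ k * n)%N.
Proof.
elim: k => [|k IH]; first by rewrite subn0.
rewrite ffactnSr mulnAC.
apply: (@leq_trans (n ^ k * (n - k ^ 2) * (n - k))); last by rewrite leq_mul2r IH orbT.
rewrite expnSr -!mulnA leq_mul2l; apply/orP; right.
have [le|lt] := leqP (k.+1 ^ 2) n; last first.
  by rewrite (_ : n - k.+1 ^ 2 = 0)%N ?muln0//; apply/eqP; rewrite subn_eq0 ltnW.
have [d ->] : exists d, n = (k.+1 ^ 2 + d)%N by exists (n - k.+1 ^ 2)%N; rewrite subnKC.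
have -> : (k.+1 ^ 2 + d - k.+1 ^ 2 = d)%N by rewrite addKn.
have -> : (k.+1 ^ 2 + d - k ^ 2 = 2 * k + 1 + d)%N by rewrite -!mulnn; nia.
have -> : (k.+1 ^ 2 + d - k = k ^ 2 + k + 1 + d)%N by rewrite -!mulnn; nia.
by rewrite -!mulnn; nia.
Qed.

Lemma ffact_half n k : (0 < n)%N -> (2 * k ^ 2 <= n)%N -> (n ^ k <= 2 * n ^_ k)%N.
Proof.
move=> n0 kn; rewrite -(leq_pmul2r n0) -mulnA.
apply: leq_trans (leq_mul (leqnn 2) (ffact_lower_bound n k)).
by rewrite mulnCA leq_mul2l; apply/orP; right; lia.
Qed.

Lemma expr_unbounded (R : realType) (x y : R) : 1 < y -> exists k, x <= y ^+ k.
Proof.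
move=> y1; have ber k : 1 + k%:R * (y - 1) <= y ^+ k.
  elim: k => [|k IH]; first by rewrite mul0r addr0.
  rewrite exprS -natr1; apply: (@le_trans _ _ (y * (1 + k%:R * (y - 1)))).
    have : 0 <= k%:R * (y - 1) ^+ 2 by rewrite mulr_ge0 ?sqr_ge0.
    lra.
  by rewrite ler_wpM2l//; lra.
have [k xk] : exists k : nat, x / (y - 1) <= k%:R.
  exists (Num.truncn (Num.max 0 (x / (y - 1)))).+1.
  apply: le_trans (ltW (truncnS_gt _)); by rewrite le_max lexx orbT.
exists k; apply: le_trans (ber k).
by move: xk; rewrite ler_pdivrMr ?subr_gt0//; lra.
Qed.

Section Threshold.
Context (R : realType).

Lemma percolates_params (n h a m N : nat) (de ep M Cm VS : R)
    (P : probability (config (dlattice n)) R) :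
  m = h.*2 -> M = m`!%:R -> Cm = 4 * 5 ^+ m * M ^+ 2 ->
  VS = ((4 * Cm + 1) * (4 / ep) + 2) * Cm -> N = (2 ^ (a + 2).*2)%N ->
  0 < de -> 0 < ep -> ep <= 2^-1 -> (1 - ep) * (1 + de) = 1 + de / 2 ->
  (1 < h)%N -> 64 / ep <= (1 + de / 2) ^+ m -> VS <= 3 ^+ a ->
  N%:R <= ep * n%:R -> ep * n%:R <= 4 * N%:R -> (4 * m ^ 2 <= n)%N ->
  (4 * Cm + 1) * M * 2 ^+ m.+1 <= n%:R -> 4 * M * (1 + de) <= n%:R ->
  Pa ((1 + de) * Num.sqrt 2 / n%:R) P -> percolates P.
Proof.
move=> mE ME CmE VSE NE de0 ep0 ep2 epde h1 hde VSa Nep epN mn Cn Mn PP.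
move: PP; set p := (1 + de) * Num.sqrt 2 / n%:R => PP.
have h0 : (0 < h)%N by apply: ltnW.
have m0 : (0 < m)%N by rewrite mE double_gt0.
have M1 : 1 <= M by rewrite ME ler1n fact_gt0.
have n1 : (0 < n)%N by apply: leq_trans mn; rewrite muln_gt0/= expn_gt0 m0.
have nR : 0 < n%:R :> R by rewrite ltr0n.
have n1R : 1 <= n%:R :> R by rewrite ler1n.
have s2 : Num.sqrt 2 ^+ 2 = 2 :> R by rewrite sqr_sqrtr.
have s20 : 0 <= Num.sqrt 2 :> R by apply: sqrtr_ge0.
have s21 : 1 <= Num.sqrt 2 :> R by rewrite -{1}(sqrtr1 R) ler_sqrt// ler1n.
have s22 : Num.sqrt 2 <= 2 :> R.
  by rewrite -[leRHS]s2 expr2 ler_peMl.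
have np : n%:R * p = (1 + de) * Num.sqrt 2 by rewrite /p mulrC divfK// gt_eqF.
have np1 : 1 <= n%:R * p by rewrite np mulr_ege1//; lra.
have p0 : 0 < p by rewrite /p divr_gt0// mulr_gt0//; lra.
have Nn : (N <= n)%N.
  by rewrite -(ler_nat R); apply: (le_trans Nep); rewrite ger_pMl//; lra.
pose n0 := (n - N)%N.
have n0E : n0%:R = n%:R - N%:R :> R by rewrite natrB.
have n0n : (1 - ep) * n%:R <= n0%:R by rewrite n0E; lra.
have n0h : n%:R <= 2 * n0%:R :> R.
  by have := ler_wpM2r (ltW nR) ep2; lra.
(* The error term of [pr_route_open] is then at most half of its main term. *)
have Mp : M * p <= 2^-1.
  rewrite /p mulrA ler_pdivrMr//.
  have : M * (1 + de) * Num.sqrt 2 <= M * (1 + de) * 2 by rewrite ler_wpM2l// mulr_ge0//; lra.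
  by rewrite mulrA; lra.
have p1 : p <= 1.
  by have := ler_wpM2r (ltW p0) M1; rewrite mul1r; lra.
(* The bound of [pr_route_open]. *)
pose q : R := (M * p ^+ m - M ^+ 2 * p ^+ m.+1) / 2 ^+ h.
have pm0 : 0 < p ^+ m by rewrite exprn_gt0.
have two0 k : 0 < 2 ^+ k :> R by rewrite exprn_gt0.
have qge : M * p ^+ m / 2 ^+ h.+1 <= q.
  rewrite (_ : M * p ^+ m / 2 ^+ h.+1 = (M * p ^+ m * 2^-1) / 2 ^+ h); last first.
    by rewrite exprS invfM mulrA.
  rewrite (_ : q = (M * p ^+ m - (M * p ^+ m) * (M * p)) / 2 ^+ h); last first.
    by rewrite /q [p ^+ m.+1]exprSr; congr (_ / _); ring.
  apply: ler_wpM2r; first by rewrite invr_ge0 ltW.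
  have : (M * p ^+ m) * (M * p) <= (M * p ^+ m) * 2^-1.
    by apply: ler_wpM2l => //; rewrite mulr_ge0 ?(ltW pm0)// (le_trans ler01).
  by lra.
have q0 : 0 < q.
  by apply: lt_le_trans qge; rewrite divr_gt0// mulr_gt0// (lt_le_trans ltr01).
pose B := {ffun 'I_(a + 2).*2 -> bool}.
have cB : #|B| = N by rewrite NE card_ffun card_bool card_ord.
pose main : 'I_n0 -> 'I_n := widen_ord (leq_subr N n).
have spec_lt (b : B) : (n0 + enum_rank b < n)%N.
  by rewrite -ltn_subRL /n0 subKn// -[X in (_ < X)%N]cB ltn_ord.
pose spec (b : B) : 'I_n := Ordinal (spec_lt b).
have mi : injective main by move=> i j /(congr1 val)/= /val_inj.
have si : injective spec.
  by move=> b b' /(congr1 val)/= /addnI /val_inj /enum_rank_inj.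
have ms i b : main i != spec b.
  by apply/eqP => /(congr1 val)/= e; have := ltn_ord i; rewrite e ltnNge leq_addr.
have D2 : n0%:R ^+ m <= 2 * (n0 ^_ m)%:R :> R.
  have n0n2 : (n <= 2 * n0)%N by rewrite -(ler_nat R) natrM.
  rewrite -natrX -natrM ler_nat ffact_half//; first by clear -n0n2 n1; lia.
  by clear -mn n0n2; lia.
have Dge : (n%:R ^+ m) / 2 ^+ m.+1 <= (n0 ^_ m)%:R :> R.
  rewrite exprS invfM mulrCA mulrC ler_pdivrMr// [leRHS]mulrC.
  apply: le_trans D2; rewrite -expr_div_n lerXn2r ?nnegrE ?divr_ge0//.
  by rewrite ler_pdivrMr// mulrC.
have Cm0 : 0 <= Cm by rewrite CmE !mulr_ge0 ?exprn_ge0// (le_trans ler01).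
have NpR : ep / 4 <= N%:R * p.
  apply: (@le_trans _ _ (ep / 4 * (n%:R * p))).
    by rewrite ler_peMr// divr_ge0// ltW.
  by rewrite mulrA; apply: ler_wpM2r; [exact: ltW|lra].
apply: (@block_percolates n R p q n%:R (4 / ep) n0 m B main spec N%:R (n0 ^_ m)%:R
  M Cm ((4 * Cm + 1) * n%:R) VS P) => //.
- by rewrite cB.
- by rewrite -[leLHS]mul1r ler_pdivrMr.
- by rewrite mulrAC ler_pdivlMr// mulrC.
- by rewrite ler_pdivlMr// mul1r; lra.
- by rewrite ler_nat.
- apply: (le_trans VSa); rewrite NE -natrX ler_nat -muln2 mulnC expnM.
  apply: (@leq_trans (4 ^ a)); last by rewrite leq_exp2l// leq_addr.
  by case: (a) => // b; rewrite leq_exp2r.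
(* [K * VE * M] is of order n^2 while [D] is of order n^m. Since [1 < h], m is at least 4, and one
   more factor n absorbs the constants. *)
- apply: le_trans Dge; rewrite ler_pdivlMr//.
  apply: (@le_trans _ _ (n%:R ^+ 2 * ((4 * Cm + 1) * M * 2 ^+ m.+1))).
    by rewrite le_eqVlt; apply/orP; left; apply/eqP; ring.
  apply: (@le_trans _ _ (n%:R ^+ 2 * n%:R)); first by rewrite ler_wpM2l ?sqr_ge0.
  by rewrite -exprSr ler_weXn2l// mE -addnn; clear -h1; lia.
- have hq : n0%:R ^+ m / 2 * (M * p ^+ m / 2 ^+ h.+1) * (ep / 4) <=
      (n0 ^_ m)%:R * q * N%:R * p.
    have X0 : 0 <= n0%:R ^+ m / 2 :> R by rewrite divr_ge0 ?exprn_ge0.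
    have Y0 : 0 <= M * p ^+ m / 2 ^+ h.+1.
      by rewrite divr_ge0 ?(ltW (two0 _))// mulr_ge0 ?(ltW pm0)// (le_trans ler01).
    have Z0 : 0 <= ep / 4 by rewrite divr_ge0// ltW.
    rewrite -[leRHS]mulrA; apply: ler_pM => //; first exact: mulr_ge0.
    by apply: ler_pM => //; rewrite ler_pdivrMr// mulrC.
  apply: le_trans hq.
  (* As m is even, the loss [2 ^+ h] of the route bound is exactly sqrt 2 ^ m and cancels the sqrt 2
     in each factor of p^m. *)
  have s2m : Num.sqrt 2 ^+ m = 2 ^+ h :> R by rewrite mE -muln2 mulnC exprM s2.
  have n0p : (1 + de / 2) ^+ m * 2 ^+ h <= n0%:R ^+ m * p ^+ m.
    rewrite -s2m -!exprMn; apply: lerXn2r; rewrite ?nnegrE.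
    - by apply: mulr_ge0 => //; lra.
    - by apply: mulr_ge0 => //; exact: ltW.
    apply: (@le_trans _ _ ((1 - ep) * n%:R * p)); last by apply: ler_wpM2r => //; exact: ltW.
    by rewrite -mulrA np mulrA epde.
  have Mep : 0 <= M * ep / 16.
    by apply: divr_ge0 => //; apply: mulr_ge0; [exact: le_trans M1|exact: ltW].
  have -> : n0%:R ^+ m / 2 * (M * p ^+ m / 2 ^+ h.+1) * (ep / 4) =
     (n0%:R ^+ m * p ^+ m / 2 ^+ h) * (M * ep / 16).
    by rewrite exprS; field; rewrite gt_eqF.
  apply: (@le_trans _ _ ((1 + de / 2) ^+ m * (M * ep / 16))); last first.
    by apply: ler_wpM2r => //; rewrite ler_pdivlMr.
  (* The losses are 2 from [D2], 2 from [qge] and 4 / ep from [NpR]; with the factor 4 required by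
     the second moment they make 64 / ep. *)
  apply: (@le_trans _ _ (64 / ep * (M * ep / 16))).
    by rewrite le_eqVlt; apply/orP; left; apply/eqP; field; rewrite gt_eqF.
  exact: ler_wpM2r.
- move=> k z; apply: (@le_trans _ _ (3 ^+ a * 3^-1 ^+ a)).
    apply: ler_pM => //; [|exact: hits_ge0|exact: hits_bound].
    rewrite VSE; apply: mulr_ge0 => //; apply: addr_ge0 => //; apply: mulr_ge0.
      by apply: addr_ge0 => //; apply: mulr_ge0.
    by apply: divr_ge0 => //; exact: ltW.
  by rewrite -exprMn divff ?expr1n.
- move=> x u uu.
  have ub : uniq (bword main u) by rewrite map_inj_uniq.
  have [paP indP _] := PP.
  have := pr_route_open paP indP p0 p1 (fun x i => pr_open (stepe x i) PP) x ub.
  have m2 : m./2 = h by rewrite mE doubleK.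
  rewrite size_bword -ME m2 natrX => hh.
  by rewrite /q ler_pdivrMr// [leRHS]mulrC.
Qed.

Lemma percolates_above (de : R) : 0 < de ->
  exists n1 : nat, forall n, (n1 <= n)%N ->
    forall P : probability (config (dlattice n)) R,
      Pa ((1 + de) * Num.sqrt 2 / n%:R) P -> percolates P.
Proof.
move=> de0.
(* The reserved proportion of coordinates; the remaining ones are still supercritical by [epde]. *)
pose ep : R := de / (2 * (1 + de)).
have de1 : 0 < 2 * (1 + de) by rewrite mulr_gt0//; lra.
have ep0 : 0 < ep by rewrite divr_gt0.
have ep2 : ep <= 2^-1 by rewrite ler_pdivrMr//; lra.
have epde : (1 - ep) * (1 + de) = 1 + de / 2.
  by rewrite /ep; field; rewrite gt_eqF//; lra.
have [h0 hh0] := @expr_unbounded R (64 / ep) (1 + de / 2) ltac:(lra).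
(* Everything up to [A] depends on [de] only. The shift by 2 gives [1 < h]. *)
pose h := h0.+2; pose m := h.*2; pose M : R := m`!%:R.
pose Cm : R := 4 * 5 ^+ m * M ^+ 2.
pose VS : R := ((4 * Cm + 1) * (4 / ep) + 2) * Cm.
have [A hA] := @expr_unbounded R VS 3 ltac:(lra).
have hm : 64 / ep <= (1 + de / 2) ^+ m.
  apply: (le_trans hh0); apply: ler_weXn2l; first lra.
  by rewrite /m /h -addnn; lia.
pose C : R := (4 ^+ A.+3 / ep) + (4 * m ^ 2)%:R + (4 * Cm + 1) * M * 2 ^+ m.+1
   + 4 * M * (1 + de).
have M0 : 0 <= M by [].
have Cm0 : 0 <= Cm.
  by apply: mulr_ge0; [apply: mulr_ge0 => //; exact: exprn_ge0|exact: exprn_ge0].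
exists (Num.truncn C).+1; move=> n n1 P PP.
have Cn : C <= n%:R.
  by apply: le_trans (ltW (truncnS_gt _)) _; rewrite ler_nat.
have t1 : 0 <= 4 ^+ A.+3 / ep by rewrite divr_ge0 ?exprn_ge0 ?ltW.
have t2 : 0 <= (4 * m ^ 2)%:R :> R by [].
have t3 : 0 <= (4 * Cm + 1) * M * 2 ^+ m.+1.
  apply: mulr_ge0; last exact: exprn_ge0.
  by apply: mulr_ge0 => //; apply: addr_ge0 => //; apply: mulr_ge0.
have t4 : 0 <= 4 * M * (1 + de) by apply: mulr_ge0; [exact: mulr_ge0|lra].
rewrite /C in Cn.
have c1 : 4 ^+ A.+3 / ep <= n%:R by lra.
have c2 : (4 * m ^ 2)%:R <= n%:R :> R by lra.
have c3 : (4 * Cm + 1) * M * 2 ^+ m.+1 <= n%:R by lra.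
have c4 : 4 * M * (1 + de) <= n%:R by lra.
have en0 : 0 <= ep * n%:R by rewrite mulr_ge0// ltW.
(* The number of special directions is the largest power of 4 not above ep n, so that bit strings of
   even length label them. *)
pose t := trunc_log 4 (Num.truncn (ep * n%:R)).
have tr : (4 ^ A.+3 <= Num.truncn (ep * n%:R))%N.
  rewrite truncn_ge_nat// natrX; move: c1; rewrite ler_pdivrMr// mulrC//.
have At : (A.+3 <= t)%N by apply: trunc_log_max.
have tlow : (4 ^ t <= Num.truncn (ep * n%:R))%N.
  by apply: trunc_logP => //; apply: leq_trans tr; rewrite expn_gt0.
have tup : (Num.truncn (ep * n%:R) < 4 ^ t.+1)%N by apply: trunc_log_ltn.
have NE : (4 ^ t = 2 ^ (t - 2 + 2).*2)%N.
  by rewrite subnK ?(leq_trans _ At)// -muln2 mulnC expnM.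
apply: (@percolates_params n h (t - 2) m (4 ^ t) de ep M Cm VS P) => //.
- apply: (le_trans hA); apply: ler_weXn2l; [lra|by clear -At; lia].
- apply: (@le_trans _ _ (Num.truncn (ep * n%:R))%:R); first by rewrite ler_nat.
  by rewrite truncn_le.
- apply: (le_trans (ltW (truncnS_gt _))).
  by rewrite -natrM ler_nat -expnS.
- by rewrite -(ler_nat R).
Qed.

End Threshold.

(** * Fair coin tosses *)

Definition bit_events : set (set (nat -> bool)) :=
  [set A | exists i, A = [set w : nat -> bool | w i]].

Definition bits := g_sigma_algebraType bit_events.

Definition bcons (b : bool) (w : bits) : bits := fun i => if i is j.+1 then w j else b.

Lemma measurable_bit i : measurable [set w : bits | w i].
Proof. by apply: sub_sigma_algebra; exists i. Qed.

Lemma measurable_to_bits d (T : measurableType d) (f : T -> bits) :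
  (forall i, measurable [set x | f x i]) -> measurable_fun setT f.
Proof.
move=> mf; apply: (@measurability _ _ T bits setT f bit_events) => //.
by move=> _ [_ [i ->] <-]; rewrite setTI; exact: mf.
Qed.

Lemma measurable_bcons b : measurable_fun setT (bcons b).
Proof.
apply: measurable_to_bits => -[|i] /=; last exact: measurable_bit.
by case: b; [rewrite (_ : [set _ | _] = setT)|rewrite (_ : [set _ | _] = set0)] => //;
  apply/seteqP; split.
Qed.

Fixpoint cylinder (u : seq bool) : set bits :=
  if u is b :: u' then [set w | w 0%N = b /\ cylinder u' (fun i => w i.+1)] else setT.

Lemma cylinder_bcons b c u : bcons b @^-1` cylinder (c :: u) =
  if b == c then cylinder u else set0.
Proof.
apply/seteqP; split=> [w [/= <- cw]|w]; first by rewrite eqxx.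
by case: eqP => [->|].
Qed.

Section BitSpace.
Context (R : realType).

(** Doubling modulo 1 on [0, 1), which shifts binary digits; fair coin tosses are the digits of a
    uniform number. *)
Definition doubling (x : R) : R := 2 * x - (if 2^-1 <= x then 1 else 0).

Definition digits (x : R) : bits := fun i => 2^-1 <= iter i doubling x.

Lemma measurable_doubling : measurable_fun setT doubling.
Proof.
apply: measurable_funB; first exact: measurable_funM.
by apply: measurable_fun_ifT => //; apply: measurable_fun_ler.
Qed.

Lemma measurable_digits : measurable_fun setT digits.
Proof.
apply: measurable_to_bits => i; rewrite /digits.
have mi : measurable_fun setT (iter i doubling).
  elim: i => [|i IH] /=; first exact: measurable_id.
  exact: measurableT_comp measurable_doubling IH.
rewrite (_ : [set _ | _] = iter i doubling @^-1` `[2^-1, +oo[%classic); last first.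
  by apply/seteqP; split=> x /=; rewrite in_itv/= andbT.
by rewrite -[X in measurable X]setTI; apply: mi.
Qed.

Fixpoint left_end (u : seq bool) : R :=
  if u is b :: u' then (b%:R + left_end u') / 2 else 0.

Lemma left_end_itv u : 0 <= left_end u /\ left_end u + 2^-1 ^+ size u <= 1.
Proof.
elim: u => [|b u [IH1 IH2]] /=; first by rewrite expr0 add0r.
have := ler0n R b; have : b%:R <= 1 :> R by case: b.
by rewrite exprS; lra.
Qed.

(** [doubling] carries the dyadic interval of [b :: u] affinely onto that of [u]. *)
Lemma digits_cylinder u : `[0, 1[%classic `&` digits @^-1` cylinder u =
  `[left_end u, left_end u + 2^-1 ^+ size u[%classic.
Proof.
elim: u => [|b u IH]; first by rewrite /= preimage_setT setIT expr0 add0r.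
have [l0 l1] := left_end_itv u.
have e0 : 0 < 2^-1 ^+ size u :> R by rewrite exprn_gt0.
apply/seteqP; split=> x /=.
  rewrite in_itv/= => -[/andP[x0 x1] [xb cx]].
  have xT : (`[0, 1[%classic `&` digits @^-1` cylinder u) (doubling x).
    split; last first.
      move: cx; rewrite /=; congr (cylinder u _); apply/funext => i.
      by rewrite /digits iterSr.
    by rewrite /= in_itv/= /doubling; case: ifP => h; apply/andP; split; lra.
  move: xT; rewrite IH /= !in_itv/= exprS /doubling => /andP[].
  by rewrite -xb /digits/=; case: ifP => h; rewrite /= => h1 h2; apply/andP; split; lra.
rewrite in_itv/= exprS => /andP[h1 h2].
have xb : (2^-1 <= x) = b.
  by case: b h1 h2 => /= h1 h2; [|apply/negbTE; rewrite -ltNge]; lra.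
have : (`[0, 1[%classic `&` digits @^-1` cylinder u) (doubling x).
  rewrite IH /= in_itv/= /doubling xb.
  by case: (b) h1 h2 => /= h1 h2; apply/andP; split; lra.
move=> [_ cx]; split.
  rewrite in_itv/=; have := ler0n R b; have : b%:R <= 1 :> R by case: (b).
  by move=> b1 b0; apply/andP; split; lra.
split; first exact: xb.
move: cx => /=; congr (cylinder u _); apply/funext => i.
by rewrite /digits iterSr.
Qed.

Definition unit_itv_measurable : measurable (`[0, 1[%classic : set R) := measurable_itv _.

Definition unit_measure := mrestr (@lebesgue_measure R) unit_itv_measurable.

HB.instance Definition _ := Measure.on unit_measure.

Let unit_measureT : unit_measure setT = 1%E.
Proof.
rewrite /unit_measure /mrestr setTI lebesgue_measure_itv/= lte_fin ltr01.
by rewrite sube0.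
Qed.

HB.instance Definition _ := Measure_isProbability.Build _ _ _ unit_measure unit_measureT.

Definition digitsR : measurableTypeR R -> bits := digits.

HB.instance Definition _ := @isMeasurableFun.Build _ _ (measurableTypeR R) bits
  digitsR measurable_digits.

Definition coin : probability bits R := distribution unit_measure digitsR.

Lemma coin_cylinder u : coin (cylinder u) = (2^-1 ^+ size u)%:E.
Proof.
rewrite /coin /distribution /pushforward/= /unit_measure /mrestr.
rewrite setIC digits_cylinder lebesgue_measure_itv/= lte_fin ltrDl exprn_gt0//.
by rewrite -EFinB addrAC subrr add0r.
Qed.

End BitSpace.

Section CoinTheory.
Context (R : realType).
Local Notation pr := (pr (coin R)).
Implicit Types (A B C : set bits) (w : bits).

Definition btail w : bits := fun i => w i.+1.

Lemma measurable_btail : measurable_fun setT btail.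
Proof. by apply: measurable_to_bits => i; exact: measurable_bit. Qed.

Lemma measurable_preimage_bits (f : bits -> bits) A : measurable_fun setT f ->
  measurable A -> measurable (f @^-1` A).
Proof. by move=> mf mA; rewrite -[X in measurable X]setTI; exact: mf. Qed.

Lemma measurable_bcons_preimage b A : measurable A -> measurable (bcons b @^-1` A).
Proof. by apply: measurable_preimage_bits; exact: measurable_bcons. Qed.

Lemma measurable_bit_eq i b : measurable [set w : bits | w i = b].
Proof.
case: b; first exact: measurable_bit.
rewrite (_ : [set _ | _] = ~` [set w : bits | w i]).
  by apply: measurableC; exact: measurable_bit.
by apply/seteqP; split=> w /=; case: (w i).
Qed.

Lemma measurable_cylinder u : measurable (cylinder u).
Proof.
elim: u => [|b u IH] /=; first exact: measurableT.
apply: (@measurableI _ _ [set w : bits | w 0%N = b] (btail @^-1` cylinder u)).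
  exact: measurable_bit_eq.
exact: measurable_preimage_bits measurable_btail IH.
Qed.

Lemma cylinder_nth u w : cylinder u w -> forall i, (i < size u)%N -> w i = nth false u i.
Proof. by elim: u w => //= b u IH w [w0 wu] [|i]//= /(IH _ wu). Qed.

Lemma cylinder_mkseq N w : cylinder (mkseq w N) w.
Proof.
elim: N w => // N IH w; rewrite /mkseq /= -[1%N]/(1 + 0)%N iotaDl -map_comp.
by split=> //; exact: (IH (btail w)).
Qed.

Lemma cylinderI u v : [\/ cylinder u `&` cylinder v = set0,
  cylinder u `&` cylinder v = cylinder u | cylinder u `&` cylinder v = cylinder v].
Proof.
elim: u v => [|b u IH] [|c v] /=; rewrite ?setTI ?setIT.
- exact: Or32.
- exact: Or33.
- exact: Or32.
have [<-|bc] := eqVneq b c; last first.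
  apply: Or31; apply/seteqP; split=> // w [[/= -> _] [cb _]].
  by move: bc; rewrite cb eqxx.
case: (IH v) => e; [apply: Or31|apply: Or32|apply: Or33]; apply/seteqP; split=> w //=.
- move=> [[_ wu] [_ wv]].
  by have : (cylinder u `&` cylinder v) (btail w) by []; rewrite e.
- by move=> [].
- move=> [w0 wu]; have : (cylinder u `&` cylinder v) (btail w) by rewrite e.
  by move=> [].
- by move=> [].
- move=> [w0 wv]; have : (cylinder u `&` cylinder v) (btail w) by rewrite e.
  by move=> [].
Qed.

(** The generating pi-system for uniqueness of measures; [set0] is the intersection of incompatible
    cylinders. *)
Let G : set (set bits) := [set A | A = set0 \/ exists u, A = cylinder u].

Let measurable_G : @measurable _ bits = <<s G >>.
Proof.
apply/seteqP; split.
  apply: smallest_sub; first exact: smallest_sigma_algebra.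
  move=> _ [i ->]; rewrite (_ : [set _ | _] =
    \bigcup_u (if nth false u i then cylinder u else set0)).
    apply: (@countable_bigcupT_measurable _ (g_sigma_algebraType G)) => // u.
    by apply: sub_sigma_algebra; case: ifP => _; [right; exists u|left].
  apply/seteqP; split=> w /=.
    move=> wi; exists (mkseq w i.+1) => //; rewrite nth_mkseq// wi.
    exact: cylinder_mkseq.
  move=> [u _]; case: ifP => // ui wu; rewrite (cylinder_nth wu) ?ui//.
  by rewrite ltnNge; apply/negP => /(nth_default false); rewrite ui.
apply: smallest_sub; first exact: sigma_algebra_measurable.
by move=> _ [->|[u ->]]; [exact: measurable0|exact: measurable_cylinder].
Qed.

Let setI_closed_G : setI_closed G.
Proof.
move=> _ _ [->|[u ->]] [->|[v ->]]; rewrite ?setI0 ?set0I; try by left.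
by case: (cylinderI u v) => ->; [left|right; exists u|right; exists v].
Qed.

HB.instance Definition _ b := @isMeasurableFun.Build _ _ bits bits (bcons b)
  (measurable_bcons b).

(* The law of fair coin tosses is invariant under tossing one more coin first. *)
Lemma coin_bcons A : measurable A ->
  2 * pr A = pr (bcons false @^-1` A) + pr (bcons true @^-1` A).
Proof.
move=> mA.
pose m1 := measure_add (coin R) (coin R).
pose m2 := measure_add (distribution (coin R) (bcons false))
   (distribution (coin R) (bcons true)).
have e1 B : m1 B = (coin R B + coin R B)%E by exact: measure_addE.
have e2 B : m2 B = (coin R (bcons false @^-1` B) + coin R (bcons true @^-1` B))%E.
  exact: measure_addE.
have e : m1 A = m2 A.
  apply: (@measure_unique _ _ _ G (fun=> setT)) => //.
  - by move=> _; right; exists [::].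
  - by apply/seteqP; split=> // w _; exists 0%N.
  - move=> C GC; apply: (etrans (e1 C)); apply: etrans (esym (e2 C)).
    case: GC => [->|[u ->]]; first by rewrite !preimage_set0 !measure0.
    rewrite [LHS](_ : _ = (2 * 2^-1 ^+ size u)%:E); last first.
      by rewrite coin_cylinder -EFinD; congr EFin; ring.
    case: u => [|c u].
      rewrite !preimage_setT probability_setT -EFinD.
      by congr EFin; rewrite expr0; ring.
    rewrite !cylinder_bcons [size _]/= exprS mulrA divff// mul1r.
    by case: c; rewrite !eqxx (_ : _ == _ = false)// measure0 ?adde0 ?add0e coin_cylinder.
  - move=> k; apply: (@le_lt_trans _ _ (coin R setT + coin R setT)%E).
      by rewrite -[leRHS]e1.
    by rewrite probability_setT -EFinD ltry.
apply: EFin_inj; rewrite mulr_natl mulr2n !EFinD !prE//.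
- exact: etrans (esym (e1 A)) (etrans e (e2 A)).
- exact: measurable_bcons_preimage.
- exact: measurable_bcons_preimage.
Qed.

End CoinTheory.

(** * Harris inequality and independence for coin tosses *)

Section BitEvents.
Context (R : realType).
Local Notation pr := (pr (coin R)).
Implicit Types (A B C : set bits) (w : bits) (J : set nat).

Definition depends_on J A := forall w w' : bits, (forall i, J i -> w i = w' i) -> A w -> A w'.

Definition bits_increasing A := forall w w' : bits, (forall i, w i ==> w' i) -> A w -> A w'.

Lemma depends_onS J1 J2 A : J1 `<=` J2 -> depends_on J1 A -> depends_on J2 A.
Proof. by move=> J12 dA w w' e; apply: dA => i /J12; exact: e. Qed.

Lemma depends_onU J A B : depends_on J A -> depends_on J B -> depends_on J (A `|` B).
Proof. by move=> dA dB w w' e [/(dA _ _ e)|/(dB _ _ e)]; [left|right]. Qed.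

Lemma depends_onC J A : depends_on J A -> depends_on J (~` A).
Proof. by move=> dA w w' e nA /(dA w' w (fun i Ji => esym (e i Ji))). Qed.

Lemma depends_on_bcons J A b : depends_on J A ->
  depends_on [set i | J i.+1] (bcons b @^-1` A).
Proof. by move=> dA w w' e; apply: dA => -[|i]//= Ji; exact: e. Qed.

Lemma bits_increasing_bcons A b : bits_increasing A -> bits_increasing (bcons b @^-1` A).
Proof. by move=> iA w w' e; apply: iA => -[|i]//=; exact: implybb. Qed.

Lemma depends_on_nothing C : depends_on set0 C -> C = set0 \/ C = setT.
Proof.
move=> dC; have [->|/set0P[w Cw]] := eqVneq C set0; [by left|right].
by apply/seteqP; split=> // w' _; apply: dC Cw.
Qed.

Definition symdiff_pr A C := pr (A `\` C) + pr (C `\` A).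

Definition approximable A := forall e : R, 0 < e ->
  exists C N, [/\ measurable C, depends_on [set i | (i < N)%N] C & symdiff_pr A C < e].

Lemma symdiff_pr_trans A B C : measurable A -> measurable B -> measurable C ->
  symdiff_pr A C <= symdiff_pr A B + symdiff_pr B C.
Proof.
move=> mA mB mC.
have h X Y Z : measurable X -> measurable Y -> measurable Z ->
    pr (X `\` Z) <= pr (X `\` Y) + pr (Y `\` Z).
  move=> mX mY mZ; rewrite (@prID _ _ _ _ (X `\` Z) Y)//; last exact: measurableD.
  rewrite addrC; apply: lerD; apply: le_pr; do ?[exact: measurableD|
    apply: measurableD => //; exact: measurableD|apply: measurableI => //; exact: measurableD].
  - by move=> w [[]].
  - by move=> w [[]].
have := h A B C mA mB mC; have := h C B A mC mB mA; rewrite /symdiff_pr; lra.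
Qed.

Lemma approximable0 : approximable set0.
Proof.
move=> e e0; exists set0, 0%N; split=> //.
by rewrite /symdiff_pr setDv pr0 addr0.
Qed.

Lemma approximableC A : approximable A -> approximable (~` A).
Proof.
move=> hA e /hA[C [N [mC dC AC]]]; exists (~` C), N; split.
- exact: measurableC.
- exact: depends_onC.
- by rewrite /symdiff_pr !setDE !setCK (setIC _ C) (setIC _ A) addrC -!setDE.
Qed.

Lemma approximableU A B : measurable A -> measurable B ->
  approximable A -> approximable B -> approximable (A `|` B).
Proof.
move=> mA mB hA hB e e0; have e2 : 0 < e / 2 by rewrite divr_gt0.
have [C [N [mC dC AC]]] := hA _ e2; have [D [M [mD dD BD]]] := hB _ e2.
exists (C `|` D), (maxn N M); split.
- exact: measurableU.
- apply: depends_onU; [apply: depends_onS dC|apply: depends_onS dD] => i /= h.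
  + by rewrite leq_max h.
  + by rewrite leq_max h orbT.
have h X Y Z W : measurable X -> measurable Y -> measurable Z -> measurable W ->
    pr ((X `|` Y) `\` (Z `|` W)) <= pr (X `\` Z) + pr (Y `\` W).
  move=> mX mY mZ mW.
  apply: (@le_trans _ _ (pr ((X `\` Z) `|` (Y `\` W)))).
    apply: le_pr; first by apply: measurableD; exact: measurableU.
      by apply: measurableU; exact: measurableD.
    by move=> w [[Xw|Yw] /not_orP[nZ nW]]; [left|right].
  rewrite -lee_fin EFinD !prE//; [|exact: measurableD..|]; last first.
    by apply: measurableU; exact: measurableD.
  by apply: measureU2; exact: measurableD.
have := h A B C D mA mB mC mD; have := h C D A B mC mD mA mB.
by rewrite /symdiff_pr in AC BD *; lra.
Qed.

Lemma approximable_bigcup (F : nat -> set bits) :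
  (forall k, measurable (F k)) -> (forall k, approximable (F k)) ->
  approximable (\bigcup_k F k).
Proof.
move=> mF hF; set U := \bigcup_k F k.
pose Un m := \big[setU/set0]_(i < m) F i.
have mUn m : measurable (Un m) by exact: bigsetU_measurable.
have mU : measurable U by exact: bigcupT_measurable.
have hUn m : approximable (Un m).
  elim: m => [|m IH]; first by rewrite /Un big_ord0; exact: approximable0.
  by rewrite /Un big_ord_recr/=; exact: (approximableU (mUn m) (mF m) IH (hF m)).
have UnU m : Un m `<=` U.
  by rewrite /Un -bigcup_mkord => w [i _ Fi]; exists i.
move=> e e0; have e2 : 0 < e / 2 by rewrite divr_gt0.
(* Continuity from below reduces the countable union to a finite one. *)
have [m hm] : exists m, pr U - e / 2 < pr (Un m).
  apply: contrapT => /forallNP hn.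
  have : (coin R U <= (pr U - e / 2)%:E)%E.
    have cv : coin R \o (fun k => Un k.+1) @ \oo --> coin R (\bigcup_k Un k.+1).
      apply: nondecreasing_cvg_mu => //; first exact: bigcupT_measurable.
      by move=> m1 m2 m12; apply/subsetPset; apply: subset_bigsetU.
    have eU : \bigcup_k Un k.+1 = U by exact: bigcup_bigsetU_bigcup.
    rewrite eU in cv.
    rewrite -(cvg_lim _ cv)//; apply: lime_le; first by apply/cvg_ex; exists (coin R U).
    apply: nearW => k; apply: (@le_trans _ _ (pr (Un k.+1))%:E); first by rewrite prE.
    by rewrite lee_fin leNgt; apply/negP; exact: hn.
  by rewrite -(prE (coin R) mU) lee_fin; lra.
have [C [N [mC dC UC]]] := hUn m _ e2; exists C, N; split=> //.
apply: le_lt_trans (symdiff_pr_trans mU (mUn m) mC) _.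
have -> : symdiff_pr U (Un m) = pr U - pr (Un m).
  rewrite /symdiff_pr [X in _ + pr X](_ : _ = set0); last by rewrite setD_eq0.
  by rewrite pr0 addr0 (prID (coin R) mU (mUn m)) setIidr//; ring.
lra.
Qed.

Lemma measurable_approximable A : measurable A -> approximable A.
Proof.
pose M := [set A | measurable A /\ approximable A].
suff : <<s bit_events >> `<=` M by move=> h /h[].
apply: smallest_sub.
  split.
  - by split; [exact: measurable0|exact: approximable0].
  - by move=> B [mB hB]; rewrite setTD; split; [exact: measurableC|exact: approximableC].
  - move=> F hF; split; first by apply: bigcupT_measurable => k; case: (hF k).
    by apply: approximable_bigcup => k; case: (hF k).
move=> _ [i ->]; split; first exact: measurable_bit.
move=> e e0; exists [set w : bits | w i], i.+1; split.
- exact: measurable_bit.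
- by move=> w w' /(_ i (leqnn _))/= ->.
- by rewrite /symdiff_pr setDv pr0 addr0.
Qed.

Lemma symdiff_pr_bcons A C : measurable A -> measurable C -> 2 * symdiff_pr A C =
  symdiff_pr (bcons false @^-1` A) (bcons false @^-1` C) +
  symdiff_pr (bcons true @^-1` A) (bcons true @^-1` C).
Proof.
move=> mA mC; rewrite mulrDr !coin_bcons; [|exact: measurableD..].
by rewrite /symdiff_pr; ring.
Qed.

Lemma pr_setI_bounds A B : measurable A -> measurable B ->
  [/\ 0 <= pr (A `&` B), pr (A `&` B) <= pr A, pr (A `&` B) <= pr B &
      pr A + pr B - 1 <= pr (A `&` B)].
Proof.
move=> mA mB; have mAB := measurableI _ _ mA mB.
split; first exact: pr_ge0.
- by apply: le_pr => // w [].
- by apply: le_pr => // w [].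
have := prID (coin R) mA mB; have : pr (A `\` B) <= pr (~` B).
  apply: le_pr; [exact: measurableD|exact: measurableC|by move=> w []].
have := prID (coin R) (@measurableT _ bits) mB; rewrite setTI setTD prT; lra.
Qed.

(** Base case of both inductions below: an event close to a trivial one has probability close to 0
    or 1, hence small covariance with any event. *)
Lemma pr_setI_trivial A B C : measurable A -> measurable B -> C = set0 \/ C = setT ->
  `|pr (A `&` B) - pr A * pr B| <= symdiff_pr A C.
Proof.
move=> mA mB C0T; have [i0 iA iB iAB] := pr_setI_bounds mA mB.
have a0 : 0 <= pr A by exact: pr_ge0.
have b0 : 0 <= pr B by exact: pr_ge0.
have a1 : pr A <= 1 by exact: pr_le1.
have b1 : pr B <= 1 by exact: pr_le1.
rewrite /symdiff_pr ler_norml; case: C0T => ->.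
  by rewrite setD0 set0D pr0 addr0; apply/andP; split; nra.
have := prID (coin R) (@measurableT _ bits) mA; rewrite setTI setTD prT setDT pr0 => e.
by apply/andP; split; nra.
Qed.

Lemma pr_bcons_le A : measurable A -> bits_increasing A ->
  pr (bcons false @^-1` A) <= pr (bcons true @^-1` A).
Proof.
move=> mA iA; apply: le_pr; [exact: measurable_bcons_preimage..|].
by move=> w; apply: iA => -[|i]//=; exact: implybb.
Qed.

(* Induction on N by conditioning on the first bit: the conditional probabilities of
   increasing events are both nondecreasing in it, so Chebyshev's sum inequality
   applies. The error term survives the limit in N because any measurable event is
   approximable by events on finitely many bits. *)
Lemma coin_harris_approx N A B C : measurable A -> measurable B -> measurable C ->
  bits_increasing A -> bits_increasing B -> depends_on [set i | (i < N)%N] C ->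
  pr A * pr B - symdiff_pr A C <= pr (A `&` B).
Proof.
elim: N A B C => [|N IH] A B C mA mB mC iA iB dC.
  have /depends_on_nothing C0T : depends_on set0 C by apply: depends_onS dC.
  by have := pr_setI_trivial mA mB C0T; rewrite ler_norml => /andP[]; lra.
have step b := IH _ _ _ (measurable_bcons_preimage b mA) (measurable_bcons_preimage b mB)
  (measurable_bcons_preimage b mC) (@bits_increasing_bcons _ b iA)
  (@bits_increasing_bcons _ b iB) (@depends_on_bcons _ _ b dC).
have := coin_bcons R (measurableI _ _ mA mB); rewrite !preimage_setI.
have := step false; have := step true.
have := coin_bcons R mA; have := coin_bcons R mB; have := symdiff_pr_bcons mA mC.
have := pr_bcons_le mA iA; have := pr_bcons_le mB iB.
move: (pr A) (pr B) (pr (A `&` B)) (symdiff_pr A C) => a b ab d.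
move: (symdiff_pr _ _) (symdiff_pr _ _) => d0 d1.
move: (pr (bcons false @^-1` A `&` _)) (pr (bcons true @^-1` A `&` _)) => ab0 ab1.
move: (pr (bcons false @^-1` A)) (pr (bcons true @^-1` A)) (pr (bcons false @^-1` B)) (pr (bcons true @^-1` B)) => a0 a1 b0 b1
  b01 a01 dE bE aE h1 h0 abE.
have -> : a = (a0 + a1) / 2 by lra.
have -> : b = (b0 + b1) / 2 by lra.
have := mulr_ge0 (_ : 0 <= a1 - a0) (_ : 0 <= b1 - b0); rewrite !subr_ge0 => /(_ a01 b01).
nra.
Qed.

(** The first bit lies in [J] or not, so one of the two events does not depend on it and has equal
    conditional probabilities; the covariance is then the mean of the two conditional ones. *)
Lemma coin_indep_approx N J A B C : measurable A -> measurable B -> measurable C ->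
  depends_on J A -> depends_on (~` J) B -> depends_on [set i | (i < N)%N] C ->
  `|pr (A `&` B) - pr A * pr B| <= symdiff_pr A C.
Proof.
elim: N J A B C => [|N IH] J A B C mA mB mC dA dB dC.
  have /depends_on_nothing C0T : depends_on set0 C by apply: depends_onS dC.
  exact: pr_setI_trivial.
have step b := IH _ _ _ _ (measurable_bcons_preimage b mA) (measurable_bcons_preimage b mB)
  (measurable_bcons_preimage b mC) (@depends_on_bcons _ _ b dA)
  (@depends_on_bcons _ _ b dB) (@depends_on_bcons _ _ b dC).
have := coin_bcons R (measurableI _ _ mA mB); rewrite !preimage_setI.
have := step false; have := step true.
have := coin_bcons R mA; have := coin_bcons R mB; have := symdiff_pr_bcons mA mC.
have same (D : set bits) (K : set nat) : depends_on K D -> ~ K 0%N ->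
    bcons false @^-1` D = bcons true @^-1` D.
  by move=> dD nK; apply/seteqP; split=> w; apply: dD => -[|i].
have : pr (bcons false @^-1` A) = pr (bcons true @^-1` A) \/
       pr (bcons false @^-1` B) = pr (bcons true @^-1` B).
  have [J0|J0] := pselect (J 0%N); last by left; rewrite (same _ _ dA J0).
  by right; rewrite (same _ _ dB)// => /(_ J0).
move: (pr A) (pr B) (pr (A `&` B)) (symdiff_pr A C) => a b ab d.
move: (symdiff_pr _ _) (symdiff_pr _ _) => d0 d1.
move: (pr (bcons false @^-1` A `&` _)) (pr (bcons true @^-1` A `&` _)) => ab0 ab1.
move: (pr (bcons false @^-1` A)) (pr (bcons true @^-1` A)) (pr (bcons false @^-1` B)) (pr (bcons true @^-1` B)) => a0 a1 b0 b1
  eq dE bE aE.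
rewrite !ler_norml => /andP[h1 h1'] /andP[h0 h0'] abE.
have -> : a = (a0 + a1) / 2 by lra.
have -> : b = (b0 + b1) / 2 by lra.
by case: eq => eq; rewrite eq in h0 h0' *; apply/andP; split; nra.
Qed.

Lemma coin_harris A B : measurable A -> measurable B ->
  bits_increasing A -> bits_increasing B -> pr A * pr B <= pr (A `&` B).
Proof.
move=> mA mB iA iB; apply/ler_addgt0Pr => e /(measurable_approximable mA)[C [N [mC dC AC]]].
by have := coin_harris_approx mA mB mC iA iB dC; lra.
Qed.

Lemma coin_indep J A B : measurable A -> measurable B ->
  depends_on J A -> depends_on (~` J) B -> pr (A `&` B) = pr A * pr B.
Proof.
move=> mA mB dA dB; apply/eqP; rewrite -subr_eq0 -normr_le0.
apply/ler_addgt0Pr => e /(measurable_approximable mA)[C [N [mC dC AC]]].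
by have := coin_indep_approx mA mB mC dA dB dC; lra.
Qed.

End BitEvents.

(** * A model that does not percolate *)

(** An increasing function of fair bits with a prescribed dyadic probability: a disjunction with a
    fresh bit maps x to (1 + x) / 2, a conjunction maps it to x / 2. *)
Fixpoint threshold (bs : seq bool) (w : bits) : bool :=
  if bs is b :: bs' then
    if b then w 0%N || threshold bs' (btail w) else w 0%N && threshold bs' (btail w)
  else false.

Fixpoint dyadic (R : realType) (bs : seq bool) : R :=
  if bs is b :: bs' then (b%:R + dyadic R bs') / 2 else 0.

Lemma threshold_le bs (w w' : bits) : (forall i, w i ==> w' i) ->
  threshold bs w ==> threshold bs w'.
Proof.
elim: bs w w' => //= b bs IH w w' ww'.
have := IH (btail w) (btail w') (fun i => ww' i.+1); have := ww' 0%N.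
by case: b; case: (w 0%N); case: (w' 0%N) => //=; case: (threshold _ _).
Qed.

Lemma measurable_threshold bs : measurable [set w | threshold bs w].
Proof.
elim: bs => [|b bs IH] /=; first by rewrite (_ : [set _ | _] = set0) ?measurable0//; apply/seteqP; split.
have mt : measurable (btail @^-1` [set w | threshold bs w]).
  exact: measurable_preimage_bits measurable_btail IH.
case: b.
  rewrite (_ : [set _ | _] = [set w : bits | w 0%N] `|` btail @^-1` [set w | threshold bs w]).
    exact: (measurableU _ _ (measurable_bit 0) mt).
  by apply/seteqP; split=> w /=; [move/orP|move=> ?; exact/orP].
rewrite (_ : [set _ | _] = [set w : bits | w 0%N] `&` btail @^-1` [set w | threshold bs w]).
  exact: (measurableI _ _ (measurable_bit 0) mt).
by apply/seteqP; split=> w /=; [move/andP|move=> ?; exact/andP].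
Qed.

Lemma measurable_reindex (g : nat -> nat) : measurable_fun setT (fun w : bits => w \o g : bits).
Proof. by apply: measurable_to_bits => i; exact: measurable_bit. Qed.

Lemma measurable_threshold_reindex bs g : measurable [set w : bits | threshold bs (w \o g)].
Proof. exact: measurable_preimage_bits (measurable_reindex g) (measurable_threshold bs). Qed.

Lemma depends_on_threshold bs g : depends_on (range g) [set w : bits | threshold bs (w \o g)].
Proof.
move=> w w' e; rewrite /= (_ : w' \o g = w \o g)//.
by apply/funext => i; rewrite /= e//; exists i.
Qed.

Section Threshold.
Context (R : realType).
Local Notation pr := (pr (coin R)).

Lemma dyadic_bounds bs : 0 <= dyadic R bs <= 1.
Proof.
elim: bs => [|b bs /andP[h0 h1]] /=; first by rewrite lexx ler01.
by apply/andP; split; case: b; rewrite /=; lra.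
Qed.

Lemma dyadic_near h (s : R) : 0 <= s <= 1 ->
  exists2 bs, size bs = h & dyadic R bs <= s <= dyadic R bs + 2^-1 ^+ h.
Proof.
elim: h s => [|h IH] s /andP[s0 s1].
  by exists [::]; rewrite //= add0r expr0 s0.
pose b := 2^-1 <= s.
have /IH[bs sb /andP[h1 h2]] : 0 <= 2 * s - b%:R <= 1.
  by rewrite /b; case: (leP 2^-1 s) => h' /=; apply/andP; split; lra.
exists (b :: bs); rewrite /= ?sb// exprS; apply/andP; split; lra.
Qed.

Lemma pr_bit i : pr [set w : bits | w i] = 2^-1.
Proof.
elim: i => [|i IH]; first have := coin_bcons R (measurable_bit 0).
  have -> : bcons false @^-1` [set w : bits | w 0%N] = set0 by apply/seteqP; split.
  have -> : bcons true @^-1` [set w : bits | w 0%N] = setT by apply/seteqP; split.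
  by rewrite prT pr0; lra.
have e b : bcons b @^-1` [set w : bits | w i.+1] = [set w : bits | w i] by [].
by have := coin_bcons R (measurable_bit i.+1); rewrite !e IH; lra.
Qed.

Lemma pr_threshold bs g : injective g ->
  pr [set w : bits | threshold bs (w \o g)] = dyadic R bs.
Proof.
elim: bs g => [|b bs IH] g g_inj /=.
  by rewrite (_ : [set _ | _] = set0) ?pr0//; apply/seteqP; split.
pose T := [set w : bits | threshold bs (w \o (g \o S))].
have T0 : pr T = dyadic R bs by apply: IH => i j /g_inj[].
have mT : measurable T by exact: measurable_threshold_reindex.
pose Z := [set w : bits | w (g 0%N)].
have mZ : measurable Z by exact: measurable_bit.
have ind : pr (Z `&` T) = pr Z * pr T.
  apply: (@coin_indep _ [set g 0%N]) => //.
    by move=> w w' /(_ _ erefl) e; rewrite /Z /= e.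
  apply: depends_onS (@depends_on_threshold bs (g \o S)).
  by move=> _ [j _ <-] /= /g_inj.
have Z0 : pr Z = 2^-1 by exact: pr_bit.
case: b => /=; last first.
  rewrite (_ : [set _ | _] = Z `&` T) ?ind ?Z0 ?T0; first by ring.
  by apply/seteqP; split=> w /=; [move/andP|move=> ?; exact/andP].
have -> : [set w : bits | (w \o g) 0%N || threshold bs (btail (w \o g))] = Z `|` T.
  by apply/seteqP; split=> w /=; [move/orP|move=> ?; exact/orP].
have := prID (coin R) (measurableU _ _ mZ mT) mZ.
rewrite (_ : (Z `|` T) `&` Z = Z); last by apply/setIidPr => w; left.
rewrite setDUl setDv set0U.
have := prID (coin R) mT mZ; rewrite (setIC T) ind Z0 T0; lra.
Qed.

End Threshold.

(** The events determined by the statuses in [F] form a sigma-algebra containing the generators. *)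
Lemma status_determined (G : digraph) (F : set (edge G)) (A : set (config G)) :
  <<s status_events F >> A ->
  forall w w' : config G, (forall e, F e -> w e = w' e) -> A w -> A w'.
Proof.
pose M := [set A : set (config G) |
  forall w w' : config G, (forall e, F e -> w e = w' e) -> A w -> A w'].
suff : <<s status_events F >> `<=` M by move=> h /h.
apply: smallest_sub.
  split=> [//|B hB|B hB].
    by move=> w w' ww' [_ nB]; split=> // /(hB w' w (fun e Fe => esym (ww' e Fe))).
  by move=> w w' ww' [k _ Bk]; exists k => //; apply: hB Bk.
by move=> _ [e Fe [Y _ <-]] w w' ww' [_ /= Ye]; split=> //=; rewrite -ww'.
Qed.

Section SiteModel.
Context (n : nat) (bs : seq bool).
Local Notation V := (vertex (dlattice n)).
Implicit Types (x y z : V) (e f : edge (dlattice n)) (k : V * bool).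

(* Every vertex of even level carries two independent bits, one shared by its
   outgoing edges and one shared by its incoming edges; these two groups of edges
   partition the edge set. *)
Definition even_end e : V * bool :=
  if odd `|level (val e).1| then ((val e).2, false) else ((val e).1, true).

(** Splits one sequence of tosses into disjoint infinite streams, one for each pair of a vertex and
    a side. *)
Definition site_bits k (t : nat) : nat := pickle (k, t).

Definition site_open k : set bits := [set w : bits | threshold bs (w \o site_bits k)].

Definition site_config (w : bits) : config (dlattice n) :=
  fun e => threshold bs (w \o site_bits (even_end e)).

Lemma site_bits_inj k : injective (site_bits k).
Proof. by move=> s t /(pcan_inj pickleK)[]. Qed.

Lemma measurable_site_config : measurable_fun setT site_config.
Proof.
apply: (@measurability _ _ bits (config (dlattice n)) setT site_config
  (status_events setT)) => //.
move=> _ [_ [e _ [Y _ <-]] <-]; rewrite !setTI.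
pose b w := threshold bs (w \o site_bits (even_end e)).
have mb : measurable_fun setT (b : bits -> bool).
  by apply: (measurable_fun_bool true); rewrite setTI; exact: measurable_threshold_reindex.
by rewrite -[X in measurable X]setTI; exact: (mb measurableT Y).
Qed.

HB.instance Definition _ := @isMeasurableFun.Build _ _ bits (config (dlattice n))
  site_config measurable_site_config.

Context (R : realType).

Definition site_model : probability (config (dlattice n)) R :=
  distribution (coin R) site_config.

Lemma pr_site_model A : pr site_model A = pr (coin R) (site_config @^-1` A).
Proof. by []. Qed.

Lemma measurable_site_preimage (A : set (config (dlattice n))) :
  measurable A -> measurable (site_config @^-1` A).
Proof. by move=> mA; rewrite -[X in measurable X]setTI; exact: measurable_site_config. Qed.

Lemma pr_site_open k : pr (coin R) (site_open k) = dyadic R bs.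
Proof. by rewrite pr_threshold//; exact: site_bits_inj. Qed.

Lemma measurable_site_open k : measurable (site_open k).
Proof. exact: measurable_threshold_reindex. Qed.

Lemma site_model_associated : positively_associated site_model.
Proof.
move=> A B mA mB iA iB; rewrite -!prE//; last exact: measurableI.
rewrite -EFinM lee_fin !pr_site_model preimage_setI.
have inc C : increasing_event C -> bits_increasing (site_config @^-1` C).
  by move=> iC w w' ww'; apply: iC => e; apply: threshold_le => i; exact: ww'.
by apply: coin_harris; [exact: measurable_site_preimage..|exact: inc|exact: inc].
Qed.

Lemma even_end_endpoint e : endpoints e (even_end e).1.
Proof. by rewrite /even_end; case: ifP => _; [right|left]. Qed.

Lemma edges_dist_share (F1 F2 : set (edge (dlattice n))) e f x : F1 e -> F2 f ->
  endpoints e x -> endpoints f x -> (edges_dist R F1 F2 <= 0)%E.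
Proof.
move=> F1e F2f ex fx; apply: (@le_trans _ _ (edge_dist R e f)).
  by apply: ereal_inf_lbound; exists e => //; exists f.
apply: (@le_trans _ _ (vertex_dist R x x)).
  by apply: ereal_inf_lbound; exists x => //; exists x.
by apply: ereal_inf_lbound; exists [::].
Qed.

Lemma site_model_independent : independent_at 1 site_model.
Proof.
move=> F1 F2 _ F12 A B sA sB.
have mA := status_measurable sA; have mB := status_measurable sB.
rewrite -!prE//; last exact: measurableI.
rewrite -EFinM !pr_site_model preimage_setI; congr EFin.
pose J F := [set i | exists2 e, F e & range (site_bits (even_end e)) i].
have dep F C : <<s status_events F >> C -> depends_on (J F) (site_config @^-1` C).
  move=> sC w w' ww'; apply: (status_determined sC) => e Fe.
  rewrite /site_config; congr threshold; apply/funext => t /=.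
  by apply: ww'; exists e => //; exists t.
apply: (@coin_indep _ (J F1)); [exact: measurable_site_preimage..|exact: dep|].
apply: depends_onS (dep _ _ sB) => i [f F2f [t _ ti]] [e F1e [s _ si]].
(* A toss read by both families belongs to one even vertex, which is an endpoint of an edge in each,
   contrary to their distance. *)
have /(pcan_inj pickleK)[ef _] : pickle (even_end e, s) = pickle (even_end f, t).
  by rewrite -[LHS]/(site_bits (even_end e) s) si -ti.
have := le_trans F12 (edges_dist_share F1e F2f (even_end_endpoint e) _).
by rewrite ef => /(_ (even_end_endpoint f)); rewrite lee_fin ler10.
Qed.

Lemma site_model_Pa : Pa (dyadic R bs) site_model.
Proof.
split; [exact: site_model_associated|exact: site_model_independent|move=> e].
rewrite -(prE _ (measurable_is_open e)) pr_site_model lee_fin.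
by rewrite -(pr_site_open (even_end e)).
Qed.

End SiteModel.

(** * Non-percolation of the site model *)

Lemma pr_bigsetU d (T : measurableType d) (R : realType) (P : probability T R)
    (I : Type) (s : seq I) (Q : pred I) (F : I -> set T) :
  (forall i, measurable (F i)) ->
  pr P (\big[setU/set0]_(i <- s | Q i) F i) <= \sum_(i <- s | Q i) pr P (F i).
Proof.
move=> mF.
suff [] : measurable (\big[setU/set0]_(i <- s | Q i) F i) /\
  pr P (\big[setU/set0]_(i <- s | Q i) F i) <= \sum_(i <- s | Q i) pr P (F i) by [].
apply: (big_ind2 (fun A c => measurable A /\ pr P A <= c)) => [|A a B b [mA Aa] [mB Bb]|i _].
- by rewrite pr0.
- split; first exact: measurableU.
  apply: le_trans (lerD Aa Bb); rewrite -lee_fin EFinD !prE//; last exact: measurableU.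
  exact: measureU2.
- by split.
Qed.

Lemma card_le_pairs n : (#|[set u : 'I_n * 'I_n | (u.1 <= u.2)%N]%SET| * 2 = n * n.+1)%N.
Proof.
set A := [set u | _]%SET; pose B : {set 'I_n * 'I_n} := [set u : 'I_n * 'I_n | (u.2 <= u.1)%N]%SET.
have AB : #|A| = #|B|.
  have sw : injective (fun u : 'I_n * 'I_n => (u.2, u.1)) by move=> [? ?] [? ?] [-> ->].
  rewrite -(card_imset _ sw); apply: eq_card => -[i j]; rewrite inE/=.
  apply/imsetP/idP => [[[k l]]|ij]; first by rewrite inE/= => kl [-> ->].
  by exists (j, i); rewrite ?inE.
have AIB : #|(A :&: B)%SET| = n.
  have dg : injective (fun i : 'I_n => (i, i)) by move=> ? ? [].
  rewrite -[RHS]card_ord -(card_codom dg); apply: eq_card => -[i j].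
  rewrite !inE/= -eqn_leq; apply/eqP/codomP => [/val_inj ->|[k [-> ->]]//].
  by exists j.
have AUB : (A :|: B)%SET = [set: 'I_n * 'I_n]%SET.
  by apply/setP => -[i j]; rewrite !inE/= leq_total.
have := cardsUI A B; rewrite AUB AIB -AB cardsT card_prod card_ord; lia.
Qed.

Section NonPercolation.
Context (n : nat) (bs : seq bool) (R : realType).
Local Notation V := 'rV[int]_n.
Local Notation pr := (pr (coin R)).
Local Notation p := (dyadic R bs).
Implicit Types (x y z : V) (k : nat).

Let even_bit (z : V) b : set bits := @site_open n bs (z, b).

Local Notation pairs := ([set u : 'I_n * 'I_n | (u.1 <= u.2)%N]%SET).

(* Contains the event that an open path of length 2k starts at the even vertex z. The
   two paths of length 2 with the same end depend on the same two bits, hence the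
   restriction to pairs u.1 <= u.2. *)
Fixpoint double_steps k z : set bits :=
  if k is k'.+1 then \big[setU/set0]_(u in pairs)
    (even_bit z true `&` (even_bit (z + unitv u.1 + unitv u.2) false `&`
      double_steps k' (z + unitv u.1 + unitv u.2)))
  else setT.

Lemma measurable_double_steps k z : measurable (double_steps k z).
Proof.
elim: k z => [|k IH] z /=; first exact: measurableT.
apply: bigsetU_measurable => u _.
by apply: measurableI; [|apply: measurableI] => //; exact: measurable_site_open.
Qed.

(** The tosses that [double_steps] from [z] may read. The incoming bit of [z] is left out, so it is
    independent of the continuation from [z]. *)
Definition later_bits z : set nat := [set i | exists (v : V) b t,
  i = @site_bits n (v, b) t /\ (level z < level v \/ v = z /\ b)].

Lemma depends_on_even_bit z b : depends_on (range (@site_bits n (z, b))) (even_bit z b).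
Proof. exact: depends_on_threshold. Qed.

Lemma depends_onI J A B : depends_on J A -> depends_on J B -> depends_on J (A `&` B).
Proof. by move=> dA dB w w' e [/(dA _ _ e) Aw /(dB _ _ e) Bw]. Qed.

Lemma level_step2 z i j : level (z + unitv i + unitv j) = level z + 2.
Proof. by rewrite !level_step -addrA. Qed.

Lemma depends_on_double_steps k z : depends_on (later_bits z) (double_steps k z).
Proof.
elim: k z => [|k IH] z //=.
apply: (big_ind (depends_on (later_bits z))) => [//|A B|u _]; first exact: depends_onU.
have lz := level_step2 z u.1 u.2.
apply: depends_onI; [|apply: depends_onI].
- apply: depends_onS (@depends_on_even_bit z true) => _ [t _ <-].
  by exists z, true, t; split=> //; right.
- apply: depends_onS (@depends_on_even_bit (z + unitv u.1 + unitv u.2) false) => _ [t _ <-].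
  by eexists; exists false, t; split=> //; left; rewrite lz; lia.
- apply: depends_onS (IH _) => _ [v [b [t [-> vz]]]].
  exists v, b, t; split=> //; left; case: vz => [|[-> _]]; rewrite lz; lia.
Qed.

Lemma site_bits_eq (u v : V * bool) s t : @site_bits n u s = @site_bits n v t -> u = v.
Proof. by move=> /(pcan_inj pickleK)[]. Qed.

Lemma pr_double_steps k z :
  pr (double_steps k z) <= (p ^+ 2 * (n * n.+1)%:R / 2) ^+ k.
Proof.
elim: k z => [|k IH] z; first by rewrite expr0 /= prT.
have /andP[p0 _] := dyadic_bounds R bs.
rewrite [double_steps _ _]/=; set r : R := _ / 2.
have r0 : 0 <= r by rewrite divr_ge0// mulr_ge0// exprn_ge0.
apply: le_trans (pr_bigsetU _ _ _ _) _ => [u|].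
  by apply: measurableI; [|apply: measurableI];
    [exact: measurable_site_open..|exact: measurable_double_steps].
apply: (@le_trans _ _ (\sum_(u in pairs) p ^+ 2 * r ^+ k)).
  apply: ler_sum => u _; set z' := z + _ + _.
  have lz : level z' = level z + 2 by exact: level_step2.
  have mE : measurable (double_steps k z') by exact: measurable_double_steps.
  have mz b v : measurable (even_bit v b) by exact: measurable_site_open.
  have iB : pr (even_bit z' false `&` double_steps k z') =
      pr (even_bit z' false) * pr (double_steps k z').
    apply: coin_indep => //; first exact: depends_on_even_bit.
    apply: depends_onS (@depends_on_double_steps k z').
    move=> _ [v [b [t [-> h]]]] [s _ /site_bits_eq[vz bf]].
    by case: h => [|[_]]; [rewrite -vz ltxx|rewrite -bf].
  have -> : pr (even_bit z true `&` (even_bit z' false `&` double_steps k z')) =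
      pr (even_bit z true) * pr (even_bit z' false `&` double_steps k z').
    apply: coin_indep => //; first exact: measurableI; first exact: depends_on_even_bit.
    apply: depends_onI.
      apply: depends_onS (@depends_on_even_bit z' false).
      move=> _ [t _ <-] [s _ /site_bits_eq[zz']].
      by have := lz; rewrite -zz'; lia.
    apply: depends_onS (@depends_on_double_steps k z').
    move=> _ [v [b [t [-> h]]]] [s _ /site_bits_eq[vz _]].
    by move: lz; case: h => [|[<- _]]; rewrite -vz; lia.
  rewrite iB !pr_site_open expr2 -mulrA ler_wpM2l// ler_wpM2l//; exact: IH.
rewrite sumr_const -mulr_natl (exprS r) mulrA ler_wpM2r ?exprn_ge0//.
have := card_le_pairs n; rewrite /r => <-; rewrite natrM; lra.
Qed.

Lemma lattice_arcP x y : lattice_arc x y -> exists i, y = x + unitv i.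
Proof.
move=> /andP[/eqP s1 /forallP le].
have [i xi] : exists i, x 0 i != y 0 i.
  apply/existsP/contraT; rewrite negb_exists => /forallP h.
  move: s1; rewrite big1 // => i _; have := h i; rewrite negbK => /eqP ->.
  by rewrite subrr normr0.
move: s1; rewrite (bigD1 i)//= => s1.
have r0 : 0 <= \sum_(j | j != i) `|x 0 j - y 0 j| by exact: sumr_ge0.
have xi0 : 0 < `|x 0 i - y 0 i| by rewrite normr_gt0 subr_eq0.
have S0 : \sum_(j | j != i) `|x 0 j - y 0 j| = 0.
  by move: (\sum_(j | _) _) (`|_|) s1 r0 xi0 => S d; lia.
rewrite S0 addr0 in s1.
have /psumr_eq0P zr := S0.
exists i; apply/rowP => j; rewrite !mxE eqxx/=.
have [->|ji] := eqVneq j i; last first.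
  by have /eqP := zr (fun _ _ => normr_ge0 _) j ji; rewrite normr_eq0 subr_eq0 addr0 => /eqP.
by have := le i; lia.
Qed.

Lemma open_stepP (w : bits) x y :
  open_step (site_config bs w : config (dlattice n)) x y ->
  exists i, y = x + unitv i /\
    if odd `|level x| then even_bit y false w else even_bit x true w.
Proof.
rewrite /open_step; case: insubP => //= e xy ve.
have [i yE] := lattice_arcP xy; move=> h; exists i; split=> //.
have ve' : val (e : edge (dlattice n)) = (x, y) := ve.
move: h; rewrite /site_config /even_end ve' /=.
by case: ifP.
Qed.

Lemma double_steps_path k z s (w : bits) : ~~ odd `|level z| ->
  path (open_step (site_config bs w : config (dlattice n))) z s -> (k.*2 <= size s)%N ->
  double_steps k z w.
Proof.
elim: k z s => [//|k IH] z [|x [|y s]]//= ez.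
move=> /and3P[/open_stepP[i [-> ]]]; rewrite (negbTE ez) => zt.
move=> /open_stepP[j [-> ]]; rewrite level_step.
have -> : odd `|level z + 1| by move: ez; lia.
move=> zf ps; rewrite doubleS !ltnS => sk.
have ds : double_steps k (z + unitv i + unitv j) w.
  by apply: IH ps sk; rewrite level_step2; move: ez; lia.
rewrite (bigD1 (if (i <= j)%N then (i, j) else (j, i)))/=; last first.
  by rewrite inE; case: (leqP i j) => //= /ltnW.
left; have zE : z + unitv i + unitv j =
    z + unitv (if (i <= j)%N then (i, j) else (j, i)).1 +
    unitv (if (i <= j)%N then (i, j) else (j, i)).2.
  by case: ifP => //= _; rewrite addrAC.
by rewrite -zE.
Qed.

(** The union covers an odd start: its first step leads to an even vertex, at the harmless cost of a
    factor n. *)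
Definition long_paths k x : set bits := double_steps k x `|`
  \big[setU/set0]_(i < n) double_steps k (x + unitv i).

Lemma measurable_long_paths k x : measurable (long_paths k x).
Proof.
apply: measurableU; first exact: measurable_double_steps.
by apply: bigsetU_measurable => i _; exact: measurable_double_steps.
Qed.

Lemma infinite_reachable_long_path (w : config (dlattice n)) x N :
  infinite_set (reachable w x) ->
  exists2 s : seq V, path (open_step w) x s & (N <= size s)%N.
Proof.
move=> inf; apply: contrapT => nos; apply: inf.
(* Without long paths, every reachable vertex is the end of one of finitely many words. *)
apply: (@sub_finite_set _ _ [set endp x c | c in [set: {bseq N of 'I_n}]]); last first.
  exact/finite_image/finite_finset.
move=> y [s ps <-].
have sN : (size s <= N)%N by rewrite leqNgt; apply/negP => /ltnW h; apply: nos; exists s.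
have [c cs <-] : exists2 c : seq 'I_n, size c = size s & endp x c = last x s.
  elim: s x ps {sN nos} => [|y' s IH] x /=; first by exists [::].
  move=> /andP[xy /IH[c cs ce]].
  have [i yE] : exists i, y' = x + unitv i.
    by move: xy; rewrite /open_step; case: insubP => //= e /lattice_arcP.
  by exists (i :: c); rewrite /= ?cs -?yE.
rewrite -cs in sN; exists (Bseq sN) => //.
Qed.

Lemma long_paths_infinite (w : bits) x k :
  infinite_set (reachable (site_config bs w : config (dlattice n)) x) -> long_paths k x w.
Proof.
move=> /infinite_reachable_long_path-/(_ k.*2.+1)[[|y s]//= /andP[xy ps] sk].
have [ox|ex] := boolP (odd `|level x|); last first.
  by left; apply: (@double_steps_path _ _ (y :: s)) => //=; [rewrite xy|exact: leqW].
have [i [yE _]] := open_stepP xy; right; rewrite (bigD1 i)//=; left; rewrite -yE.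
by apply: double_steps_path ps _ => //; rewrite yE level_step; move: ox; lia.
Qed.

Lemma pr_long_paths k x :
  pr (long_paths k x) <= n.+1%:R * (p ^+ 2 * (n * n.+1)%:R / 2) ^+ k.
Proof.
have mU : measurable (\big[setU/set0]_(i < n) double_steps k (x + unitv i)).
  by apply: bigsetU_measurable => i _; exact: measurable_double_steps.
have m0 := measurable_double_steps k x.
apply: (@le_trans _ _ (pr (double_steps k x) +
    pr (\big[setU/set0]_(i < n) double_steps k (x + unitv i)))).
  by rewrite -lee_fin EFinD !prE//; [exact: measureU2|exact: measurableU].
rewrite -nat1r mulrDl mul1r lerD ?pr_double_steps//.
apply: le_trans (pr_bigsetU _ _ _ _) _ => [i|]; first exact: measurable_double_steps.
rewrite -[n in n%:R]card_ord mulr_natl -sumr_const; apply: ler_sum => i _.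
exact: pr_double_steps.
Qed.

Lemma site_model_not_percolates : p ^+ 2 * (n * n.+1)%:R / 2 < 1 ->
  ~ percolates (site_model n bs R).
Proof.
set r : R := _ / 2 => r1.
have /andP[p0 _] := dyadic_bounds R bs.
have r0 : 0 <= r by rewrite divr_ge0// mulr_ge0// exprn_ge0.
pose H x := \bigcap_k long_paths k x.
have mH x : measurable (H x).
  by apply: bigcapT_measurable => k; exact: measurable_long_paths.
have H0 x : coin R (H x) = 0%E.
  rewrite -prE//; congr EFin; apply/eqP; rewrite eq_le pr_ge0 andbT leNgt; apply/negP => c0.
  have le k : pr (H x) <= n.+1%:R * r ^+ k.
    apply: le_trans (pr_long_paths k x); apply: le_pr => //.
      exact: measurable_long_paths.
    by move=> w; exact.
  have [rE|rn0] := eqVneq r 0; first by have := le 1%N; rewrite rE expr1 mulr0 leNgt c0.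
  have rgt0 : 0 < r by rewrite lt_def rn0.
  have [k] := @expr_unbounded R (n.+2%:R / pr (H x)) r^-1 ltac:(by rewrite invf_gt1).
  rewrite exprVn ler_pdivrMr// => h.
  have : (r ^+ k)^-1 * pr (H x) <= n.+1%:R.
    by rewrite ler_pdivrMl ?exprn_gt0// mulrC.
  by move=> /(le_trans h); rewrite ler_nat ltnn.
rewrite /percolates -/(@percolation_event (dlattice n)); apply/negP.
rewrite -leNgt [leLHS](_ : _ = coin R (site_config bs @^-1` @percolation_event (dlattice n)))//.
have mF k : measurable (if @unpickle V k is Some x then H x else set0).
  by case: (unpickle k) => [x|]; [exact: mH|exact: measurable0].
apply: (@le_trans _ _ (coin R (\bigcup_k
    (if @unpickle V k is Some x then H x else set0)))).
  apply: le_measure; rewrite ?inE.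
  - apply: measurable_site_preimage; exact: (@measurable_percolation (dlattice n)).
  - exact: bigcupT_measurable.
  - move=> w [x infx]; exists (pickle x) => //; rewrite pickleK => k _.
    exact: long_paths_infinite.
have /(negligibleP _ (bigcupT_measurable _ mF)) -> // : (coin R).-negligible
    (\bigcup_k (if @unpickle V k is Some x then H x else set0)).
apply: negligible_bigcup => k; apply/(negligibleP _ (mF k)).
by case: (unpickle k) => [x|]; [exact: H0|exact: measure0].
Qed.

End NonPercolation.

(** * The critical value *)

Lemma Pa_le (G : digraph) (R : realType) (p q : R) (P : probability (config G) R) :
  p <= q -> Pa q P -> Pa p P.
Proof. by move=> pq [h1 h2 h3]; split=> // e; apply: le_trans (h3 e); rewrite lee_fin. Qed.

Section CriticalProbability.
Context (R : realType) (n : nat).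

Let S := [set p : R | 0 <= p <= 1 /\
  exists2 P : probability (config (dlattice n)) R, Pa p P & ~ percolates P].

Let S_dyadic bs : dyadic R bs ^+ 2 * (n * n.+1)%:R / 2 < 1 -> S (dyadic R bs).
Proof.
move=> h; split; first exact: dyadic_bounds.
exists (site_model n bs R); first exact: site_model_Pa.
exact: site_model_not_percolates.
Qed.

Let S0 : S 0.
Proof. by apply: (@S_dyadic [::]); rewrite /= expr0n/= !mul0r ltr01. Qed.

(** Site models are built only for dyadic densities; a dyadic number just below [s] satisfies the
    same inequality. *)
Lemma pa_plus_ge (s : R) : 0 <= s <= 1 -> s ^+ 2 * (n * n.+1)%:R / 2 < 1 ->
  s <= pa_plus R (dlattice n).
Proof.
move=> /andP[s0 s1] sn; have hS : has_sup S.
  by split; [exists 0|exists 1 => p [/andP[]]].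
apply/ler_addgt0Pr => e e0.
have [h eh] := @expr_unbounded R e^-1 2 ltac:(lra).
have he : 2^-1 ^+ h <= e.
  by rewrite exprVn -[leRHS]invrK lef_pV2 ?posrE ?invr_gt0 ?exprn_gt0.
have [bs _ /andP[bs_s s_bs]] := @dyadic_near R h s ltac:(by rewrite s0).
have /andP[b0 _] := dyadic_bounds R bs.
have : dyadic R bs <= pa_plus R (dlattice n).
  apply: (ub_le_sup hS.2); apply: S_dyadic; apply: le_lt_trans sn.
  by rewrite ler_pM2r// ler_wpM2r// ler_sqr ?nnegrE.
lra.
Qed.

Lemma pa_plus_le (q : R) :
  (forall P : probability (config (dlattice n)) R, Pa q P -> percolates P) ->
  pa_plus R (dlattice n) <= q.
Proof.
move=> hq; apply: ge_sup; first by exists 0.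
move=> p [_ [P pP nP]]; rewrite leNgt; apply/negP => /ltW qp; apply: nP.
exact/hq/(Pa_le qp).
Qed.

End CriticalProbability.

Theorem theorem3 (R : realType) :
  exists2 eps : nat -> R, eps n @[n --> \oo] --> (0 : R) &
    forall n : nat, (0 < n)%N ->
      pa_plus R (dlattice n) = Num.sqrt 2 / n%:R * (1 + eps n).
Proof.
have s2 : 0 < Num.sqrt 2 :> R by rewrite sqrtr_gt0.
have s22 : Num.sqrt 2 ^+ 2 = 2 :> R by rewrite sqr_sqrtr.
exists (fun n => pa_plus R (dlattice n) * n%:R / Num.sqrt 2 - 1); last first.
  move=> n n0; have nn : n%:R != 0 :> R by rewrite pnatr_eq0 -lt0n.
  by field; rewrite nn gt_eqF.
apply/cvgrPdist_le => e e0; pose de : R := Num.min e 2^-1.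
have de0 : 0 < de by rewrite lt_min e0 invr_gt0 ltr0n.
have de2 : de <= 2^-1 by rewrite ge_min lexx orbT.
have dee : de <= e by rewrite ge_min lexx.
have [n1 up] := @percolates_above R de de0.
exists (maxn n1 (maxn 2 (Num.truncn de^-1).+1)) => // n /=.
rewrite !geq_max => /and3P[n1n n2 dn].
have n0 : 0 < n%:R :> R by rewrite ltr0n; exact: leq_trans n2.
have n2' : 2 <= n%:R :> R by rewrite ler_nat.
have den : 1 <= de * n%:R.
  rewrite -ler_pdivrMl// mulr1; apply: le_trans (ltW (truncnS_gt _)) _.
  by rewrite ler_nat.
have {}up := pa_plus_le (up n n1n).
have low : (1 - de) * Num.sqrt 2 / n%:R <= pa_plus R (dlattice n).
  apply: pa_plus_ge.
    have s2le : Num.sqrt 2 <= 2 :> R by nra.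
    rewrite divr_ge0//=; last by apply: mulr_ge0; lra.
    by rewrite ler_pdivrMr// mul1r; nra.
  rewrite expr_div_n exprMn s22 natrM -[n.+1%:R]natr1.
  have -> : (1 - de) ^+ 2 * 2 / n%:R ^+ 2 * (n%:R * (n%:R + 1)) / 2 =
      (1 - de) ^+ 2 * (n%:R + 1) / n%:R by field; rewrite gt_eqF.
  rewrite ltr_pdivrMr// mul1r; move: (n%:R) n0 n2' den => N n0 n2' den.
  (* Since 1 <= de N, (1 - de)^2 (N + 1) <= (1 - de)(1 - de^2) N < N. *)
  have : 0 < N * de ^+ 2 by rewrite mulr_gt0// exprn_gt0.
  nra.
rewrite sub0r normrN; apply: le_trans dee.
rewrite ler_pdivrMr// in low; rewrite ler_pdivlMr// in up.
rewrite ler_norml; apply/andP; split.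
  by rewrite lerBrDr ler_pdivlMr//; lra.
by rewrite lerBlDr ler_pdivrMr//; lra.
Qed.
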